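(* Let $\mathbb{K}$ be a field, let $h\ge1$ and $n_1,n_2\ge 2$ be integers, and let $\mathbf{a}_1,\mathbf{d}_1,\mathbf{a}_2,\mathbf{d}_2\in\mathbb{N}^4$ be linearly independent over $\mathbb{Q}$. Let $\mathfrak{S}_2$ be the join of the affine semigroups generated by $S_i=\{\mathbf{a}_i,h\mathbf{a}_i+\mathbf{d}_i,\dots,h\mathbf{a}_i+n_i\mathbf{d}_i\}$, $i=1,2$, and let $I_{\mathfrak{S}_2}\subset\mathbb{K}[x_1,\dots,x_{n_1+n_2+2}]$ be the defining ideal of $\mathbb{K}[\mathfrak{S}_2]$. Put $$P_1=\begin{pmatrix}x_1^h&x_2&\cdots&x_{n_1}\\ x_2&x_3&\cdots&x_{n_1+1}\end{pmatrix},\qquad P_2=\begin{pmatrix}x_{n_1+2}^h&x_{n_1+3}&\cdots&x_{n_1+n_2+1}\\ x_{n_1+3}&x_{n_1+4}&\cdots&x_{n_1+n_2+2}\end{pmatrix}.$$ Then: (1) $I_{\mathfrak{S}_2}=I_2(P_1)+I_2(P_2)$. (2) The maximal minors of the matrices $P_1$ and $P_2$ form a minimal Gröbner basis of $I_{\mathfrak{S}_2}$ with respect to the negative degree reverse lexicographic ordering induced by $$x_2>x_3>\dots>x_{n_1}>x_{n_1+3}>\dots>x_{n_1+n_2+1}>x_1>x_{n_1+1}>x_{n_1+2}>x_{n_1+n_2+2}.$$ (3) $\mathbb{K}[\mathfrak{S}_2]$ is Koszul. (4) The tensor product of the Eagon-Northcott complexes of $P_1$ and $P_2$ gives a minimal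 graded free resolution of $I_{\mathfrak{S}_2}$.
   Context: $\mathfrak{S}_2=\langle S_1\cup S_2\rangle\subset\mathbb{N}^4$ is the semigroup (containing $0$) generated by $S_1\cup S_2$. $\mathbb{K}[\mathfrak{S}_2]$ is the subalgebra of $\mathbb{K}[t_1,\dots,t_4]$ spanned by the monomials $\mathbf{t}^\gamma$, $\gamma\in\mathfrak{S}_2$. The defining ideal is the kernel of the $\mathbb{K}$-algebra map $R:=\mathbb{K}[x_1,\dots,x_{n_1+n_2+2}]\to\mathbb{K}[\mathfrak{S}_2]$ with $x_1\mapsto\mathbf{t}^{\mathbf{a}_1}$, $x_{i+1}\mapsto\mathbf{t}^{h\mathbf{a}_1+i\mathbf{d}_1}$ ($1\le i\le n_1$), $x_{n_1+2}\mapsto\mathbf{t}^{\mathbf{a}_2}$, $x_{n_1+2+j}\mapsto\mathbf{t}^{h\mathbf{a}_2+j\mathbf{d}_2}$ ($1\le j\le n_2$); $R$ is $\mathbb{N}^4$-graded accordingly. $I_2(P)$ is the ideal generated by the $2\times2$ (maximal) minors of $P$. In the negative degree reverse lexicographic ordering, $m>m'$ if $\deg m<\deg m'$ (standard total degree), or if the degrees agree and $m>m'$ in the reverse lexicographic order for the given order of variables (i.e. the smallest variable whose exponents in $m$ and $m'$ differ has smaller exponent in $m$). A finite set $G\subset I\setminus\{0\}$ is a Gröbner basis of $I$ if the leading monomials of its elements generate the ideal generated by all leading monomials of non-zero elements of $I$; it is minimal if no leading monomial of an element of $G$ divides that of another. $\mathbb{K}[\mathfrak{S}_2]$ being Koszul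 means that its associated graded ring $\bigoplus_{i\ge0}\mathfrak{m}^i/\mathfrak{m}^{i+1}$, with $\mathfrak{m}$ the ideal generated by the images of all the variables, is a Koszul $\mathbb{K}$-algebra (the field $\mathbb{K}$ has a linear free resolution over it); for $h=1$ this graded ring is $\mathbb{K}[\mathfrak{S}_2]$ itself with its standard grading. For a $2\times f$ matrix $P$ representing $\alpha:F=R^f\to G=R^2$, the Eagon-Northcott complex is $$0\to(\mathrm{Sym}_{f-2}G)^*\otimes\wedge^fF\to\cdots\to G^*\otimes\wedge^3F\to\wedge^2F\xrightarrow{\wedge^2\alpha}\wedge^2G$$ with the standard differentials. As usual, the resolution in (4) is a resolution of the cyclic module $R/I_{\mathfrak{S}_2}$. *)

(* Defs.v *)
From HB Require Import structures.
From mathcomp Require Import all_boot all_algebra.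
From mathcomp Require Import ring_quotient.
From mathcomp Require Import mpoly.
From mathcomp Require Import boolp.

Set Implicit Arguments.
Unset Strict Implicit.
Unset Printing Implicit Defensive.

Import GRing.Theory.
Local Open Scope ring_scope.
Local Open Scope quotient_scope.

Section Ideals.
Variable A : comPzRingType.
Implicit Types (I J G : A -> Prop).

Definition ideal_span G : A -> Prop := fun x =>
  exists n (c g : 'I_n -> A), (forall i, G (g i)) /\ x = \sum_i c i * g i.

Definition ideal_add I J : A -> Prop := fun x =>
  exists u v, [/\ I u, J v & x = u + v].

Definition ideal_mul I J : A -> Prop :=
  ideal_span (fun z => exists u v, [/\ I u, J v & z = u * v]).

Fixpoint ideal_pow I i : A -> Prop :=
  if i is j.+1 then ideal_mul I (ideal_pow I j) else fun _ => True.

Lemma ideal_span0 G : ideal_span G 0.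
Proof.
exists 0%N, (fun _ => 0), (fun _ => 0); split; first by case.
by rewrite big_ord0.
Qed.

Lemma ideal_spanD G x y : ideal_span G x -> ideal_span G y ->
  ideal_span G (x + y).
Proof.
move=> [n [c [g [Gg ->]]]] [n' [c' [g' [Gg' ->]]]].
exists (n + n')%N,
  (fun i => match split i with inl j => c j | inr j => c' j end),
  (fun i => match split i with inl j => g j | inr j => g' j end).
split; first by move=> i; case: (split i).
rewrite big_split_ord /=; congr (_ + _); apply: eq_bigr => i _.
  by rewrite (unsplitK (inl i)).
by rewrite (unsplitK (inr i)).
Qed.

Lemma ideal_spanM G a x : ideal_span G x -> ideal_span G (a * x).
Proof.
move=> [n [c [g [Gg ->]]]]; exists n, (fun i => a * c i), g; split=> //.
by rewrite mulr_sumr; apply: eq_bigr => i _; rewrite mulrA.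
Qed.

Lemma ideal_span_sub G x : G x -> ideal_span G x.
Proof.
move=> Gx; exists 1%N, (fun _ => 1), (fun _ => x); split=> //.
by rewrite big_ord1 mul1r.
Qed.

Lemma ideal_span_min G I : I 0 -> (forall x y, I x -> I y -> I (x + y)) ->
  (forall a x, G x -> I (a * x)) -> forall x, ideal_span G x -> I x.
Proof.
move=> I0 ID IM x [n [c [g [Gg ->]]]].
by elim/big_rec: _ => // i y _ Iy; apply: ID => //; apply: IM.
Qed.

Lemma ideal_pow0 I i : ideal_pow I i 0.
Proof. by case: i => [|i] //; apply: ideal_span0. Qed.

Lemma ideal_powD I i x y : ideal_pow I i x -> ideal_pow I i y ->
  ideal_pow I i (x + y).
Proof. by case: i => [|i] //; apply: ideal_spanD. Qed.

Lemma ideal_powMl I i a x : ideal_pow I i x -> ideal_pow I i (a * x).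
Proof. by case: i => [|i] //; apply: ideal_spanM. Qed.

Lemma ideal_powN I i x : ideal_pow I i x -> ideal_pow I i (- x).
Proof. by rewrite -mulN1r; apply: ideal_powMl. Qed.

Lemma ideal_pow_sum I i (T : Type) (r : seq T) (P : pred T) (F : T -> A) :
  (forall t, ideal_pow I i (F t)) -> ideal_pow I i (\sum_(t <- r | P t) F t).
Proof.
by move=> H; elim/big_ind: _; [exact: ideal_pow0 | exact: ideal_powD | ].
Qed.

Lemma ideal_powM I i j x y : ideal_pow I i x -> ideal_pow I j y ->
  ideal_pow I (i + j) (x * y).
Proof.
elim: i x => [|i IHi] x; first by move=> _; rewrite add0n; apply: ideal_powMl.
rewrite addSn => Ix Iy; move: x Ix.
apply: (ideal_span_min (I := fun x => ideal_pow I (i + j).+1 (x * y))).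
- by rewrite mul0r; apply: ideal_span0.
- by move=> u v Hu Hv; rewrite mulrDl; apply: ideal_spanD.
- move=> a _ [u [v [Iu Iv ->]]]; rewrite -mulrA; apply: ideal_spanM.
  apply: ideal_span_sub; exists u, (v * y); split=> //; last by rewrite mulrA.
  exact: IHi.
Qed.

End Ideals.

(* The associated graded ring gr_m(A) = (+)_i m^i / m^(i+1), realised as the *)
(* quotient of the Rees ring (+)_i m^i T^i, a subring of A[T], by its ideal  *)
(* (+)_i m^(i+1) T^i. *)
Section AssociatedGraded.
Variables (A : comNzRingType) (m : A -> Prop).

Definition rees_pred : {pred {poly A}} :=
  fun p : {poly A} => `[< forall i, ideal_pow m i p`_i >].

Lemma reesP (p : {poly A}) : reflect (forall i, ideal_pow m i p`_i) (p \in rees_pred).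
Proof. exact: asboolP. Qed.

Lemma rees_subring : subring_closed rees_pred.
Proof.
split=> [|p q /reesP pR /reesP qR|p q /reesP pR /reesP qR].
- apply/reesP => i; rewrite coef1; case: i => [|i] //; exact: (@ideal_pow0 _ _ i.+1).
- apply/reesP => i; rewrite coefB.
  by apply: ideal_powD; last apply: ideal_powN.
- apply/reesP => i; rewrite coefM; apply: ideal_pow_sum => j.
  by rewrite -{1}(subnKC (leq_ord j)); apply: ideal_powM.
Qed.

HB.instance Definition _ := GRing.isSubringClosed.Build {poly A} rees_pred
  rees_subring.

Definition rees := {p : {poly A} | p \in rees_pred}.
HB.instance Definition _ := SubType.on rees.
HB.instance Definition _ := Choice.on rees.
HB.instance Definition _ := [SubChoice_isSubComNzRing of rees by <:].

Definition rees_shift : {pred rees} :=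
  fun p : rees => `[< forall i, ideal_pow m i.+1 (val p : {poly A})`_i >].

Lemma rees_shiftP (p : rees) :
  reflect (forall i, ideal_pow m i.+1 (val p : {poly A})`_i) (p \in rees_shift).
Proof. exact: asboolP. Qed.

Lemma rees_shift_zmod : zmod_closed rees_shift.
Proof.
split=> [|p q /rees_shiftP pR /rees_shiftP qR].
  by apply/rees_shiftP => i; rewrite raddf0 coef0; apply: ideal_pow0.
apply/rees_shiftP => i; rewrite raddfB coefB.
by apply: (@ideal_powD _ _ i.+1); last apply: (@ideal_powN _ _ i.+1).
Qed.

HB.instance Definition _ := GRing.isZmodClosed.Build rees rees_shift
  rees_shift_zmod.

Lemma rees_shiftM (p q : rees) : q \in rees_shift -> p * q \in rees_shift.
Proof.
move=> /rees_shiftP qR; apply/rees_shiftP => i; rewrite rmorphM coefM.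
apply: (@ideal_pow_sum _ _ i.+1) => j; have /reesP pR := valP p.
by rewrite -{1}(subnKC (leq_ord j)) -addnS; apply: ideal_powM.
Qed.

Definition gr := {ideal_quot rees_shift}.
HB.instance Definition _ := Choice.on gr.
HB.instance Definition _ := GRing.Zmodule.on gr.
HB.instance Definition _ := Quotient.on gr.

Definition gr_one : gr := \pi_gr (1 : rees).
Definition gr_mul (x y : gr) : gr := \pi_gr (repr x * repr y : rees).

Lemma gr_eqP (p q : rees) :
  reflect (\pi_gr p = \pi_gr q) (p - q \in rees_shift).
Proof. by rewrite Quotient.idealrBE; apply: eqP. Qed.

Lemma gr_piM (p q : rees) : gr_mul (\pi_gr p) (\pi_gr q) = \pi_gr (p * q).
Proof.
apply/gr_eqP; set p' := repr _; set q' := repr _.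
have -> : p' * q' - p * q = p' * (q' - q) + q * (p' - p).
  by rewrite !mulrBr [q * p']mulrC addrA subrK [q * p]mulrC.
by apply: rpredD; apply: rees_shiftM; apply/gr_eqP; rewrite reprK.
Qed.

Lemma gr_mulA : associative gr_mul.
Proof.
move=> x y z; rewrite -[x]reprK -[y]reprK -[z]reprK.
move: (repr x) (repr y) (repr z) => p q r.
by rewrite (gr_piM q r) (gr_piM p q) (gr_piM p) (gr_piM _ r) mulrA.
Qed.
Lemma gr_mulC : commutative gr_mul.
Proof.
move=> x y; rewrite -[x]reprK -[y]reprK; move: (repr x) (repr y) => p q.
by rewrite (gr_piM p q) (gr_piM q p) mulrC. Qed.
Lemma gr_mul1 : left_id gr_one gr_mul.
Proof. by move=> x; rewrite -[x]reprK (gr_piM 1) mul1r. Qed.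
Lemma gr_piD (p q : rees) : \pi_gr (p + q) = \pi_gr p + \pi_gr q.
Proof. exact: Quotient.pi_add. Qed.
Lemma gr_mulD : left_distributive gr_mul +%R.
Proof.
move=> x y z; rewrite -[x]reprK -[y]reprK -[z]reprK.
move: (repr x) (repr y) (repr z) => p q r.
by rewrite -(gr_piD p q) (gr_piM p r) (gr_piM q r) (gr_piM _ r) mulrDl gr_piD.
Qed.
HB.instance Definition _ := GRing.Zmodule_isComPzRing.Build gr
  gr_mulA gr_mulC gr_mul1 gr_mulD.

Definition gr_part (i : nat) : gr -> Prop := fun x =>
  exists (a : A) (p : rees), val p = a *: 'X^i /\ x = \pi_gr p.

Lemma polyC_rees (a : A) : a%:P \in rees_pred.
Proof.
by apply/reesP => -[|i]; rewrite coefC //=; apply: (@ideal_span0 A).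
Qed.

Definition gr_cst (a : A) : gr := \pi_gr (Sub a%:P (polyC_rees a) : rees).

Lemma gr_cst_zmod : zmod_morphism gr_cst.
Proof.
move=> a b; apply/eqP; rewrite eq_sym subr_eq eq_sym; apply/eqP.
rewrite -gr_piD; congr (\pi_gr _); apply: val_inj.
by rewrite /= rmorphB subrK.
Qed.
Lemma gr_cst_monoid : monoid_morphism gr_cst.
Proof.
split=> [|a b].
  by congr (\pi_gr _); apply: val_inj; rewrite /= rmorph1.
rewrite [RHS]gr_piM; congr (\pi_gr _); apply: val_inj.
by rewrite /= rmorphM.
Qed.
HB.instance Definition _ := GRing.isZmodMorphism.Build A gr gr_cst gr_cst_zmod.
HB.instance Definition _ := GRing.isMonoidMorphism.Build A gr gr_cst
  gr_cst_monoid.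

End AssociatedGraded.

(* Koszul algebras; [A_ i] is the homogeneous component of degree i of A.    *)
(* The i-th free module is A(-i)^(b i), its elements are row vectors, and    *)
(* D i acts by right multiplication. *)
Section Koszul.
Variables (K : fieldType) (A : comPzRingType).
Variables (iota : {rmorphism K -> A}) (A_ : nat -> A -> Prop).

Definition irrelevant_ideal : A -> Prop :=
  ideal_span (fun x => exists2 i, (0 < i)%N & A_ i x).

Definition linear_resolution (b : nat -> nat)
    (D : forall i, 'M[A]_(b i.+1, b i)) : Prop :=
  [/\ b 0%N = 1%N,
      forall i j k, A_ 1 (D i j k),
      forall x : 'rV[A]_(b 0%N),
        (forall j, irrelevant_ideal (x 0 j)) <-> exists w, x = w *m D 0%N
    & forall i (x : 'rV[A]_(b i.+1)),
        x *m D i = 0 <-> exists w, x = w *m D i.+1].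

Definition koszul : Prop :=
  [/\ injective iota,
      forall x, A_ 0%N x <-> exists c, x = iota c
    & exists b D, @linear_resolution b D].

End Koszul.

Section SemigroupAlgebra.
Variables (K : fieldType) (n : nat) (S : 'X_{1..n} -> Prop).

Inductive semigroup_gen : 'X_{1..n} -> Prop :=
| Semigroup0 : semigroup_gen 0%MM
| SemigroupD s m of S s & semigroup_gen m : semigroup_gen (s + m)%MM.

Lemma semigroup_genD m m' : semigroup_gen m -> semigroup_gen m' ->
  semigroup_gen (m + m')%MM.
Proof.
elim=> [|s u Ss _ IH] Hm'; first by rewrite add0m.
by rewrite -addmA; apply: SemigroupD; last exact: IH.
Qed.

Definition ksg_pred : {pred {mpoly K[n]}} :=
  fun p => `[< forall m, m \in msupp p -> semigroup_gen m >].

Lemma ksgP (p : {mpoly K[n]}) :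
  reflect (forall m, m \in msupp p -> semigroup_gen m) (p \in ksg_pred).
Proof. exact: asboolP. Qed.

Lemma ksg_subalg : subalg_closed ksg_pred.
Proof.
split=> [|c p q /ksgP pS /ksgP qS|p q /ksgP pS /ksgP qS]; apply/ksgP => m.
- by rewrite msupp1 inE => /eqP ->; apply: Semigroup0.
- by move=> /msuppD_le; rewrite mem_cat => /orP[/msuppZ_le|] => [/pS|/qS].
- move=> /msuppM_le /allpairsP[[u v] /= [/pS Hu /qS Hv ->]].
  exact: semigroup_genD.
Qed.

HB.instance Definition _ :=
  GRing.isSubalgClosed.Build K {mpoly K[n]} ksg_pred ksg_subalg.

Definition ksg := {p : {mpoly K[n]} | p \in ksg_pred}.
HB.instance Definition _ := SubType.on ksg.
HB.instance Definition _ := Choice.on ksg.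
HB.instance Definition _ := [SubChoice_isSubAlgebra of ksg by <:].
HB.instance Definition _ :=
  GRing.SubNzRing_isSubComNzRing.Build {mpoly K[n]} ksg_pred ksg.

End SemigroupAlgebra.

Section GroebnerBases.
Variables (K : fieldType) (n : nat).
Implicit Types (gt : 'X_{1..n} -> 'X_{1..n} -> Prop) (f g : {mpoly K[n]}).
Implicit Types (m : 'X_{1..n}) (I : {mpoly K[n]} -> Prop).

(* [s] lists the variables in decreasing order, so a larger index in s means *)
(* a smaller variable.  This is a local order: lower degree is larger. *)
Definition neg_degrevlex_gt (s : seq 'I_n) m m' : Prop :=
  (mdeg m < mdeg m')%N \/
  (mdeg m = mdeg m' /\
   exists2 i, (m i < m' i)%N &
     forall j, (index i s < index j s)%N -> m j = m' j).

Definition is_lead gt f m : Prop :=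
  m \in msupp f /\ forall m', m' \in msupp f -> m' != m -> gt m m'.

Definition lead_ideal gt (F : {mpoly K[n]} -> Prop) : {mpoly K[n]} -> Prop :=
  ideal_span (fun v : {mpoly K[n]} =>
    exists f m, [/\ F f, is_lead gt f m & v = 'X_[m]]).

Definition groebner_basis gt I (G : seq {mpoly K[n]}) : Prop :=
  (forall g, g \in G -> I g /\ g != 0) /\
  (forall u, lead_ideal gt (fun g => g \in G) u <->
             lead_ideal gt (fun f => I f /\ f != 0) u).

Definition minimal_groebner_basis gt I (G : seq {mpoly K[n]}) : Prop :=
  groebner_basis gt I G /\
  forall g g' m m', g \in G -> g' \in G -> g != g' ->
    is_lead gt g m -> is_lead gt g' m' -> ~~ (m <= m')%MM.

End GroebnerBases.

Section Minors.
Variables (R : comNzRingType) (f : nat) (P : 'M[R]_(2, f)).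

Definition minor2 (i j : 'I_f) : R :=
  \det (colsub (fun k : 'I_2 => if k == 0 then i else j) P).

Definition minors : seq R :=
  [seq minor2 ij.1 ij.2 | ij : 'I_f * 'I_f <- enum {: 'I_f * 'I_f}
                        & (ij.1 < ij.2)%N].

Definition minors_ideal : R -> Prop := ideal_span (fun x => x \in minors).

End Minors.

(* A complex of finite free modules with a chosen homogeneous basis: the      *)
(* element b of [cbasis] lies in homological degree [cdeg b], and its image   *)
(* is the sum of the [cdiff b c] c. *)
Record based_complex (R : Type) := BasedComplex {
  cbasis : finType;
  cdeg : cbasis -> nat;
  cdiff : cbasis -> cbasis -> R
}.

Section Complexes.
Variable R : comNzRingType.

Definition cmap (C : based_complex R) (v : {ffun cbasis C -> R}) :
    {ffun cbasis C -> R} :=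
  [ffun c => \sum_b v b * cdiff b c].

Definition in_cdeg (C : based_complex R) k (v : {ffun cbasis C -> R}) : Prop :=
  forall b, v b != 0 -> cdeg b = k.

Definition is_complex (C : based_complex R) : Prop :=
  (forall b c : cbasis C, cdiff b c != 0 -> cdeg b = (cdeg c).+1) /\
  (forall v : {ffun cbasis C -> R}, cmap (cmap v) = 0).

(* C is a free resolution of R/I, where C_0 = R has the basis element b0. *)
Definition resolves (C : based_complex R) (I : R -> Prop) (b0 : cbasis C) :=
  [/\ is_complex C,
      forall b : cbasis C, cdeg b = 0%N <-> b = b0,
      forall r, I r <-> exists2 v : {ffun cbasis C -> R},
        in_cdeg 1 v & cmap v = [ffun b => if b == b0 then r else 0]
    & forall k (v : {ffun cbasis C -> R}), in_cdeg k.+1 v -> cmap v = 0 ->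
        exists2 w, in_cdeg k.+2 w & cmap w = v].

Definition tensor_complex (C D : based_complex R) : based_complex R :=
  @BasedComplex R (cbasis C * cbasis D)%type
    (fun x => cdeg x.1 + cdeg x.2)%N
    (fun x y => (x.2 == y.2)%:R * cdiff x.1 y.1
                + (-1) ^+ cdeg x.1 * ((x.1 == y.1)%:R * cdiff x.2 y.2)).

(* The Eagon-Northcott complex of a 2 x f matrix P.  [None] is the generator  *)
(* of /\^2 G = R.  For #|T| = k + 1 >= 2, [Some (a, T)] is the element        *)
(* g_0^(a) g_1^(k-1-a) (x) e_T of (Sym_(k-1) G)^* (x) /\^(k+1) F, the first   *)
(* factor being taken in the basis dual to the monomials in g_0, g_1 (the     *)
(* divided powers).  Contraction by g_r lowers the exponent of g_r by one     *)
(* (and is 0 when this exponent is 0), so d maps u (x) e_T to the sum over    *)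
(* r and i \in T of +/- P r i *: (g_r -| u) (x) e_(T \ i). *)
Section EagonNorthcott.
Variables (f : nat) (P : 'M[R]_(2, f)).

Definition EN_basis : finType :=
  option {x : 'I_f * {set 'I_f} | (x.1 < #|x.2|.-1)%N}.

Definition EN_deg (b : EN_basis) : nat :=
  if b is Some x then #|(val x).2|.-1 else 0%N.

Definition EN_diff (b c : EN_basis) : R :=
  match b, c with
  | Some x, None =>
      let T := (val x).2 in
      if #|T| == 2 then \sum_(i in T) \sum_(j in T | (i < j)%N) minor2 P i j
      else 0
  | Some x, Some y =>
      let: (a, T) := val x in
      let: (a', T') := val y in
      \sum_(i in T | T :\ i == T')
        (-1) ^+ #|[set j in T | (j < i)%N]| *
        ((a == a'.+1 :> nat)%:R * P 0 i + (a == a' :> nat)%:R * P 1 i)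
  | None, _ => 0
  end.

Definition eagon_northcott : based_complex R :=
  @BasedComplex R EN_basis EN_deg EN_diff.

End EagonNorthcott.
End Complexes.

(* K[x_1, ..., x_n] is graded by N^q, the variable x_i having degree [wt i]. *)
Section GradedResolutions.
Variables (K : fieldType) (n q : nat) (wt : 'I_n -> 'X_{1..q}).

Definition wdeg (m : 'X_{1..n}) : 'X_{1..q} := (\sum_i wt i *+ m i)%MM.

Definition minimal_graded_resolution (C : based_complex {mpoly K[n]})
    (I : {mpoly K[n]} -> Prop) : Prop :=
  exists (b0 : cbasis C) (gdeg : cbasis C -> 'X_{1..q}),
  [/\ resolves I b0,
      gdeg b0 = 0%MM,
      forall (b c : cbasis C) m, m \in msupp (cdiff b c) ->
        gdeg b = (gdeg c + wdeg m)%MM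
    & forall b c : cbasis C, (cdiff b c)@_0%MM = 0].

End GradedResolutions.

Section Join.
Implicit Types (h : nat) (a d : 'X_{1..4}).

Definition gen h a d (i : nat) : 'X_{1..4} :=
  if i is 0 then a else (a *+ h + d *+ i)%MM.

Definition gen_set h n a d : 'X_{1..4} -> Prop :=
  fun s => exists2 i, (i <= n)%N & s = gen h a d i.

Definition nvars (n1 n2 : nat) : nat := (n1 + n2).+2.

(* Exponents of the images of the variables; the variable x_k,  *)
(* 1 <= k <= n1 + n2 + 2, has index k - 1. *)
Definition join_wt h n1 n2 a1 d1 a2 d2 (k : 'I_(nvars n1 n2)) : 'X_{1..4} :=
  if (k <= n1)%N then gen h a1 d1 k else gen h a2 d2 (k - n1.+1).

Definition join_gens h n1 n2 a1 d1 a2 d2 : 'X_{1..4} -> Prop :=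
  fun s => gen_set h n1 a1 d1 s \/ gen_set h n2 a2 d2 s.

Definition lin_indep a1 d1 a2 d2 : Prop :=
  row_free (\matrix_(i < 4, j < 4)
    ((tnth [tuple a1; d1; a2; d2] i) j)%:R : 'M[rat]_4).

Variable K : fieldType.

Definition join_ring h n1 n2 a1 d1 a2 d2 :=
  ksg K (join_gens h n1 n2 a1 d1 a2 d2).

(* The kernel of R -> K[S_2]; composing with K[S_2] \subset K[t_1..t_4] does *)
(* not change it. *)
Definition join_ideal h n1 n2 a1 d1 a2 d2 :
    {mpoly K[nvars n1 n2]} -> Prop :=
  fun f => f \mPo [tuple 'X_[join_wt h a1 d1 a2 d2 k] | k < nvars n1 n2]
           = 0 :> {mpoly K[4]}.

Definition join_max h n1 n2 a1 d1 a2 d2 :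
    join_ring h n1 n2 a1 d1 a2 d2 -> Prop :=
  ideal_span (fun x : join_ring h n1 n2 a1 d1 a2 d2 =>
    exists k : 'I_(nvars n1 n2),
      val x = 'X_[join_wt h a1 d1 a2 d2 k] :> {mpoly K[4]}).

Definition join_gr h n1 n2 a1 d1 a2 d2 :=
  gr (@join_max h n1 n2 a1 d1 a2 d2).

Definition join_gr_alg h n1 n2 a1 d1 a2 d2 :
    {rmorphism K -> join_gr h n1 n2 a1 d1 a2 d2} :=
  gr_cst (@join_max h n1 n2 a1 d1 a2 d2)
    \o in_alg (join_ring h n1 n2 a1 d1 a2 d2).

Definition join_koszul h n1 n2 a1 d1 a2 d2 : Prop :=
  koszul (join_gr_alg h n1 n2 a1 d1 a2 d2)
    (@gr_part _ (@join_max h n1 n2 a1 d1 a2 d2)).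

(* x_k, numbered from 1. *)
Definition xvar n1 n2 (k : nat) : {mpoly K[nvars n1 n2]} := 'X_(inord k.-1).

(* The 2 x n matrix with rows (x_(s+1)^h, x_(s+2), ..., x_(s+n)) and          *)
(* (x_(s+2), ..., x_(s+n+1)). *)
Definition rnc_matrix n1 n2 h (s n : nat) : 'M[{mpoly K[nvars n1 n2]}]_(2, n) :=
  \matrix_(r < 2, c < n)
    if (r == 0) && (c == 0 :> nat) then xvar n1 n2 s.+1 ^+ h
    else xvar n1 n2 (s + c + r).+1.

Definition P1 n1 n2 h := rnc_matrix n1 n2 h 0 n1.
Definition P2 n1 n2 h := rnc_matrix n1 n2 h n1.+1 n2.

End Join.

Definition join_vars n1 n2 : seq 'I_(nvars n1 n2) :=
  [seq inord k.-1 | k <- iota 2 n1.-1 ++ iota (n1 + 3) n2.-1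
     ++ [:: 1; n1 + 1; n1 + 2; n1 + n2 + 2]%N].

(* Main.v *)
(** Call a monomial standard if, in each of the two blocks of variables, the
    exponents of the middle variables (neither first nor last) add up to at most
    1.  A standard monomial is determined by its weight, and among the monomials
    of that weight it has the largest degree and the largest exponent at each of
    the four end variables.

    A basis element of the tensor product of the two Eagon-Northcott complexes
    times a monomial is called a cell.  Matching a cell with its leading term,
    when the middle variables of its monomial are small enough, is an acyclic
    matching whose critical cells are the standard monomials.  Hence the complex
    is exact in positive degrees, and standard monomials span modulo the minors;
    since distinct ones have distinct weights, the minors generate the ideal.
    By the extremality above a standard monomial is the smallest of its weight,
    hence not a leading monomial of the ideal; so a leading monomial is divisible
    by a product of two middle variables of one block, and these products are
    the leading monomials of the minors.

    For the Koszul property, list the variables as the four end variables, then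
    the middle ones of the first block, then those of the second.  In the
    associated graded ring each ideal generated by an initial segment has colon
    ideal by the next variable generated by an initial segment again.  Modules
    with linear quotients given by this flag have syzygy modules of the same
    kind, so the resolution of the residue field is linear. *)

Require Import Defs.
From mathcomp Require Import all_boot all_algebra.
From mathcomp Require Import ring_quotient.
From mathcomp Require Import mpoly zify ring.
From mathcomp Require Import boolp.

Set Implicit Arguments.
Unset Strict Implicit.
Unset Printing Implicit Defensive.

Import GRing.Theory.
Local Open Scope ring_scope.

(** * Linear quotients along a flag *)

(** For [h > 1] the minors are not homogeneous for the standard degree, so the argument runs on
    weights: linear independence turns a weight into two numbers per block, from which the standard
    monomial is read off by division with remainder. Maximality of its degree also means that this
    degree is the order of the weight in the filtration by powers of the maximal ideal. Standard
    monomials are therefore a basis of the associated graded ring as well, for all [h] at once and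
    without equations of the tangent cone.

    Cells form an infinite basis over the field; acyclicity is expressed by a rank with values in
    pairs of naturals, so that reduction ends. The two matchings can be combined because the state
    of a cell (critical, source or target) is visible in the variables of its own block, which the
    differential of the other complex leaves alone. *)

Section LinearQuotients.
Variables (A : comPzRingType) (A1 A2 : A -> Prop).
Variables (N : nat) (v : nat -> A) (g : nat -> nat).

Definition flag_ideal j x := exists a : nat -> A, x = \sum_(c < j) a c * v c.

Hypothesis A1_0 : A1 0.
Hypothesis A1B : forall x y, A1 x -> A1 y -> A1 (x - y).
Hypothesis A2B : forall x y, A2 x -> A2 y -> A2 (x - y).
Hypothesis A1M : forall x y, A1 x -> A1 y -> A2 (x * y).
Hypothesis A1v : forall c, (c < N)%N -> A1 (v c).
Hypothesis flag_lin : forall j x, (j <= N)%N -> A2 x -> flag_ideal j x ->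
  exists a : nat -> A, (forall c, A1 (a c)) /\ x = \sum_(c < j) a c * v c.
Hypothesis g_le : forall j, (j < N)%N -> (g j <= N)%N.
Hypothesis flag_colon : forall j x, (j < N)%N ->
  flag_ideal j (x * v j) <-> flag_ideal (g j) x.

Definition row_span p q (s : nat -> 'rV[A]_p) (x : 'rV[A]_p) :=
  exists a : nat -> A, x = \sum_(i < q) a i *: s i.

(** [l i] is the index of the colon ideal of the earlier generators by the i-th one. The last clause
    is linearity: relations among generators with linear entries are compared in degree two, so the
    predicates [A1] and [A2] can stand in for a full grading. *)
Definition linear_quotients p q (s : nat -> 'rV[A]_p) (l : nat -> nat) :=
  [/\ forall i k, (i < q)%N -> A1 (s i 0 k),
      forall i, (i < q)%N -> (l i <= N)%N,
      forall i a, (i < q)%N -> row_span i s (a *: s i) <-> flag_ideal (l i) a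
    & forall i (x : 'rV[A]_p), (i <= q)%N -> (forall k, A2 (x 0 k)) -> row_span i s x ->
        exists a : nat -> A, (forall j, A1 (a j)) /\
          x = \sum_(j < i) a j *: s j].

Lemma flag_ideal0 x : flag_ideal 0 x -> x = 0.
Proof. by case=> a ->; rewrite big_ord0. Qed.

Lemma flag_ideal_sub j j' x : (j <= j')%N -> flag_ideal j x -> flag_ideal j' x.
Proof.
move=> jj' [a ->]; exists (fun c => if (c < j)%N then a c else 0).
rewrite (big_ord_widen _ (fun c => a c * v c) jj') big_mkcond /=.
by apply: eq_bigr => c _; case: ifP; rewrite ?mul0r.
Qed.

(** Appending a generator is encoded by overriding the sequence at index [q]. *)
Lemma sum_setn (V : lmodType A) (q : nat) (a : nat -> A) b (s : nat -> V) z :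
  \sum_(i < q.+1) (if i == q :> nat then b else a i) *:
     (if i == q :> nat then z else s i) = \sum_(i < q) a i *: s i + b *: z.
Proof.
rewrite big_ord_recr /= eqxx; congr (_ + _); apply: eq_bigr => i _.
by rewrite ltn_eqF.
Qed.

Lemma sum_setn_lt (V : lmodType A) (q i : nat) (a : nat -> A) (s : nat -> V) z :
  (i <= q)%N ->
  \sum_(j < i) a j *: (if j == q :> nat then z else s j) =
  \sum_(j < i) a j *: s j.
Proof.
by move=> iq; apply: eq_bigr => j _; rewrite ltn_eqF // (leq_trans _ iq).
Qed.

Lemma row_span_setn p q i (s : nat -> 'rV[A]_p) z x : (i <= q)%N ->
  row_span i (fun j => if j == q then z else s j) x <-> row_span i s x.
Proof.
by move=> iq; split=> -[a ->]; exists a; rewrite sum_setn_lt.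
Qed.

(** * Syzygies of a module with linear quotients *)

Section Syzygies.
Variables (p q : nat) (s : nat -> 'rV[A]_p) (l : nat -> nat).
Hypothesis s_lq : linear_quotients q s l.

Definition syz (x : 'rV[A]_q) := \sum_(i < q) x 0 i *: s i = 0.

(* The syzygies supported on the first r + 1 generators whose last coordinate *)
(* lies in the c-th ideal of the flag. *)
Definition syz_part r c (x : 'rV[A]_q) :=
  [/\ syz x, forall i : 'I_q, (r < i)%N -> x 0 i = 0
    & forall i : 'I_q, i = r :> nat -> flag_ideal c (x 0 i)].

Definition syz_gen r c := exists q' (s' : nat -> 'rV[A]_q) l',
  [/\ linear_quotients q' s' l',
      forall i, (i < q')%N -> syz_part r c (s' i)
    & forall x, syz_part r c x -> row_span q' s' x].

Lemma syz_partB r c x y a : syz_part r c x -> syz_part r c y ->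
  syz_part r c (x - a *: y).
Proof.
move=> [Zx x0 xc] [Zy y0 yc]; split.
- rewrite /syz; under eq_bigr => i _ do rewrite !mxE scalerBl -scalerA.
  by rewrite sumrB -scaler_sumr Zx Zy scaler0 subr0.
- by move=> i ri; rewrite !mxE x0 // y0 // mulr0 subr0.
- move=> i ir; rewrite !mxE; have [b ->] := xc _ ir; have [d ->] := yc _ ir.
  exists (fun c => b c - a * d c); rewrite mulr_sumr -sumrB.
  by apply: eq_bigr => k _; rewrite mulrBl mulrA.
Qed.

Lemma syz_part_sum r c q' (s' : nat -> 'rV[A]_q) (a : nat -> A) :
  (forall i, (i < q')%N -> syz_part r c (s' i)) ->
  syz_part r c (\sum_(i < q') a i *: s' i).
Proof.
elim: q' => [|q' IH] H; last first.
  rewrite big_ord_recr /= -[a q' *: _]opprK -scaleNr.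
  by apply: syz_partB; [apply: IH => i /ltnW; apply: H | apply: H].
rewrite big_ord0; split=> [|i _|i _]; rewrite ?mxE //.
  by rewrite /syz big1 // => i _; rewrite mxE scale0r.
by exists (fun=> 0); rewrite big1 // => k _; rewrite mul0r.
Qed.

(** One new generator [z] is enough. As [c < l r], the row [v c *: s r] is a combination of earlier
    generators, and [z] is this relation. A multiple [a *: z] falls into the old module exactly when
    [a * v c] lies in the c-th ideal of the flag, so the colon index of [z] is [g c]. *)
Lemma syz_genS r c : (r < q)%N -> (c < l r)%N -> syz_gen r c -> syz_gen r c.+1.
Proof.
move=> rq clr [q' [s' [l' [[lin' l'N col' spl'] ker' gen']]]].
have [lin lN col spl] := s_lq.
have cN : (c < N)%N := leq_trans clr (lN r rq).
pose ro := Ordinal rq.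
(* The row [v c *: s r] has entries of degree two, so its coefficients can be chosen linear. *)
have [b [A1b bE]] : exists b : nat -> A, (forall j, A1 (b j)) /\
    v c *: s r = \sum_(j < r) b j *: s j.
  apply: spl; first exact: ltnW.
    by move=> k; rewrite mxE; apply: A1M; [apply: A1v | apply: lin].
  apply/(col _ _ rq); exists (fun i => (i == c)%:R).
  rewrite (bigD1 (Ordinal clr)) //= eqxx mul1r big1 ?addr0 // => i.
  by rewrite -val_eqE /= => /negPf ->; rewrite mul0r.
pose z : 'rV[A]_q := \row_i (if (i < r)%N then - b i
                             else if i == r :> nat then v c else 0).
have zr : z 0 ro = v c by rewrite mxE ltnn eqxx.
have z_part : syz_part r c.+1 z.
  split.
  - rewrite /syz (bigID (fun i : 'I_q => (i < r)%N)) /=.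
    rewrite [X in X + _](_ : _ = - (v c *: s r)).
      rewrite (bigD1 ro) /= ?ltnn // zr big1 ?addr0 ?addNr // => i.
      rewrite -leqNgt -val_eqE /= => /andP[ri ir].
      by rewrite mxE ltnNge ri /= (negPf ir) scale0r.
    rewrite bE -sumrN (big_ord_widen _ (fun j => - (b j *: s j)) (ltnW rq)).
    by apply: eq_bigr => i ir; rewrite mxE ir scaleNr.
  - by move=> i ri; rewrite mxE ltnNge (ltnW ri) /= gtn_eqF.
  - move=> i ir; rewrite mxE ir ltnn eqxx; exists (fun i => (i == c)%:R).
    rewrite (bigD1 ord_max) //= eqxx mul1r big1 ?addr0 // => j.
    by rewrite -val_eqE /= => /negPf ->; rewrite mul0r.
have A1z k : A1 (z 0 k).
  rewrite mxE; case: ifP => _; last by case: ifP => // _; apply: A1v.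
  by rewrite -sub0r; apply: A1B.
have lower x y : syz_part r c.+1 x -> (forall i, i = ro -> flag_ideal c (x 0 i - y * v c)) ->
    syz_part r c (x - y *: z).
  move=> Px Hx; have [Zx x0 xc] := syz_partB y Px z_part; split=> // i ir.
  have -> : i = ro by apply: val_inj.
  by rewrite !mxE ltnn eqxx; apply: Hx.
pose s'' j := if j == q' then z else s' j.
pose l'' j := if j == q' then g c else l' j.
have part_up x : syz_part r c x -> syz_part r c.+1 x.
  move=> [Zx x0 xc]; split=> // i ir.
  by apply: flag_ideal_sub (xc _ ir).
have ker'' i : (i < q'.+1)%N -> syz_part r c.+1 (s'' i).
  rewrite /s''; case: eqP => [_ _|/eqP iq' ]; first exact: z_part.
  by rewrite ltnS leq_eqVlt (negPf iq') => /ker'/part_up.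
exists q'.+1, s'', l''; split=> //; last first.
  move=> x Px; have [_ _ /(_ ro erefl) [a xE]] := Px.
  have [|a' a'E] := gen' (x - a c *: z).
    apply: lower => // _ ->; exists a; rewrite xE big_ord_recr /=.
    by rewrite addrK.
  exists (fun i => if i == q' then a c else a' i).
  by rewrite sum_setn -a'E subrK.
split.
- move=> i k; rewrite /s''; case: eqP => [_ _|/eqP iq']; first exact: A1z.
  by rewrite ltnS leq_eqVlt (negPf iq') => /lin'.
- move=> i; rewrite /l''; case: eqP => [_ _|/eqP iq']; first exact: g_le.
  by rewrite ltnS leq_eqVlt (negPf iq') => /l'N.
- move=> i a iq; rewrite row_span_setn // /s'' /l''.
  case: eqP => [->|/eqP iq'].
    rewrite -flag_colon //; split.
      move=> [d dE]; have [_ _ /(_ ro erefl)] := syz_part_sum d ker'.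
      by rewrite -dE mxE zr.
    move=> [d dE]; apply: gen'.
    have P0 : syz_part r c.+1 0.
      by have := @syz_part_sum r c.+1 0 s' (fun=> 0); rewrite big_ord0; apply.
    have -> : a *: z = 0 - (- a) *: z by rewrite scaleNr opprK add0r.
    by apply: lower => // _ ->; exists d; rewrite mxE mulNr sub0r opprK.
  by apply: col'; move: iq; rewrite ltnS leq_eqVlt (negPf iq').
(* New is only the full span. The coordinate at [r] is a linear combination of the first [c.+1] flag
   elements; its last coefficient is the multiple of [z] to remove, and the rest is of degree two in
   the old span. *)
- move=> i x; rewrite leq_eqVlt => /orP[/eqP ->|iq] A2x.
    move=> [a xE].
    have [_ _ /(_ ro erefl) xr] := syz_part_sum a ker''; rewrite -xE in xr.
    have [d [A1d xd]] := flag_lin cN (A2x ro) xr.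
    have A2y k : A2 ((x - d c *: z) 0 k).
      by rewrite !mxE; apply: A2B => //; have := A1z k; rewrite mxE; apply: A1M.
    have Sy : row_span q' s' (x - d c *: z).
      apply: gen'; apply: lower; first by rewrite xE; apply: syz_part_sum.
      by move=> _ ->; exists d; rewrite xd big_ord_recr /= addrK.
    have [d' [A1d' d'E]] := spl' q' _ (leqnn _) A2y Sy.
    exists (fun i => if i == q' then d c else d' i); split.
      by move=> j; case: ifP.
    by rewrite sum_setn -d'E subrK.
  by rewrite row_span_setn // => /(spl' _ _ iq A2x)[a [A1a ->]];
     exists a; rewrite sum_setn_lt.
Qed.

Lemma syz_gen_le r c : (r < q)%N -> (c <= l r)%N -> syz_gen r 0 -> syz_gen r c.
Proof.
by move=> rq; elim: c => // c IH clr /(IH (ltnW clr)); apply: syz_genS.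
Qed.

(** The last coordinate of a syzygy always lies in the colon ideal of the earlier generators, which
    is the ideal of index [l r], and the ideal of index 0 is zero. So the induction on [c] that ends
    at one generator restarts at the next. *)
Lemma syz_part_next r x : (r < q)%N -> syz_part r (l r) x <-> syz_part r.+1 0 x.
Proof.
move=> rq; have [_ _ col _] := s_lq; split=> -[Zx x0 xc].
  split=> // [i ri|i ir]; first by apply: x0; apply: ltnW.
  by have -> : x 0 i = 0; [apply: x0; rewrite ir | exists (fun=> 0); rewrite big_ord0].
have x0' (i : 'I_q) : (r < i)%N -> x 0 i = 0.
  rewrite leq_eqVlt => /orP[/eqP ri|]; last exact: x0.
  by apply/flag_ideal0/xc.
split=> // i ir; apply/(col _ _ rq).
pose a j := if insub j is Some j' then - x 0 j' else 0.
exists a; rewrite -ir (big_ord_widen q (fun j => a j *: s j)); last by rewrite ir ltnW.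
move/eqP: Zx; rewrite /syz (bigD1 i) //= addr_eq0 => /eqP ->.
rewrite (bigID (fun j : 'I_q => (j < i)%N)) /= [X in _ + X]big1 ?addr0; last first.
  move=> j /andP[ji]; rewrite -leqNgt leq_eqVlt => /orP[/eqP ij|ij].
    by case/eqP: ji; apply: val_inj.
  by rewrite x0' ?scale0r // -ir.
rewrite -sumrN; apply: eq_big => j.
  by rewrite -val_eqE andb_idl //= => /ltn_eqF ->.
by rewrite /a valK scaleNr.
Qed.

Lemma syzygies_linear_quotients : exists q' (s' : nat -> 'rV[A]_q) l',
  linear_quotients q' s' l' /\ forall x, syz x <-> row_span q' s' x.
Proof.
have base : syz_gen 0 0.
  exists 0%N, (fun=> 0), (fun=> 0%N); split.
  - split=> //= i x; rewrite leqn0 => /eqP -> _ [a ->].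
    by exists (fun=> 0); rewrite !big_ord0.
  - by [].
  - move=> x [_ x0 xc]; exists (fun=> 0); rewrite big_ord0; apply/rowP=> i.
    rewrite mxE; have [i0|] := posnP i; last exact: x0.
    by apply/flag_ideal0/xc.
(* No coordinate has index [q] or more, so this stage consists of all syzygies. *)
have [] : syz_gen q 0.
  suff: forall r, (r <= q)%N -> syz_gen r 0 by apply.
  elim=> // r IH rq; have /(syz_gen_le rq (leqnn _)) := IH (ltnW rq).
  move=> [q' [s' [l' [lq ker gen]]]]; exists q', s', l'; split=> //.
    by move=> i /ker/syz_part_next; apply.
  by move=> x /(syz_part_next _ rq)/gen.
move=> q' [s' [l' [lq ker gen]]]; exists q', s', l'; split=> // x; split.
  move=> Zx; apply: gen; split=> // i; first by rewrite ltnNge (ltnW (ltn_ord i)).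
  by move=> iq; have := ltn_ord i; rewrite iq ltnn.
by move=> [a ->]; have [] := syz_part_sum a ker.
Qed.

End Syzygies.

Record lq_module p := LqModule {
  lq_rank : nat;
  lq_gens : nat -> 'rV[A]_p;
  lq_index : nat -> nat;
  lqP : linear_quotients lq_rank lq_gens lq_index
}.

Lemma lq_syz_ex p (M : lq_module p) :
  exists M' : lq_module (lq_rank M), forall x : 'rV_(lq_rank M),
    syz (lq_gens M) x <-> row_span (lq_rank M') (lq_gens M') x.
Proof.
have [q' [s' [l' [lq Zx]]]] := syzygies_linear_quotients (lqP M).
by exists (LqModule lq).
Qed.

Definition lq_syz p (M : lq_module p) : lq_module (lq_rank M) :=
  projT1 (cid (lq_syz_ex M)).

(** The width of each syzygy module is the rank of the module before it, hence the dependent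
    pair. *)
Fixpoint lq_chain (M : lq_module 1) i : {p & lq_module p} :=
  if i is j.+1 then existT _ _ (lq_syz (projT2 (lq_chain M j)))
  else existT _ _ M.

(** The resolution starts from the flag itself, taken as generators of the irrelevant ideal;
    [flag_colon] says that its colon indices are [g]. *)
Lemma flag_module_proof :
  linear_quotients N (fun c => (v c)%:M : 'rV[A]_1) g.
Proof.
have spanE i x : row_span i (fun c => (v c)%:M : 'rV[A]_1) x <->
    flag_ideal i (x 0 0).
  split=> -[a xE]; exists a; first by rewrite xE summxE;
    apply: eq_bigr => j _; rewrite !mxE mulr1n.
  apply/rowP=> j; rewrite ord1 xE summxE.
  by apply: eq_bigr => c _; rewrite !mxE mulr1n.
split=> [i k iN|//|i a iN|i x iN A2x /spanE].
- by rewrite ord1 mxE mulr1n; apply: A1v.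
- by rewrite spanE !mxE mulr1n; apply: flag_colon.
- move=> /(flag_lin iN (A2x 0))[a [A1a xE]]; exists a; split=> //.
  apply/rowP=> j; rewrite ord1 xE summxE.
  by apply: eq_bigr => c _; rewrite !mxE mulr1n.
Qed.

Lemma flag_linear_resolution (A_ : nat -> A -> Prop) :
  A_ 1%N = A1 -> (forall x, irrelevant_ideal A_ x <-> flag_ideal N x) ->
  exists b D, @linear_resolution A A_ b D.
Proof.
move=> A_1 irr; pose C := lq_chain (LqModule flag_module_proof).
pose b i := projT1 (C i).
pose D i : 'M[A]_(b i.+1, b i) := \matrix_(k < b i.+1) lq_gens (projT2 (C i)) k.
have mulD i x : x *m D i = \sum_(k < b i.+1) x 0 k *: lq_gens (projT2 (C i)) k.
  by rewrite mulmx_sum_row; apply: eq_bigr => k _; rewrite rowK.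
have spanD i x : row_span (b i.+1) (lq_gens (projT2 (C i))) x <->
    exists w, x = w *m D i.
  split=> [[a ->]|[w ->]].
    exists (\row_k a k); rewrite mulD.
    by apply: eq_bigr => k _; rewrite mxE.
  exists (fun k => if insub k is Some k' then w 0 k' else 0).
  by rewrite mulD; apply: eq_bigr => k _; rewrite valK.
exists b, D; split=> //.
- by move=> i j k; rewrite A_1 mxE; have [lin _ _ _] := lqP (projT2 (C i)); apply: lin.
- move=> x; rewrite -(spanD 0%N) /=; split=> [Hx|[a ->] j].
    have /irr[a xE] := Hx 0; exists a; apply/rowP=> j.
    by rewrite ord1 xE summxE; apply: eq_bigr => c _; rewrite !mxE mulr1n.
  apply/irr; exists a; rewrite ord1 summxE.
  by apply: eq_bigr => c _; rewrite !mxE mulr1n.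
- move=> i x; rewrite -spanD mulD /=.
  exact: (projT2 (cid (lq_syz_ex (projT2 (C i))))).
Qed.

End LinearQuotients.

(** * Acyclic matchings *)

Section Matching.
Variables (K : fieldType) (N : nat).
Implicit Types (C : based_complex {mpoly K[N]}).

Definition cell C := (cbasis C * 'X_{1..N})%type.

Definition dcoef C (u w : cell C) : K := ('X_[u.2] * cdiff u.1 w.1)@_(w.2).

(** An algebraic Morse matching on the cells, which form a basis over the field. [am_rank] excludes
    alternating cycles: another source [u'] whose boundary meets the partner of [u] has larger rank.
    The rank is a lexicographic pair because a product of matchings needs one component per
    factor. *)
Record acyclic_matching C (crit : cell C -> Prop) (mt : cell C -> cell C -> Prop)
    (rk1 rk2 : cell C -> nat) : Prop := AcyclicMatching {
  am_cover : forall w, [\/ crit w, exists w', mt w w' | exists u, mt u w];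
  am_coef : forall u w, mt u w -> dcoef u w != 0;
  am_fun : forall u w w', mt u w -> mt u w' -> w = w';
  am_rank : forall u w u' w', mt u w -> mt u' w' -> u != u' -> dcoef u' w != 0 ->
    (rk1 u < rk1 u')%N \/ (rk1 u = rk1 u' /\ (rk2 u < rk2 u')%N)
}.

(** * Homology of a complex with an acyclic matching *)

Section Exactness.
Variables (C : based_complex {mpoly K[N]}).
Variables (crit : cell C -> Prop) (mt : cell C -> cell C -> Prop).
Variables (rk1 rk2 : cell C -> nat).
Hypothesis (C_complex : is_complex C).
Hypothesis (C_matching : acyclic_matching crit mt rk1 rk2).
Implicit Types (v x : {ffun cbasis C -> {mpoly K[N]}}) (u w y : cell C).

Definition cellv w : {ffun cbasis C -> {mpoly K[N]}} :=
  [ffun b => if b == w.1 then 'X_[w.2] else 0].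

Definition supported (P : cell C -> Prop) v :=
  forall w, (v w.1)@_(w.2) != 0 -> P w.

Lemma cellv_coef u w : (cellv u w.1)@_(w.2) = (u == w)%:R.
Proof.
case: u w => [b m] [c p]; rewrite ffunE xpair_eqE eq_sym /=.
by case: eqP => _; rewrite ?mcoeffX ?mcoeff0.
Qed.

Lemma supportedD P v x : supported P v -> supported P x -> supported P (v + x).
Proof.
move=> Sv Sx w; rewrite ffunE mcoeffD => H; apply: contrapT => Pw.
have v0 : (v w.1)@_(w.2) = 0 by apply/eqP; apply: contrapT => /negP/Sv.
have x0 : (x w.1)@_(w.2) = 0 by apply/eqP; apply: contrapT => /negP/Sx.
by rewrite v0 x0 addr0 eqxx in H.
Qed.

Lemma supportedZ P (a : K) v : supported P v -> supported P (a *: v).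
Proof.
move=> Sv w; rewrite ffunE mcoeffZ mulf_eq0 negb_or => /andP[_]; exact: Sv.
Qed.

Lemma supported_cellv (P : cell C -> Prop) w : P w -> supported P (cellv w).
Proof.
move=> Pw y; rewrite cellv_coef; have [<- //|_] := eqVneq w y.
by rewrite mulr0n eqxx.
Qed.

Lemma cmapB v x : cmap (v - x) = cmap v - cmap x.
Proof.
apply/ffunP=> c; rewrite !ffunE -sumrB; apply: eq_bigr => b _.
by rewrite !ffunE mulrBl.
Qed.

Lemma cmap0 : cmap (0 : {ffun cbasis C -> {mpoly K[N]}}) = 0.
Proof.
by apply/ffunP=> c; rewrite !ffunE big1 // => b _; rewrite ffunE mul0r.
Qed.

Lemma cmapD v x : cmap (v + x) = cmap v + cmap x.
Proof.
apply/ffunP=> c; rewrite !ffunE -big_split; apply: eq_bigr => b _.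
by rewrite !ffunE mulrDl.
Qed.

Lemma cmapZ (a : K) v : cmap (a *: v) = a *: cmap v.
Proof.
apply/ffunP=> c; rewrite !ffunE scaler_sumr; apply: eq_bigr => b _.
by rewrite !ffunE scalerAl.
Qed.

Lemma cmap_cellv u c : cmap (cellv u) c = 'X_[u.2] * cdiff u.1 c.
Proof.
rewrite ffunE (bigD1 u.1) //= ffunE eqxx big1 ?addr0 // => b /negPf bu.
by rewrite ffunE bu mul0r.
Qed.

Lemma in_cdegD k v x : in_cdeg k v -> in_cdeg k x -> in_cdeg k (v + x).
Proof.
move=> Hv Hx b; rewrite ffunE; have [v0|/Hv //] := eqVneq (v b) 0.
by rewrite v0 add0r => /Hx.
Qed.

Lemma in_cdegZ k (a : K) v : in_cdeg k v -> in_cdeg k (a *: v).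
Proof.
by move=> Hv b; rewrite ffunE => H; apply: Hv; apply: contraNneq H => ->; rewrite scaler0.
Qed.

Lemma cell_expand v : v = \sum_b \sum_(m <- msupp (v b)) (v b)@_m *: cellv (b, m).
Proof.
apply/ffunP=> c; rewrite sum_ffunE (bigD1 c) //= sum_ffunE [X in X + _](_ : _ = v c).
  rewrite big1 ?addr0 // => b /negPf bc; rewrite sum_ffunE big1 // => m _.
  by rewrite !ffunE eq_sym bc scaler0.
by rewrite [RHS]mpolyE; apply: eq_bigr => m _; rewrite !ffunE eqxx.
Qed.

(** The cells that remain once every target has been cancelled against the boundary of its
    source. *)
Definition unmatched_down w := crit w \/ exists w', mt w w'.

Definition reducible k v :=
  exists2 x, in_cdeg k.+1 x & supported unmatched_down (v - cmap x).

Lemma in_cdeg0 k : in_cdeg k (0 : {ffun cbasis C -> {mpoly K[N]}}).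
Proof. by move=> b; rewrite ffunE eqxx. Qed.

Lemma reducibleD k v x : reducible k v -> reducible k x -> reducible k (v + x).
Proof.
move=> [v' Dv Sv] [x' Dx Sx]; exists (v' + x'); first exact: in_cdegD.
by rewrite cmapD opprD addrACA; exact: (supportedD Sv Sx).
Qed.

Lemma reducibleZ k (a : K) v : reducible k v -> reducible k (a *: v).
Proof.
move=> [v' Dv Sv]; exists (a *: v'); first exact: in_cdegZ.
by rewrite cmapZ -scalerBr; apply: supportedZ.
Qed.

Lemma reducible_cells k v :
  (forall w, (v w.1)@_(w.2) != 0 -> reducible k (cellv w)) -> reducible k v.
Proof.
have R0 : reducible k 0.
  exists 0; first exact: in_cdeg0.
  by rewrite cmap0 subr0 => w; rewrite ffunE mcoeff0 eqxx.
move=> H; rewrite [v]cell_expand.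
elim/big_ind: _ => // [*|b _]; first exact: reducibleD.
rewrite big_seq; elim/big_ind: _ => // [*|m]; first exact: reducibleD.
by rewrite mcoeff_msupp => bm; apply/reducibleZ/H.
Qed.

Lemma dcoef_deg u w : dcoef u w != 0 -> cdeg u.1 = (cdeg w.1).+1.
Proof.
move=> H; apply: (C_complex.1); apply: contraNneq H => H.
by rewrite /dcoef H mulr0 mcoeff0.
Qed.

Lemma reducible_down k w : unmatched_down w -> reducible k (cellv w).
Proof.
move=> Dw; exists 0; first exact: in_cdeg0.
by rewrite cmap0 subr0; apply: supported_cellv.
Qed.

(** Cancelling a target against the boundary of its source [u] brings in the other cells of that
    boundary. Those which are targets again have sources of smaller rank than [u], so the process
    ends; the outer induction is on the first rank, the inner one on the second. *)
Lemma reducible_cell w : reducible (cdeg w.1) (cellv w).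
Proof.
have [Cw|Dw|[u]] := am_cover C_matching w.
- by apply: reducible_down; left.
- by apply: reducible_down; right.
have [n1 n1E] := ubnP (rk1 u); elim: n1 => // n1 IH1 in u w n1E *.
have [n2 n2E] := ubnP (rk2 u); elim: n2 => // n2 IH2 in u w n1E n2E *.
move=> uw; have dw := am_coef C_matching uw.
set c := dcoef u w in dw.
have -> : cellv w = (cellv w - c^-1 *: cmap (cellv u)) + cmap (c^-1 *: cellv u).
  by rewrite cmapZ subrK.
apply: reducibleD; last first.
  exists (c^-1 *: cellv u).
    apply: in_cdegZ => b; rewrite ffunE; case: (b =P u.1) => [-> _|_]; last by rewrite eqxx.
    exact: dcoef_deg.
  by move=> y; rewrite subrr ffunE mcoeff0 eqxx.
apply: reducible_cells => y; rewrite !ffunE.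
rewrite -[if _ then _ else _](ffunE (fun b => if b == w.1 then 'X_[w.2] else 0)).
rewrite mcoeffB cellv_coef mcoeffZ -/(cmap _ y.1).
have := cmap_cellv u y.1; rewrite ffunE => ->; rewrite -/(dcoef u y).
have [<-|wy] := eqVneq w y; first by rewrite /c mulVf // subrr eqxx.
rewrite mulr0n sub0r oppr_eq0 mulf_eq0 negb_or => /andP[_ dy].
have dyw : cdeg y.1 = cdeg w.1.
  by apply: succn_inj; rewrite -(dcoef_deg dy) (dcoef_deg dw).
rewrite -dyw; have [Cy|Dy|[u' u'y]] := am_cover C_matching y.
- by apply: reducible_down; left.
- by apply: reducible_down; right.
have uu' : u' != u.
  by apply: contraNneq wy => uu'; apply/eqP; apply: (am_fun C_matching uw); rewrite -uu'.
have [lt1|[eq1 lt2]] := am_rank C_matching u'y uw uu' dy.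
  by apply: (IH1 u') => //; apply: leq_trans lt1 _; rewrite -ltnS.
apply: (IH2 u') => //; first by rewrite eq1.
by apply: leq_trans lt2 _; rewrite -ltnS.
Qed.

Lemma matching_reduce k v : in_cdeg k v -> reducible k v.
Proof.
move=> Dv; apply: reducible_cells => w Hw.
rewrite -(Dv w.1); first exact: reducible_cell.
by apply: contraNneq Hw => ->; rewrite mcoeff0.
Qed.

Lemma cmap_coef v w :
  (cmap v w.1)@_(w.2) =
  \sum_b \sum_(m <- msupp (v b)) (v b)@_m * dcoef (b, m) w.
Proof.
rewrite ffunE raddf_sum; apply: eq_bigr => b _ /=.
rewrite {1}[v b]mpolyE mulr_suml raddf_sum; apply: eq_bigr => m _ /=.
by rewrite -scalerAl mcoeffZ.
Qed.

Lemma lex_max (s : seq (cell C)) u0 : u0 \in s ->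
  exists2 u, u \in s & forall u', u' \in s ->
    ~ ((rk1 u < rk1 u')%N \/ (rk1 u = rk1 u' /\ (rk2 u < rk2 u')%N)).
Proof.
elim: s u0 => // x [|y s] IH u0 _.
  exists x; first exact: mem_head.
  by move=> u'; rewrite inE => /eqP ->; rewrite !ltnn; case=> // -[].
have [u us umax] := IH y (mem_head _ _).
have [ux|ux] := pselect ((rk1 u < rk1 x)%N \/ (rk1 u = rk1 x /\ (rk2 u < rk2 x)%N)).
  exists x; first exact: mem_head.
  move=> u'; rewrite inE => /orP[/eqP ->|/umax u'u]; first by rewrite !ltnn; case=> // -[].
  move=> xu'; apply: u'u; case: ux xu' => [ux|[ux1 ux2]] [xu|[xu1 xu2]].
  - by left; apply: ltn_trans xu.
  - by left; rewrite -xu1.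
  - by left; rewrite ux1.
  - by right; split; [rewrite ux1 | apply: ltn_trans xu2].
exists u; first by rewrite inE us orbT.
by move=> u'; rewrite inE => /orP[/eqP ->|/umax].
Qed.

(** Take a source [u] of maximal rank in the finite support. Its partner receives a contribution
    from [u] alone, since any other source of the support that hits it would have larger rank. *)
Lemma matching_inj v : supported (fun u => exists w, mt u w) v ->
  cmap v = 0 -> v = 0.
Proof.
move=> Sv dv; apply: contrapT => /eqP v0.
pose s := [seq (b, m) | b <- enum (cbasis C), m <- msupp (v b)].
have sP u : (u \in s) = ((v u.1)@_u.2 != 0).
  rewrite -mcoeff_msupp; apply/allpairsPdep/idP => [[b [m [_ bm ->]]] //|um].
  by exists u.1, u.2; rewrite mem_enum; split=> //; case: (u).
have [u0 u0s] : exists u0, u0 \in s.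
  apply: contrapT => H; case/eqP: v0; apply/ffunP=> b; rewrite ffunE.
  apply/mpolyP=> m; rewrite mcoeff0; apply/eqP; apply: contrapT => /negP bm.
  by apply: H; exists (b, m); rewrite sP.
have [u us umax] := lex_max u0s.
have [w uw] : exists w, mt u w by apply: Sv; rewrite -sP.
have := cmap_coef v w; rewrite dv ffunE mcoeff0 => /esym/eqP.
rewrite sP in us.
rewrite (bigD1 u.1) //= (bigD1_seq u.2) /= ?msupp_uniq //; last by rewrite mcoeff_msupp.
have z b m : m \in msupp (v b) -> (b, m) != u -> (v b)@_m * dcoef (b, m) w = 0.
  move=> bm bmu; apply/eqP; rewrite mulf_eq0; apply/orP; right.
  apply: contrapT => /negP bmw; rewrite mcoeff_msupp in bm.
  have [w' uw'] : exists w, mt (b, m) w by apply: Sv.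
  have := am_rank C_matching uw uw'; rewrite eq_sym => /(_ bmu bmw).
  by apply: umax; rewrite sP.
rewrite big_seq_cond big1 ?addr0; last first.
  by move=> m /andP[mu mu2]; apply: z => //; case: (u) mu2 => ? ? /=; rewrite xpair_eqE eqxx.
rewrite big1 ?addr0; last first.
  move=> b bu; rewrite big_seq big1 // => m mb; apply: z => //.
  by case: (u) bu => ? ? /=; rewrite xpair_eqE => /negPf ->.
rewrite -surjective_pairing mulf_eq0 (negPf us) /=.
by rewrite (negPf (am_coef C_matching uw)).
Qed.

(** Modulo a boundary the cycle becomes a combination of sources, because critical cells sit in
    degree 0 only. It is still a cycle, hence zero by [matching_inj]. *)
Lemma matching_exact k v :
  (forall w, crit w -> cdeg w.1 = 0%N) -> in_cdeg k.+1 v -> cmap v = 0 ->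
  exists2 x, in_cdeg k.+2 x & cmap x = v.
Proof.
move=> crit0 Dv dv; have [x Dx Sx] := matching_reduce Dv; exists x => //.
apply/esym/subr0_eq; apply: matching_inj; last first.
  by rewrite cmapB dv (C_complex.2) subr0.
move=> w Hw; case: (Sx w Hw) => // /crit0 w0.
move: Hw; rewrite !ffunE mcoeffB.
have -> : v w.1 = 0.
  by apply/eqP; apply: contrapT => /negP /Dv; rewrite w0.
rewrite mcoeff0 sub0r oppr_eq0 => H.
suff : cdeg w.1 = k.+1 by rewrite w0.
have : cmap x w.1 != 0.
  by rewrite ffunE; apply: contraNneq H => ->; rewrite mcoeff0.
rewrite ffunE => H'; apply: contrapT => wk; case/eqP: H'; apply: big1 => b _.
have [->|/Dx xb] := eqVneq (x b) 0; first by rewrite mul0r.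
have [->|/(C_complex.1)] := eqVneq (cdiff b w.1) 0; first by rewrite mulr0.
by rewrite xb => -[] /esym.
Qed.

End Exactness.
End Matching.

(** * Tensor products of complexes and of matchings *)

Section TensorComplex.
Variable R : comNzRingType.
Implicit Types (C D : based_complex R).

Lemma sum_delta (I : finType) (i : I) (F : I -> R) :
  \sum_j (i == j)%:R * F j = F i.
Proof.
rewrite (bigD1 i) //= eqxx mul1r big1 ?addr0 // => j.
by rewrite eq_sym => /negPf ->; rewrite mul0r.
Qed.

Lemma is_complexP C : (forall b c : cbasis C, cdiff b c != 0 -> cdeg b = (cdeg c).+1) ->
  is_complex C <-> forall b e : cbasis C, \sum_c cdiff b c * cdiff c e = 0.
Proof.
move=> Cdeg; split=> [[_ dd] b e|dd].
  have /ffunP/(_ e) := dd [ffun b' => (b == b')%:R].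
  rewrite !ffunE => H; rewrite -[RHS]H; apply: eq_bigr => c _; rewrite ffunE.
  by under eq_bigr => b' _ do rewrite ffunE; rewrite sum_delta.
split=> // v; apply/ffunP=> e; rewrite !ffunE.
under eq_bigr => c _ do rewrite ffunE mulr_suml.
rewrite exchange_big big1 // => b _.
by under eq_bigr => c _ do rewrite -mulrA; rewrite -mulr_sumr dd mulr0.
Qed.

Lemma is_complex_tensor C D :
  is_complex C -> is_complex D -> is_complex (tensor_complex C D).
Proof.
move=> cC cD; have [degC _] := cC; have [degD _] := cD.
have /(is_complexP degC) ddC := cC; have /(is_complexP degD) ddD := cD.
have degT (x y : cbasis (tensor_complex C D)) : cdiff x y != 0 -> cdeg x = (cdeg y).+1.
  case: x y => [x1 x2] [y1 y2] /=; have [<-|_] := eqVneq x2 y2.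
    rewrite mul1r; have [->|/degC -> //] := eqVneq (cdiff x1 y1) 0.
    rewrite add0r; have [<-|_] := eqVneq x1 y1; last by rewrite mul0r mulr0 => /eqP.
    have [->|/degD/n_Sn //] := eqVneq (cdiff x2 x2) 0.
    by rewrite !mulr0 => /eqP.
  rewrite mul0r add0r; have [<-|_] := eqVneq x1 y1; last by rewrite mul0r mulr0 => /eqP.
  have [->|/degD ->] := eqVneq (cdiff x2 y2) 0; last by rewrite addnS.
  by rewrite !mulr0 => /eqP.
apply/(is_complexP degT) => -[x1 x2] [z1 z2] /=.
pose F y1 y2 := ((x2 == y2)%:R * cdiff x1 y1 +
   (-1) ^+ cdeg x1 * ((x1 == y1)%:R * cdiff x2 y2)) *
  ((y2 == z2)%:R * cdiff y1 z1 +
   (-1) ^+ cdeg y1 * ((y1 == z1)%:R * cdiff y2 z2)).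
rewrite -(pair_bigA _ F) /=.
have FE y1 y2 : F y1 y2 =
    (x2 == y2)%:R * ((x2 == z2)%:R * (cdiff x1 y1 * cdiff y1 z1)) +
    (x2 == y2)%:R * ((z1 == y1)%:R * ((-1) ^+ cdeg z1 * cdiff x1 z1 * cdiff x2 z2)) +
    ((x1 == y1)%:R * ((z2 == y2)%:R * ((-1) ^+ cdeg x1 * cdiff x1 z1 * cdiff x2 z2)) +
    (x1 == y1)%:R * ((x1 == z1)%:R * (cdiff x2 y2 * cdiff y2 z2))).
  rewrite /F mulrDl !mulrDr [z1 == _]eq_sym [z2 == _]eq_sym; congr (_ + _ + (_ + _)).
  - have [->|_] := eqVneq x2 y2; last by rewrite !mul0r.
    by rewrite !mul1r mulrCA.
  - have [->|_] := eqVneq x2 y2; last by rewrite !mul0r.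
    have [->|_] := eqVneq y1 z1; last by rewrite !mul0r !mulr0.
    by rewrite !mul1r mulrCA mulrA.
  - have [->|_] := eqVneq x1 y1; last by rewrite !mul0r !mulr0 !mul0r.
    have [->|_] := eqVneq y2 z2; last by rewrite !mul0r !mulr0.
    by rewrite !mul1r -!mulrA; congr (_ * _); rewrite mulrC.
  - have [->|_] := eqVneq x1 y1; last by rewrite !mul0r !mulr0 !mul0r.
    have [->|_] := eqVneq y1 z1; last by rewrite !mul0r !mulr0.
    by rewrite !mul1r mulrACA -exprMn mulrNN mulr1 expr1n mul1r.
under eq_bigr => y1 _ do under eq_bigr => y2 _ do rewrite FE.
under eq_bigr => y1 _ do rewrite !big_split /= -!mulr_sumr !sum_delta.
rewrite !big_split /= -!mulr_sumr !sum_delta ddC ddD !mulr0 add0r addr0.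
(* The two cross terms carry the signs of [x1] and of [z1], whose degrees differ by one. *)
have [->|/degC ->] := eqVneq (cdiff x1 z1) 0; first by rewrite !(mulr0, mul0r) addr0.
by rewrite exprS mulN1r !mulNr subrr.
Qed.

End TensorComplex.

(** * Products of matchings in disjoint sets of variables *)

Section TensorMatching.
Variables (K : fieldType) (N : nat).
Implicit Types (C D : based_complex {mpoly K[N]}) (V W : pred 'I_N).

(** All activity is confined to the variables [V]. By the last two clauses a target is told apart
    from critical cells and from sources on the same basis element by its exponents in [V]; a move
    in the other complex does not change these. *)
Record local_matching V C (crit : cell C -> Prop) (mt : cell C -> cell C -> Prop)
    (rk : cell C -> nat) : Prop := LocalMatching {
  lm_matching : acyclic_matching crit mt rk (fun=> 0%N);
  lm_dcoef : forall (u w : cell C), dcoef u w != 0 -> forall i, ~~ V i -> u.2 i = w.2 i;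
  lm_crit : forall b (m m' : 'X_{1..N}), crit (b, m) -> {in V, m =1 m'} -> crit (b, m');
  lm_crit_deg : forall w, crit w -> cdeg w.1 = 0%N;
  lm_crit_up : forall u b (m m' : 'X_{1..N}), crit (b, m) -> mt u (b, m') -> ~ {in V, m =1 m'};
  lm_down_up : forall u b (m m' : 'X_{1..N}) w, mt (b, m) w -> mt u (b, m') -> ~ {in V, m =1 m'}
}.

Variables (C D : based_complex {mpoly K[N]}) (V W : pred 'I_N).
Variables (critC : cell C -> Prop) (mtC : cell C -> cell C -> Prop).
Variables (rkC : cell C -> nat).
Variables (critD : cell D -> Prop) (mtD : cell D -> cell D -> Prop).
Variables (rkD : cell D -> nat).
Hypothesis (C_complex : is_complex C) (D_complex : is_complex D).
Hypothesis (lmC : local_matching V critC mtC rkC).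
Hypothesis (lmD : local_matching W critD mtD rkD).
Hypothesis (VW : forall i, V i -> ~~ W i).

Let T := tensor_complex C D.
Let fstc (u : cell T) : cell C := (u.1.1, u.2).
Let sndc (u : cell T) : cell D := (u.1.2, u.2).

Definition tensor_crit (u : cell T) := critC (fstc u) /\ critD (sndc u).

(* The second factor moves only where the first one is critical. *)
Definition tensor_mt (u w : cell T) :=
  (mtC (fstc u) (fstc w) /\ u.1.2 = w.1.2) \/
  [/\ critC (fstc u), u.1.1 = w.1.1 & mtD (sndc u) (sndc w)].

(** Cells that are critical in the first factor get the least value, so they rank below all cells
    moved by that factor, and among themselves are compared by the second factor. *)
Definition tensor_rk1 (u : cell T) :=
  if `[< critC (fstc u) >] then 0%N else (rkC (fstc u)).+1.

Definition tensor_rk2 (u : cell T) := rkD (sndc u).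

Lemma dcoef_tensor (u w : cell T) :
  dcoef u w = (u.1.2 == w.1.2)%:R * dcoef (fstc u) (fstc w) +
    (-1) ^+ cdeg u.1.1 * ((u.1.1 == w.1.1)%:R * dcoef (sndc u) (sndc w)).
Proof.
rewrite /dcoef /= mulrDr mcoeffD; congr (_ + _).
  by case: eqP => _; rewrite ?(mul1r, mul0r, mulr0, mcoeff0).
rewrite mulrCA -signr_odd -[in RHS]signr_odd.
case: (odd _); case: eqP => _;
 by rewrite ?(expr0, expr1, mulN1r, mul1r, mul0r, mulr0, mcoeffN, mcoeff0).
Qed.

Lemma mtC_deg u w : mtC u w -> cdeg u.1 = (cdeg w.1).+1.
Proof. by move=> /(am_coef (lm_matching lmC)); apply: dcoef_deg. Qed.

Lemma mtD_deg u w : mtD u w -> cdeg u.1 = (cdeg w.1).+1.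
Proof. by move=> /(am_coef (lm_matching lmD)); apply: dcoef_deg. Qed.

Lemma critC_mtC u w : critC u -> ~ mtC u w.
Proof. by move=> /(lm_crit_deg lmC) u0 /mtC_deg; rewrite u0. Qed.

Lemma dcoefD_V (u w : cell D) : dcoef u w != 0 -> {in V, u.2 =1 w.2}.
Proof. by move=> H i /VW; apply: (lm_dcoef lmD H). Qed.

Lemma tensor_rk1_up u w : mtC (fstc u) w -> tensor_rk1 u = (rkC (fstc u)).+1.
Proof. by move=> H; rewrite /tensor_rk1 asboolF // => /critC_mtC/(_ H). Qed.

Lemma tensor_rk1_crit u : critC (fstc u) -> tensor_rk1 u = 0%N.
Proof. by move=> H; rewrite /tensor_rk1 asboolT. Qed.

Lemma tensor_matching :
  acyclic_matching tensor_crit tensor_mt tensor_rk1 tensor_rk2.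
Proof.
have [amC amD] := (lm_matching lmC, lm_matching lmD).
split.
- case=> -[b1 b2] m.
  have [C1|[[c1 m'] H]|[[c1 m'] H]] := am_cover amC (b1, m).
  + have [D1|[[c2 m'] H]|[[c2 m'] H]] := am_cover amD (b2, m).
    * by apply: Or31.
    * by apply: Or32; exists (b1, c2, m'); right.
    * apply: Or33; exists (b1, c2, m'); right; split=> //.
      apply: (lm_crit lmC) C1 _ => i Vi.
      by have /dcoefD_V/(_ i Vi)/esym := am_coef amD H.
  + by apply: Or32; exists (c1, b2, m'); left.
  + by apply: Or33; exists (c1, b2, m'); left.
- move=> [[u1 u2] m] [[w1 w2] m'] [[/= H e]|[/= Cu e H]];
    rewrite dcoef_tensor /= e eqxx.
  + have := mtC_deg H; rewrite /= mul1r; case: (u1 =P w1) => [->|_ _].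
      by move/eqP; rewrite ltn_eqF.
    by rewrite mul0r mulr0 addr0; exact: (am_coef amC H).
  + have := mtD_deg H; rewrite /= mul1r; case: (u2 =P w2) => [->|_ _].
      by move/eqP; rewrite ltn_eqF.
    rewrite mul0r add0r -signr_odd mulf_eq0 negb_or signr_eq0 /=.
    exact: (am_coef amD H).
- move=> [[u1 u2] m] [[w1 w2] m'] [[w1' w2'] m''].
  case=> [[/= H e]|[/= Cu e H]] [[/= H' e']|[/= Cu' e' H']].
  + by have [<- <-] := am_fun amC H H'; rewrite -e -e'.
  + by case: (critC_mtC Cu' H).
  + by case: (critC_mtC Cu H').
  + by have [<- <-] := am_fun amD H H'; rewrite -e -e'.
- move=> [[u1 u2] m] [[w1 w2] p] [[u1' u2'] m'] w' Hu Hu' uu'.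
  rewrite dcoef_tensor /= => dc.
  have {dc} [[e d1]|[e d2]] : (u2' = w2 /\ dcoef (u1', m') (w1, p) != 0) \/
      (u1' = w1 /\ dcoef (u2', m') (w2, p) != 0).
    move: dc; have [->|_] := eqVneq u2' w2.
      have [->|dc _] := eqVneq (dcoef (u1', m') (w1, p)) 0; last by left.
      rewrite mulr0 add0r.
      have [->|_] := eqVneq u1' w1; last by rewrite mul0r mulr0 => /eqP.
      by rewrite mul1r mulf_eq0 negb_or => /andP[_ ?]; right.
    rewrite mul0r add0r; have [->|_] := eqVneq u1' w1; last by rewrite mul0r mulr0 => /eqP.
    by rewrite mul1r mulf_eq0 negb_or => /andP[_ ?]; right.
  (* A boundary through the first factor needs positive degree there, so [u'] is not critical in
     it. *)
  + case: Hu' => [[/= H' e']|[/= Cu' e' H']]; last first.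
      by move: (dcoef_deg C_complex d1); rewrite (lm_crit_deg lmC Cu').
    rewrite (tensor_rk1_up H'); case: Hu => [[/= H e'']|[/= Cu e'' H]].
      rewrite (tensor_rk1_up H).
      left; have uu'1 : (u1, m) != (u1', m').
        apply: contraNneq uu' => -[-> ->]; apply/eqP.
        by rewrite e'' e.
      by rewrite ltnS; case: (am_rank amC H H' uu'1 d1) => [//|[_]]; rewrite ltnn.
    by rewrite (tensor_rk1_crit Cu); left.
  (* Here the boundary runs through the second factor and the exponents in [V] are unchanged. So the
     first component of [w] cannot be a target when that of [u'] is a source or critical, and the
     remaining cases are comparisons of ranks. *)
  + have agree := dcoefD_V d2.
    case: Hu' => [[/= H' e']|[/= Cu' e' H']].
      case: Hu => [[/= H e'']|[/= Cu e'' H]].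
        by rewrite e in H'; case: (lm_down_up lmC H' H).
      by rewrite (tensor_rk1_up H') (tensor_rk1_crit Cu); left.
    case: Hu => [[/= H e'']|[/= Cu e'' H]].
      by rewrite e in Cu'; case: (lm_crit_up lmC Cu' H).
    rewrite (tensor_rk1_crit Cu) (tensor_rk1_crit Cu'); right; split=> //.
    have uu'2 : (u2, m) != (u2', m').
      apply: contraNneq uu' => -[-> ->]; apply/eqP.
      by rewrite e'' e.
    by case: (am_rank amD H H' uu'2 d2) => [//|[_]]; rewrite ltnn.
Qed.

Lemma tensor_crit_deg (w : cell T) : tensor_crit w -> cdeg w.1 = 0%N.
Proof. by case=> /(lm_crit_deg lmC) /= -> /(lm_crit_deg lmD) /= ->. Qed.

End TensorMatching.

(** * The Eagon-Northcott complex *)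

Lemma big_option (R : nmodType) (I : finType) (F : option I -> R) :
  \sum_c F c = F None + \sum_i F (Some i).
Proof.
rewrite (bigD1 None) //=; congr (_ + _).
rewrite (reindex_omap Some (fun c => c)) /=; last by case.
by apply: eq_bigl => i; rewrite eqxx.
Qed.

(** The diagonal has its own hypothesis, since antisymmetry does not make it vanish in
    characteristic two. *)
Lemma antisym_sum0 (R : zmodType) (n : nat) (F : 'I_n -> 'I_n -> R) :
  (forall i, F i i = 0) -> (forall i j : 'I_n, (i < j)%N -> F i j = - F j i) ->
  \sum_i \sum_j F i j = 0.
Proof.
move=> F0 FN.
have -> : \sum_i \sum_j F i j =
    \sum_(i : 'I_n) \sum_(j : 'I_n | (i < j)%N) F i j +
    \sum_(i : 'I_n) \sum_(j : 'I_n | (j < i)%N) F i j.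
  rewrite -big_split; apply: eq_bigr => i _ /=.
  rewrite (bigID (fun j : 'I_n => (i < j)%N)) /=; congr (_ + _).
  rewrite (bigD1 i) ?ltnn //= F0 add0r; apply: eq_bigl => j.
  by rewrite -val_eqE /= -leqNgt [(j < i)%N]ltn_neqAle andbC.
rewrite [X in _ + X](exchange_big_dep xpredT) //= -big_split big1 // => i _ /=.
by rewrite -big_split big1 // => j ij /=; rewrite (FN _ _ ij) addNr.
Qed.

Lemma set_ord3 n (T : {set 'I_n}) : #|T| = 3%N ->
  exists x y z : 'I_n, [/\ (x < y)%N, (y < z)%N & T = [set x; y; z]].
Proof.
move=> T3; have [x0 x0T] : exists x, x \in T by apply/card_gt0P; rewrite T3.
have [x xT xmin] : exists2 x, x \in T & forall y, y \in T -> (x <= y)%N.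
  by case: (arg_minnP (fun i : 'I_n => nat_of_ord i) x0T) => x; exists x.
have : #|T :\ x| == 2 by move/eqP: T3; rewrite (cardsD1 x T) xT.
have xlt y : y \in T :\ x -> (x < y)%N.
  rewrite !inE => /andP[yx yT]; rewrite ltn_neqAle xmin // andbT.
  by rewrite eq_sym.
case/cards2P=> y [z [yz TE]].
have Txyz : T = [set x; y; z] by rewrite -(setD1K xT) TE setUA.
have xy : (x < y)%N by apply: xlt; rewrite TE !inE eqxx.
have xz : (x < z)%N by apply: xlt; rewrite TE !inE eqxx orbT.
case: (ltngtP y z) => [yz'|zy|/val_inj e]; last by rewrite e eqxx in yz.
  by exists x, y, z.
by exists x, z, y; split=> //; rewrite Txyz -!setUA [[set y; z]]setUC.
Qed.

Lemma minor2E (R : comNzRingType) (f : nat) (P : 'M[R]_(2, f)) i j :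
  minor2 P i j = P 0 i * P 1 j - P 0 j * P 1 i.
Proof.
rewrite /minor2 (expand_det_row _ 0) !big_ord_recl big_ord0 addr0 /cofactor.
rewrite !det_mx11 !mxE /= expr0 mul1r expr1 mulN1r mulrN.
do ![congr (_ * _) || congr (_ + _) || congr (- _)]; congr (P _ _); exact: val_inj.
Qed.

Section EagonNorthcottComplex.
Variables (R : comNzRingType) (f : nat) (P : 'M[R]_(2, f)).
Local Notation EN := (eagon_northcott P).
Local Notation EN_gen := {x : 'I_f * {set 'I_f} | (x.1 < #|x.2|.-1)%N}.

Definition EN_sign (T : {set 'I_f}) (i : 'I_f) : R :=
  (-1) ^+ #|[set j in T | (j < i)%N]|.

Definition EN_coef (a a' : nat) (i : 'I_f) : R :=
  (a == a'.+1)%:R * P 0 i + (a == a')%:R * P 1 i.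

Definition EN_m2 (T : {set 'I_f}) : R :=
  if #|T| == 2 then \sum_(i in T) \sum_(j in T | (i < j)%N) minor2 P i j else 0.

Lemma EN_diff_Some (x y : EN_gen) :
  EN_diff P (Some x) (Some y) =
  \sum_(i in (val x).2 | (val x).2 :\ i == (val y).2)
     EN_sign (val x).2 i * EN_coef (val x).1 (val y).1 i.
Proof. by case: x y => [[a T] ?] [[a' T'] ?]. Qed.

Lemma EN_degP (b c : EN_basis f) : EN_diff P b c != 0 -> EN_deg b = (EN_deg c).+1.
Proof.
case: b => [x|]; last by rewrite eqxx.
case: c => [y|]; last by rewrite /=; case: ifP => [/eqP -> //|_]; rewrite eqxx.
rewrite EN_diff_Some => H.
have [i /andP[iT /eqP TE]] : exists i, (i \in (val x).2) && ((val x).2 :\ i == (val y).2).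
  apply/existsP; apply: contraNT H => /existsPn H.
  by rewrite big1 // => i /(negP (H i)).
have := valP y; rewrite /EN_deg /= -TE [in X in _ -> X](cardsD1 i (val x).2) iT /=.
by case: #|_|.
Qed.

(** The guards say when a contraction is nonzero: that by [g_0] if its exponent [a] is positive,
    that by [g_1] if its exponent, which is [#|T|.-2 - a], is positive. *)
Lemma EN_sum (a : nat) (T : {set 'I_f}) (x : EN_gen) (Phi : nat -> {set 'I_f} -> R) :
  a = (val x).1 :> nat -> T = (val x).2 ->
  \sum_(y : EN_gen) EN_diff P (Some x) (Some y) * Phi (val y).1 (val y).2 =
  \sum_(i in T) EN_sign T i *
    ((if (0 < a)%N then P 0 i * Phi a.-1 (T :\ i) else 0) +
     (if (a < #|T|.-2)%N then P 1 i * Phi a (T :\ i) else 0)).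
Proof.
move=> aE TE.
pose A := [pred y : 'I_f * {set 'I_f} | (y.1 < #|y.2|.-1)%N].
pose F (y : 'I_f * {set 'I_f}) :=
  \sum_(i in T | T :\ i == y.2) EN_sign T i * EN_coef a y.1 i * Phi y.1 y.2.
rewrite (eq_bigr (fun y => F (val y))); last first.
  by move=> y _; rewrite EN_diff_Some mulr_suml -TE -aE.
rewrite -(@big_sub _ _ _ _ A F) /F.
rewrite (exchange_big_dep (fun i => i \in T)) /=; last by move=> ? ? _ /andP[].
apply: eq_bigr => i iT.
have xA : (a < #|T|.-1)%N by rewrite aE TE; apply: (valP x).
have cTi : #|T :\ i|.-1 = #|T|.-2 by rewrite (cardsD1 i T) iT.
have af : (a < f)%N by rewrite aE; apply: ltn_ord.
have apf : (a.-1 < f)%N by apply: leq_ltn_trans af; apply: leq_pred.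
rewrite (eq_bigl (fun y : 'I_f * {set 'I_f} => (y.1 < #|T|.-2)%N && (y.2 == T :\ i))); last first.
  move=> y; rewrite inE iT eq_sym /=; case: eqP => [->|_]; last by rewrite !andbF.
  by rewrite cTi.
pose G (b : 'I_f) := EN_sign T i * EN_coef a b i * Phi b (T :\ i).
rewrite (eq_bigr (fun y => G y.1)); last by move=> y /andP[_ /eqP ->].
rewrite -(pair_big_dep (fun b : 'I_f => (b < #|T|.-2)%N)
   (fun _ S => S == T :\ i) (fun b _ => G b)) /=.
under eq_bigr => b _ do rewrite big_pred1_eq /G -mulrA.
rewrite -mulr_sumr; congr (_ * _).
under eq_bigr => b _ do rewrite /EN_coef mulrDl -!mulrA.
rewrite big_split /=; congr (_ + _).
  case: posnP => [->|a0]; first by rewrite big1 // => b _; rewrite mul0r.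
  have ap : (a.-1 < #|T|.-2)%N by move: xA a0; case: (a) => // ?; case: #|T| => // -[].
  rewrite (bigD1 (Ordinal apf)) //= prednK // eqxx mul1r big1 ?addr0 // => b.
  rewrite -val_eqE /= => /andP[_ /negPf ba].
  by rewrite -[a]prednK // eqSS eq_sym ba mul0r.
case: ifP => aT.
  rewrite (bigD1 (Ordinal af)) //= eqxx mul1r big1 ?addr0 // => b.
  by rewrite -val_eqE /= eq_sym => /andP[_ /negPf ->]; rewrite mul0r.
rewrite big1 // => b bT; have [ab|] := eqVneq a b; last by rewrite mul0r.
by rewrite ab bT in aT.
Qed.

Lemma EN_signD1 (T : {set 'I_f}) (i j : 'I_f) : i \in T -> j \in T -> (i < j)%N ->
  EN_sign T i * EN_sign (T :\ i) j = - (EN_sign T j * EN_sign (T :\ j) i).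
Proof.
move=> iT jT ij; rewrite /EN_sign.
have -> : [set k in T :\ j | (k < i)%N] = [set k in T | (k < i)%N].
  apply/setP=> k; rewrite !inE; have [ki|] := boolP (k < i)%N; last by rewrite !andbF.
  by rewrite -val_eqE /= ltn_eqF // (ltn_trans ki).
have -> : [set k in T | (k < j)%N] = i |: [set k in T :\ i | (k < j)%N].
  apply/setP=> k; rewrite !inE; have [->|_] := eqVneq k i; last by [].
  by rewrite iT ij.
by rewrite cardsU1 !inE eqxx /= exprS mulN1r mulNr opprK mulrC.
Qed.

(** Removing [i] then [j], or [j] then [i], gives opposite signs, while the coefficient [Q] is
    symmetric in [i] and [j]. *)
Lemma EN_complex_Some (x z : EN_gen) :
  \sum_(y : EN_gen) EN_diff P (Some x) (Some y) * EN_diff P (Some y) (Some z) = 0.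
Proof.
pose a : nat := (val x).1; pose T := (val x).2; pose a2 : nat := (val z).1; pose S := (val z).2.
pose Phi (b : nat) (B : {set 'I_f}) :=
  \sum_(i in B | B :\ i == S) EN_sign B i * EN_coef b a2 i.
rewrite (eq_bigr (fun y => EN_diff P (Some x) (Some y) * Phi (val y).1 (val y).2)); last first.
  by move=> y _; rewrite [EN_diff P (Some y) _]EN_diff_Some.
rewrite (@EN_sum a T) //.
pose Q (i j : 'I_f) : R := (a == a2.+2)%:R * (P 0 i * P 0 j) +
  ((a == a2.+1)%:R * (P 0 i * P 1 j + P 1 i * P 0 j) +
   (a == a2)%:R * (P 1 i * P 1 j)).
pose F (i j : 'I_f) := if [&& i \in T, j \in T, i != j & (T :\ i) :\ j == S]
  then EN_sign T i * EN_sign (T :\ i) j * Q i j else 0.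
rewrite -[RHS](@antisym_sum0 R f F); last 2 first.
- by move=> i; rewrite /F eqxx /= !andbF.
- move=> i j ij; rewrite /F [j == i]eq_sym.
  have -> : T :\ i :\ j = T :\ j :\ i by apply/setP=> k; rewrite !inE andbCA.
  have [iT|_] := boolP (i \in T); last by rewrite andbF oppr0.
  have [jT|_] := boolP (j \in T); last by rewrite /= oppr0.
  case: ifP => _; last by rewrite oppr0.
  rewrite EN_signD1 // mulNr; congr (- (_ * _)); rewrite /Q; ring.
rewrite big_mkcond; apply: eq_bigr => i _; case: ifP => iT; last first.
  by rewrite big1 // => j _; rewrite /F iT.
rewrite /Phi !mulr_sumr.
transitivity (\sum_(j in T :\ i | T :\ i :\ j == S)
    EN_sign T i * EN_sign (T :\ i) j * Q i j); last first.
  rewrite big_mkcond; apply: eq_bigr => j _; rewrite /F iT !inE eq_sym.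
  by case: (i != j); case: (j \in T).
have -> : (if (0 < a)%N
       then \sum_(j in T :\ i | T :\ i :\ j == S)
               P 0 i * (EN_sign (T :\ i) j * EN_coef a.-1 a2 j) else 0) =
   \sum_(j in T :\ i | T :\ i :\ j == S)
      (if (0 < a)%N then P 0 i * (EN_sign (T :\ i) j * EN_coef a.-1 a2 j) else 0).
  by case: ifP => // _; rewrite big1.
(* The guard may be dropped: where it fails, [a2 < #|S|.-1] forces [a2.+1 < a], and both indicators
   in [EN_coef] are zero. *)
have -> : (if (a < #|T|.-2)%N
       then \sum_(j in T :\ i | T :\ i :\ j == S)
               P 1 i * (EN_sign (T :\ i) j * EN_coef a a2 j) else 0) =
   \sum_(j in T :\ i | T :\ i :\ j == S)
      P 1 i * (EN_sign (T :\ i) j * EN_coef a a2 j).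
  case: ifP => // aT; rewrite big1 // => j /andP[jT /eqP SE].
  have cS : #|T| = #|S|.+2 by rewrite -SE (cardsD1 i T) iT (cardsD1 j (T :\ i)) jT.
  have a2S : (a2 < #|S|.-1)%N := valP z.
  have : (a2.+1 < a)%N.
    move: aT; rewrite cS /= => /negbT; rewrite -leqNgt; apply: leq_trans.
    by move: a2S; case: #|S|.
  move=> aa; rewrite /EN_coef !gtn_eqF //; last exact: ltnW.
  by rewrite !mul0r addr0 !mulr0.
rewrite -big_split mulr_sumr; apply: eq_bigr => j _ /=.
rewrite /Q /EN_coef; case: (a) => [|b] /=; first by rewrite add0r; ring.
by rewrite !eqSS; ring.
Qed.

Lemma EN_m2_pair (p q : 'I_f) : (p < q)%N -> EN_m2 [set p; q] = minor2 P p q.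
Proof.
move=> pq; have pq' : p != q by rewrite -val_eqE /= ltn_eqF.
rewrite /EN_m2 cards2 pq' /= big_setU1 ?inE //= big_set1.
rewrite big_mkcondr /= big_setU1 ?inE //= big_set1 ltnn pq add0r.
rewrite big_mkcondr /= big_setU1 ?inE //= big_set1 ltnn ltnNge (ltnW pq) /=.
by rewrite !addr0.
Qed.

(** Only sets of three elements contribute. For them the sum is the Laplace expansion of a 3 x 3
    determinant with a repeated row, namely row 1 for [a = 0] and row 0 for [a = 1]. *)
Lemma EN_complex_None (x : EN_gen) :
  \sum_(y : EN_gen) EN_diff P (Some x) (Some y) * EN_diff P (Some y) None = 0.
Proof.
pose a : nat := (val x).1; pose T := (val x).2.
pose Phi (b : nat) (B : {set 'I_f}) := EN_m2 B.
rewrite (eq_bigr (fun y => EN_diff P (Some x) (Some y) * Phi (val y).1 (val y).2)) //.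
rewrite (@EN_sum a T) //.
have [T3|T3] := eqVneq #|T| 3%N; last first.
  rewrite big1 // => i iT; rewrite /Phi /EN_m2.
  have -> : (#|T :\ i| == 2) = false.
    by apply: contraNF T3; rewrite (cardsD1 i T) iT => /eqP ->.
  by rewrite !mulr0 !if_same addr0 mulr0.
have a2 : (a < 2)%N by have := valP x; rewrite -/a -/T T3.
have [i [j [k [ij jk TE]]]] := set_ord3 T3.
have ik : (i < k)%N := ltn_trans ij jk.
have [ji ki kj] : [/\ (j == i) = false, (k == i) = false & (k == j) = false].
  by rewrite -!val_eqE /= !gtn_eqF.
have [ij' ik' jk'] : [/\ (i == j) = false, (i == k) = false & (j == k) = false].
  by rewrite ![_ == j]eq_sym ![_ == k]eq_sym.
have Ti : T :\ i = [set j; k].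
  by rewrite TE; apply/setP=> l; rewrite !inE; case: eqP => [->|]; rewrite ?ij' ?ik'.
have Tj : T :\ j = [set i; k].
  by rewrite TE; apply/setP=> l; rewrite !inE; case: eqP => [->|]; rewrite ?ji ?jk' ?orbF.
have Tk : T :\ k = [set i; j].
  by rewrite TE; apply/setP=> l; rewrite !inE; case: eqP => [->|]; rewrite ?ki ?kj ?orbF.
have si : EN_sign T i = 1.
  rewrite /EN_sign; suff -> : [set l in T | (l < i)%N] = set0 by rewrite cards0.
  apply/setP=> l; rewrite TE !inE; apply/negP=> /andP[/orP[/orP[]|] /eqP ->].
  - by rewrite ltnn.
  - by rewrite ltnNge (ltnW ij).
  - by rewrite ltnNge (ltnW ik).
have sj : EN_sign T j = -1.
  rewrite /EN_sign; suff -> : [set l in T | (l < j)%N] = [set i] by rewrite cards1.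
  apply/setP=> l; rewrite TE !inE; have [->|_] := eqVneq l i; first by rewrite ij.
  have [->|_] := eqVneq l j; first by rewrite ltnn.
  by have [->|_] := eqVneq l k; first by rewrite ltnNge (ltnW jk).
have sk : EN_sign T k = 1.
  rewrite /EN_sign; suff -> : [set l in T | (l < k)%N] = [set i; j].
    by rewrite cards2 ij' /= expr2 mulrNN mulr1.
  apply/setP=> l; rewrite TE !inE; have [->|_] := eqVneq l i; first by rewrite ik.
  have [->|_] := eqVneq l j; first by rewrite jk.
  by have [->|_] := eqVneq l k; first by rewrite ltnn.
rewrite T3 /Phi TE -setUA big_setU1 ?inE ?ij' ?ik' //= big_setU1 ?inE ?jk' //= big_set1.
rewrite setUA -TE Ti Tj Tk !EN_m2_pair // si sj sk !minor2E.
by case: (a) a2 => [|[|//]] _ /=; ring.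
Qed.

Lemma EN_is_complex : is_complex EN.
Proof.
apply/is_complexP; first exact: EN_degP.
move=> b e; rewrite big_option /=; case: b => [x|]; last first.
  by rewrite mul0r add0r big1 // => y _; rewrite mul0r.
rewrite mulr0 add0r; case: e => [z|]; last exact: EN_complex_None.
exact: EN_complex_Some.
Qed.

End EagonNorthcottComplex.

(** * A matching on the Eagon-Northcott complex of a scroll matrix *)

Section Block.
Variables (N o n h : nat).
Hypothesis (on_le : (o + n <= N)%N).

Definition bvar (j : nat) : 'I_N.+1 := inord (o + j).

(** These monomials are the entries of the scroll matrix: the entry in row [r] and column [c] has
    index [c + r], and only index 0 carries the power [h]. *)
Definition bmon (j : nat) : 'X_{1..N.+1} :=
  if j is 0 then (U_(bvar 0) *+ h)%MM else U_(bvar j)%MM.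

Definition midsum (m : 'X_{1..N.+1}) := (\sum_(1 <= j < n) m (bvar j))%N.

Definition in_block : pred 'I_N.+1 := fun i => (o <= i <= o + n)%N.

Lemma bvar_val j : (j <= n)%N -> bvar j = (o + j)%N :> nat.
Proof. by move=> jn; rewrite inordK //; lia. Qed.

Lemma bvar_eq i j : (i <= n)%N -> (j <= n)%N -> (bvar i == bvar j) = (i == j).
Proof. by move=> ? ?; rewrite -val_eqE /= !bvar_val // eqn_add2l. Qed.

Lemma bvar_in j : (j <= n)%N -> in_block (bvar j).
Proof. by move=> jn; rewrite /in_block bvar_val //; lia. Qed.

Lemma bmonE i j : (i <= n)%N -> (j <= n)%N ->
  bmon j (bvar i) = ((i == j) * (if j == 0 then h else 1))%N.
Proof.
case: j => [|j] iN jN; rewrite /bmon ?mulmnE mnm1E bvar_eq //=.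
  by rewrite eq_sym.
by rewrite muln1 eq_sym.
Qed.

Lemma bmon_mid i j : (i <= n)%N -> (0 < j <= n)%N -> bmon j (bvar i) = (i == j).
Proof.
by move=> iN /andP[j0 jN]; rewrite bmonE // -[j == 0]negbK -lt0n j0 muln1.
Qed.

Lemma bmon_off i j : ~~ in_block i -> (j <= n)%N -> bmon j i = 0%N.
Proof.
move=> iV jn; have ij k : (k <= n)%N -> (bvar k == i) = false.
  by move=> kn; apply: contraNF iV => /eqP <-; apply: bvar_in.
by case: j jn => [|j] jn; rewrite /bmon ?mulmnE mnm1E ij.
Qed.

Lemma midsumD m m' : midsum (m + m') = (midsum m + midsum m')%N.
Proof. by rewrite /midsum -big_split; apply: eq_bigr => i _; rewrite mnmDE. Qed.

Lemma midsum_bmon j : (j <= n)%N -> midsum (bmon j) = (0 < j < n)%N.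
Proof.
move=> jn; rewrite /midsum; case: (boolP (0 < j < n)%N) => jm.
  have j_in : (0 < j <= n)%N by lia.
  rewrite (bigD1_seq j) ?mem_index_iota ?iota_uniq //= bmon_mid // eqxx.
  rewrite big_nat_cond big1 // => i /andP[i_n /negPf ij].
  by rewrite bmon_mid ?ij //; lia.
rewrite big_nat_cond big1 // => i; rewrite andbT => i_n.
have i_le : (i <= n)%N by lia.
by rewrite bmonE //; case: eqP => // ij; rewrite -ij i_n in jm.
Qed.

Lemma eq_midsum (m m' : 'X_{1..N.+1}) : {in in_block, m =1 m'} -> midsum m = midsum m'.
Proof.
by move=> mm'; rewrite /midsum; apply: eq_big_nat => j jn; apply/mm'/bvar_in; lia.
Qed.

Definition bounded k (m : 'X_{1..N.+1}) :=
  forall l, (0 < l < n)%N -> (0 < m (bvar l))%N -> (l <= k)%N.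

Lemma mid_max (m : 'X_{1..N.+1}) : (0 < midsum m)%N ->
  exists c, [/\ (0 < c < n)%N, (0 < m (bvar c))%N & bounded c m].
Proof.
move=> m0; pose Q c := (0 < c < n)%N && (0 < m (bvar c))%N.
have exQ : exists c, Q c.
  apply: contrapT => H; move: m0; rewrite /midsum big_nat_cond big1 //.
  move=> i; rewrite andbT => i_n; apply/eqP; apply: contrapT => /negP; rewrite -lt0n => mi.
  by apply: H; exists i; rewrite /Q i_n.
have Qn c : Q c -> (c <= n)%N by case/andP=> /andP[_ /ltnW].
have [c /andP[cn mc] cmax] := ex_maxnP exQ Qn.
by exists c; split=> // l ln ml; apply: cmax; rewrite /Q ln.
Qed.

Lemma mid_max_gt k m : ~ bounded k m ->
  exists c, [/\ (0 < c < n)%N, (0 < m (bvar c))%N, bounded c m & (k < c)%N].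
Proof.
move=> H; have [l [ln ml kl]] : exists l, [/\ (0 < l < n)%N, (0 < m (bvar l))%N & (k < l)%N].
  apply: contrapT => H'; apply: H => l ln ml; rewrite leqNgt; apply/negP=> kl.
  by apply: H'; exists l.
have [|c [cn mc cb]] := @mid_max m.
  rewrite /midsum (bigD1_seq l) ?mem_index_iota ?iota_uniq //=.
  by rewrite addn_gt0 ml.
by exists c; split=> //; apply: leq_trans kl _; apply: cb.
Qed.

Lemma bmon_subK j (m : 'X_{1..N.+1}) : (0 < j)%N -> (0 < m (bvar j))%N ->
  (m - bmon j + bmon j)%MM = m.
Proof.
case: j => // j _ mj; rewrite submK //; apply/mnm_lepP => i.
by rewrite /bmon mnm1E; case: eqP => // <-.
Qed.

Lemma bounded_sub k m m' : bounded k m -> bounded k (m - m')%MM.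
Proof.
by move=> km l ln H; apply: km => //; apply: leq_trans H _; rewrite mnmBE leq_subr.
Qed.

End Block.

(** * Matching the cells of one block with their leading terms *)

Section EagonNorthcottMatching.
Variables (K : fieldType) (N o n h : nat).
Hypotheses (on_le : (o + n <= N)%N) (n_ge2 : (2 <= n)%N) (h_ge1 : (1 <= h)%N).

Local Notation v := (@bvar N o).
Local Notation Y := (@bmon N o h).

Definition scroll_mx : 'M[{mpoly K[N.+1]}]_(2, n) :=
  \matrix_(r < 2, c < n) 'X_[Y (c + r)].

Local Notation EN := (eagon_northcott scroll_mx).
Local Notation EN_gen := {x : 'I_n * {set 'I_n} | (x.1 < #|x.2|.-1)%N}.
Local Notation sum := (@midsum N o n).
Local Notation bounded := (@bounded N o n).

Definition gdiv (x : EN_gen) : nat := (val x).1.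
Definition gset (x : EN_gen) : {set 'I_n} := (val x).2.

Lemma gdiv_lt x : (gdiv x < #|gset x|.-1)%N. Proof. exact: (valP x). Qed.

Lemma gen_eq x y : gdiv x = gdiv y -> gset x = gset y -> x = y.
Proof.
case: x y => [[a T] p] [[b S] q]; rewrite /gdiv /gset /= => ab TS.
by apply: val_inj; rewrite /= TS; congr (_, _); apply: val_inj.
Qed.

Lemma gen_mk a (T : {set 'I_n}) : (a < #|T|.-1)%N ->
  exists x, gdiv x = a /\ gset x = T.
Proof.
move=> aT; have an : (a < n)%N.
  by apply: leq_trans aT _; rewrite (leq_trans (leq_pred _)) // -[X in (_ <= X)%N]card_ord max_card.
by exists (Sub (Ordinal an, T) aT).
Qed.

Definition is_top (T : {set 'I_n}) (t : 'I_n) :=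
  t \in T /\ forall s, s \in T -> (s <= t)%N.

(* u is matched to its leading term: for a positive divided power, the face
   omitting the top t of the set, with monomial factor Y t; for divided power 0,
   the face omitting the second largest element r, with factor Y r.+1. *)
Definition EN_mt (u w : cell EN) : Prop :=
  if u.1 is Some x then
    [\/ exists (y : EN_gen) t,
          [/\ gdiv x = (gdiv y).+1, is_top (gset x) t, gset y = gset x :\ t,
              bounded t u.2 & w = (Some y, (u.2 + Y t)%MM)],
        exists (y : EN_gen) t r,
          [/\ gdiv x = 0%N /\ gdiv y = 0%N,
              is_top (gset x) t /\ is_top (gset x :\ t) r, gset y = gset x :\ r,
              bounded r.+1 u.2 & w = (Some y, (u.2 + Y r.+1)%MM)]
      | exists i j : 'I_n,
          [/\ gset x = [set i; j], (i < j)%N, bounded i.+1 u.2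
            & w = (None, (u.2 + Y i.+1 + Y j)%MM)]]
  else False.

Definition EN_crit (w : cell EN) := w.1 = None /\ (sum w.2 <= 1)%N.

Definition gtop (x : EN_gen) : nat := \max_(i in gset x) i.

(* Lexicographic in the middle degree, n minus the top of the set, and the
   positivity of the divided power. *)
Definition EN_rk (w : cell EN) : nat :=
  if w.1 is Some x then
    sum w.2 * (2 * n).+2 + 2 * (n - gtop x) + (0 < gdiv x)
  else 0.

Lemma gtopE x (t : 'I_n) : is_top (gset x) t -> gtop x = t.
Proof.
move=> [tx tmax]; apply/eqP; rewrite eqn_leq (leq_bigmax_cond (F := fun i : 'I_n => nat_of_ord i)) //.
by rewrite andbT; apply/bigmax_leqP.
Qed.

Lemma scrollE r c : scroll_mx r c = 'X_[Y (c + r)]. Proof. by rewrite mxE. Qed.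

Lemma EN_diff_face (x y : EN_gen) i : i \in gset x -> gset y = gset x :\ i ->
  EN_diff scroll_mx (Some x) (Some y) = EN_sign _ (gset x) i *
    ((gdiv x == (gdiv y).+1)%:R * 'X_[Y i] + (gdiv x == gdiv y)%:R * 'X_[Y i.+1]).
Proof.
move=> ix yE; rewrite EN_diff_Some -/(gset x) -/(gset y) (bigD1 i) ?ix ?yE //=.
rewrite /EN_coef !scrollE addn0 addn1 big1 ?addr0 // => j /andP[/andP[jx /eqP ji] nji].
move/setP/(_ j): ji; rewrite !inE eqxx jx andbT /=.
by rewrite (negPf nji).
Qed.

Lemma card_gset x : (1 < #|gset x|)%N.
Proof. by have := gdiv_lt x; case: #|_| => // -[|c]; rewrite ?ltn0. Qed.

Lemma EN_diff_minor (x : EN_gen) :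
  EN_diff scroll_mx (Some x) None = 0 \/
  exists i j : 'I_n, [/\ (i < j)%N, gset x = [set i; j] &
    EN_diff scroll_mx (Some x) None = 'X_[Y i + Y j.+1] - 'X_[Y i.+1 + Y j]].
Proof.
rewrite -[EN_diff _ _ _]/(EN_m2 scroll_mx (gset x)).
have [|] := boolP (#|gset x| == 2); last by rewrite /EN_m2 => /negPf ->; left.
move/cards2P => [i0 [j0 [ij0 xE]]]; right.
have [i [j [ij {i0 j0 ij0} xE]]] : exists i j : 'I_n, (i < j)%N /\ gset x = [set i; j].
  case: (ltngtP i0 j0) => [ij|ji|/val_inj e]; last by rewrite e eqxx in ij0.
    by exists i0, j0.
  by exists j0, i0; rewrite setUC.
exists i, j; split=> //; rewrite xE EN_m2_pair // minor2E !scrollE !addn0 !addn1.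
by rewrite !mpolyXD [_ * 'X_[Y i.+1]]mulrC.
Qed.

Lemma EN_sign_mcoeff (T : {set 'I_n}) i (p : {mpoly K[N.+1]}) m :
  ((EN_sign _ T i * p)@_m != 0) = (p@_m != 0).
Proof.
rewrite /EN_sign -signr_odd; case: odd; rewrite ?expr1 ?expr0 ?mulN1r ?mul1r //.
by rewrite mcoeffN oppr_eq0.
Qed.

Lemma dcoef_gen (x y : EN_gen) m p : dcoef ((Some x, m) : cell EN) (Some y, p) != 0 ->
  exists2 s, s \in gset x /\ gset y = gset x :\ s &
    (gdiv x = (gdiv y).+1 /\ p = (m + Y s)%MM) \/
    (gdiv x = gdiv y /\ p = (m + Y s.+1)%MM).
Proof.
rewrite -[dcoef _ _]/(('X_[m] * EN_diff scroll_mx (Some x) (Some y))@_p) => H.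
have [s sx yE] : exists2 s, s \in gset x & gset x :\ s = gset y.
  suff /existsP[s /andP[sx /eqP yE]] : [exists s, (s \in gset x) && (gset x :\ s == gset y)].
    by exists s.
  apply: contraNT H => /existsPn H; rewrite EN_diff_Some big1 ?mulr0 ?mcoeff0 ?eqxx //.
  by move=> i /(negP (H i)).
exists s => //; move: H; rewrite (EN_diff_face sx (esym yE)) mulrCA EN_sign_mcoeff.
have [-> |_] := eqVneq (gdiv x) (gdiv y).+1.
  rewrite (gtn_eqF (ltnSn _)) mul1r mul0r addr0 -mpolyXD mcoeffX.
  by have [<- _|_ /eqP//] := eqVneq (m + Y s)%MM p; left.
have [-> |_] := eqVneq (gdiv x) (gdiv y); last first.
  by rewrite !mul0r addr0 mulr0 mcoeff0 => /eqP.
rewrite mul1r mul0r add0r -mpolyXD mcoeffX.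
by have [<- _|_ /eqP//] := eqVneq (m + Y s.+1)%MM p; right.
Qed.

Lemma dcoef_min (x : EN_gen) m p : dcoef ((Some x, m) : cell EN) (None, p) != 0 ->
  exists i j : 'I_n, [/\ (i < j)%N, gset x = [set i; j] &
    p = (m + Y i + Y j.+1)%MM \/ p = (m + Y i.+1 + Y j)%MM].
Proof.
rewrite -[dcoef _ _]/(('X_[m] * EN_diff scroll_mx (Some x) None)@_p).
case: (EN_diff_minor x) => [->|[i [j [ij xE ->]]]].
  by rewrite mulr0 mcoeff0 => /eqP.
rewrite mulrBr -!mpolyXD !addmA mcoeffB !mcoeffX => H; exists i, j; split=> //.
move: H; have [<- _|_] := eqVneq (m + Y i + Y j.+1)%MM p; first by left.
have [<- _|_] := eqVneq (m + Y i.+1 + Y j)%MM p; first by right.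
by rewrite subrr => /eqP.
Qed.

Lemma dcoef_none m w : dcoef ((None, m) : cell EN) w = 0.
Proof. by rewrite /dcoef /= mulr0 mcoeff0. Qed.

(** The last two components of the rank add up to less than [(2 * n).+2], so the weighted sum
    compares lexicographically. *)
Lemma EN_rk_lt (x x' : EN_gen) m m' :
  (sum m < sum m')%N \/ (sum m = sum m' /\
   ((gtop x' < gtop x)%N \/ [/\ gtop x = gtop x', gdiv x = 0%N & (0 < gdiv x')%N])) ->
  (EN_rk (Some x, m) < EN_rk (Some x', m'))%N.
Proof.
have gtn y : (gtop y < n)%N.
  have [i iy] : exists i, i \in gset y by apply/card_gt0P/(leq_trans _ (card_gset y)).
  by case: (eq_bigmax_cond (fun i : 'I_n => nat_of_ord i) (introT card_gt0P (ex_intro _ i iy))) => j _;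
     rewrite /gtop => ->.
have := gtn x; have := gtn x'; rewrite /EN_rk /=.
move: (gtop x) (gtop x') (gdiv x) (gdiv x') (sum m) (sum m') => t t' a a' s s'.
move=> tn' tn [ss|[<- [tt|[<- -> ->]]]].
- have : (s.+1 * (2 * n).+2 <= s' * (2 * n).+2)%N by rewrite leq_mul2r ss orbT.
  by case: (0 < a)%N; case: (0 < a')%N; lia.
- by case: (0 < a)%N; case: (0 < a')%N; lia.
- by rewrite /=; lia.
Qed.

Lemma is_top_ex (T : {set 'I_n}) : (0 < #|T|)%N -> exists t, is_top T t.
Proof.
move=> /card_gt0P [x0 x0T].
by case: (arg_maxnP (fun i : 'I_n => nat_of_ord i) x0T) => t; exists t.
Qed.

Lemma is_top_lt (T : {set 'I_n}) t s : is_top T t -> s \in T :\ t -> (s < t)%N.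
Proof.
move=> [_ tmax]; rewrite !inE => /andP[st /tmax]; rewrite leq_eqVlt => /orP[/eqP e|//].
by rewrite (val_inj e) eqxx in st.
Qed.

Lemma is_top_uniq (T : {set 'I_n}) t s : is_top T t -> is_top T s -> t = s.
Proof.
move=> [tT tmax] [sT smax]; apply: val_inj; apply/eqP.
by rewrite eqn_leq tmax // smax.
Qed.

Lemma is_top_pair (i j : 'I_n) : (i < j)%N ->
  is_top [set i; j] j /\ is_top ([set i; j] :\ j) i.
Proof.
move=> ij; have ij' : (i == j) = false by rewrite -val_eqE /= ltn_eqF.
split; split; rewrite ?inE ?eqxx ?orbT ?ij' // => s; rewrite !inE.
  by case/orP=> /eqP -> //; apply: ltnW.
by case/andP=> /negPf ->; rewrite orbF => /eqP ->.
Qed.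

(** A cell on [x] is a source exactly when its monomial is [bounded] by this index: [EN_mt_bound] is
    one direction, the proof of [EN_cover] contains the other. *)
Definition EN_bound (x : EN_gen) (k : nat) : Prop :=
  exists2 t, is_top (gset x) t &
    if (0 < gdiv x)%N then k = t else exists2 r, is_top (gset x :\ t) r & k = r.+1.

Lemma EN_bound_ex x : exists k, EN_bound x k.
Proof.
have [t top_t] := is_top_ex (ltnW (card_gset x)).
have [|r top_r] := @is_top_ex (gset x :\ t).
  by have := card_gset x; rewrite (cardsD1 t (gset x)) top_t.1.
case: (posnP (gdiv x)) => [x0|x0].
  by exists r.+1, t => //; rewrite x0 /=; exists r.
by exists (t : nat), t => //; rewrite x0.
Qed.

Lemma EN_bound_uniq x k l : EN_bound x k -> EN_bound x l -> k = l.
Proof.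
move=> [t xt +] [s xs]; rewrite (is_top_uniq xs xt).
case: ifP => [_ -> -> //|_ [r xr ->] [r' xr' ->]].
by rewrite (is_top_uniq xr xr').
Qed.

Lemma EN_bound_gtop x k : EN_bound x k -> (k <= gtop x)%N.
Proof.
move=> [t xt]; rewrite (gtopE xt); case: ifP => [_ -> //|_ [r xr ->]].
by apply: (is_top_lt xt); case: xr.
Qed.

Lemma EN_mt_bound x m w : EN_mt (Some x, m) w ->
  exists2 k, EN_bound x k & bounded k m.
Proof.
case=> [[y [t [xy top_t _ mt _]]]|[y [t [r [[x0 _] [top_t top_r] _ mt _]]]]|].
- by exists (t : nat) => //; exists t; rewrite ?xy.
- by exists r.+1 => //; exists t; rewrite ?x0 //; exists r.
- move=> [i [j [xE ij mt _]]]; exists i.+1 => //.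
  have [jx ix] := is_top_pair ij; rewrite -xE in jx ix.
  exists j => //; have := gdiv_lt x.
  rewrite xE cards2 -val_eqE /= ltn_eqF //= ltnS leqn0 => /eqP -> /=.
  by exists i; rewrite -?xE.
Qed.

Lemma EN_mt_fun u w w' : EN_mt u w -> EN_mt u w' -> w = w'.
Proof.
case: u => [[x|] m] //.
have pair_lt (y : EN_gen) (i j r : 'I_n) : gset x = [set i; j] -> r \in gset x -> gset y <> gset x :\ r.
  move=> xE rx yE; have := card_gset y; rewrite yE.
  have : (#|gset x| <= 2)%N by rewrite xE cards2; case: (_ != _).
  by rewrite (cardsD1 r (gset x)) rx add1n; case: #|_| => [|[|?]].
case=> [[y [t [xy top_t yE _ ->]]]|[y [t [r [[x0 y0] [top_t top_r] yE _ ->]]]]|[i [j [xE ij _ ->]]]];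
case=> [[y' [t' [xy' top_t' yE' _ ->]]]|[y' [t' [r' [[x0' y0'] [top_t' top_r'] yE' _ ->]]]]|[i' [j' [xE' ij' _ ->]]]].
- have e := is_top_uniq top_t top_t'; rewrite e in yE *.
  by rewrite (@gen_eq y y') ?yE ?yE' //; apply: succn_inj; rewrite -xy -xy'.
- by rewrite x0' in xy.
- by case: (pair_lt y i' j' t xE' (top_t.1) yE).
- by rewrite x0 in xy'.
- have e := is_top_uniq top_t top_t'; rewrite -e in top_r'.
  have e' := is_top_uniq top_r top_r'; rewrite e' in yE *.
  by rewrite (@gen_eq y y') ?yE ?yE' ?y0 ?y0'.
- by case: (pair_lt y i' j' r xE') => //; case: top_r => /setD1P[].
- by case: (pair_lt y' i j t' xE (top_t'.1) yE').
- by case: (pair_lt y' i j r' xE) => //; case: top_r' => /setD1P[].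
- have [jx ix] := is_top_pair ij; have [jx' ix'] := is_top_pair ij'.
  rewrite -xE in jx ix; rewrite -xE' in jx' ix'.
  have e := is_top_uniq jx jx'; rewrite -e in ix' *.
  by rewrite (is_top_uniq ix ix').
Qed.

Lemma dcoef_face (x y : EN_gen) i m : i \in gset x -> gset y = gset x :\ i ->
  gdiv x = (gdiv y).+1 -> dcoef ((Some x, m) : cell EN) (Some y, (m + Y i)%MM) != 0.
Proof.
move=> ix yE xy.
rewrite -[dcoef _ _]/(('X_[m] * EN_diff scroll_mx (Some x) (Some y))@_(m + Y i)).
rewrite (EN_diff_face ix yE) mulrCA EN_sign_mcoeff xy eqxx (gtn_eqF (ltnSn _)).
by rewrite mul1r mul0r addr0 -mpolyXD mcoeffX eqxx oner_neq0.
Qed.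

Lemma dcoef_face0 (x y : EN_gen) i m : i \in gset x -> gset y = gset x :\ i ->
  gdiv x = gdiv y -> dcoef ((Some x, m) : cell EN) (Some y, (m + Y i.+1)%MM) != 0.
Proof.
move=> ix yE xy.
rewrite -[dcoef _ _]/(('X_[m] * EN_diff scroll_mx (Some x) (Some y))@_(m + Y i.+1)).
rewrite (EN_diff_face ix yE) mulrCA EN_sign_mcoeff xy eqxx (ltn_eqF (ltnSn _)).
by rewrite mul1r mul0r add0r -mpolyXD mcoeffX eqxx oner_neq0.
Qed.

Lemma minor_terms_neq (i j : 'I_n) : (i < j)%N -> (Y i + Y j.+1 != Y i.+1 + Y j)%MM.
Proof.
move=> ij; apply/eqP=> /mnmP/(_ (v j.+1)); have jn := ltn_ord j.
rewrite !mnmDE !(bmonE h on_le) ?eqxx; try lia.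
have -> : (j.+1 == j) = false by lia.
have -> : (j.+1 == i.+1) = false by lia.
by have -> : (j.+1 == i) = false by lia.
Qed.

Lemma EN_mt_coef u w : EN_mt u w -> dcoef u w != 0.
Proof.
case: u => [[x|] m] //.
case=> [[y [t [xy [tx _] yE _ ->]]]|[y [t [r [[x0 y0] [_ [/setD1P[_ rx] _]] yE _ ->]]]]|].
- exact: dcoef_face.
- by apply: dcoef_face0; rewrite ?x0.
- move=> [i [j [xE ij _ ->]]].
  rewrite -[dcoef _ _]/(('X_[m] * EN_m2 scroll_mx (gset x))@_(m + Y i.+1 + Y j)).
  rewrite xE EN_m2_pair // minor2E !scrollE !addn0 !addn1 -!mpolyXD mulrBr -!mpolyXD.
  rewrite mcoeffB !mcoeffX -!addmA [(Y j + _)%MM]addmC eqxx.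
  have /negPf := minor_terms_neq ij.
  have -> : (m + (Y i + Y j.+1) == m + (Y i.+1 + Y j))%MM = (Y i + Y j.+1 == Y i.+1 + Y j)%MM.
    by apply/eqP/eqP=> [|-> //] /addmI.
  by move=> ->; rewrite sub0r oppr_eq0 oner_neq0.
Qed.

Lemma bmon_swap a b (m m' : 'X_{1..N.+1}) : (0 < a <= n)%N -> (b <= n)%N -> a != b ->
  (m + Y a = m' + Y b)%MM -> (0 < m' (v a))%N.
Proof.
move=> /andP[a0 an] bn ab /mnmP/(_ (v a)); rewrite !mnmDE (bmon_mid h on_le) ?a0 //.
by rewrite (bmonE h on_le) // (negPf ab) mul0n eqxx addn0 addn1 => <-.
Qed.

Lemma sum_eq a b (m m' : 'X_{1..N.+1}) : (a <= n)%N -> (b <= n)%N ->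
  (m + Y a = m' + Y b)%MM -> (sum m + (0 < a < n) = sum m' + (0 < b < n))%N.
Proof.
move=> an bn /(congr1 (@midsum N o n)).
by rewrite !midsumD !(midsum_bmon h on_le).
Qed.

Lemma bound_pair (x : EN_gen) (i j : 'I_n) k : gset x = [set i; j] -> (i < j)%N ->
  EN_bound x k -> [/\ k = i.+1, gtop x = j & gdiv x = 0%N].
Proof.
move=> xE ij xk; have [jx ix] := is_top_pair ij; rewrite -xE in jx ix.
have x0 : gdiv x = 0%N.
  have := gdiv_lt x.
  by rewrite xE cards2 -val_eqE /= ltn_eqF //= ltnS leqn0 => /eqP.
split=> //; last exact: gtopE.
by apply: (EN_bound_uniq xk); exists j => //; rewrite x0; exists i.
Qed.

(** Two factorisations of one monomial are compared. If the factor on the side of [x'] is an end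
    variable or its power, [m'] has larger middle degree. If it is a middle variable other than
    [Y t], each factor divides the cofactor of the other one, and the two bounds contradict each
    other. There remain equal cells, and the case [t = s.+1], in which the top of [x'] is below
    [t]. *)
Lemma rank_top (x y x' : EN_gen) (t s : 'I_n) m m' k' :
  gdiv x = (gdiv y).+1 -> is_top (gset x) t -> gset y = gset x :\ t -> bounded t m ->
  EN_bound x' k' -> bounded k' m' -> (x, m) != (x', m') ->
  s \in gset x' -> gset y = gset x' :\ s ->
  (gdiv x' = (gdiv y).+1 /\ (m + Y t = m' + Y s)%MM) \/
  (gdiv x' = gdiv y /\ (m + Y t = m' + Y s.+1)%MM) ->
  (EN_rk (Some x, m) < EN_rk (Some x', m'))%N.
Proof.
move=> xy top_t yE mt x'k m'k xx' sx' yE' H; apply: EN_rk_lt.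
have [tn sn] := (ltn_ord t, ltn_ord s).
have t0 : (0 < t)%N.
  have [z zy] : exists z, z \in gset y by apply/card_gt0P/ltnW/card_gset.
  by rewrite yE in zy; apply: leq_trans (is_top_lt top_t zy).
have x'lt : (s < t)%N -> (gtop x' < t)%N.
  move=> st; apply: (leq_trans (n := t.-1.+1)); last by rewrite prednK.
  rewrite ltnS; apply/bigmax_leqP => z zx'; rewrite -ltnS prednK //.
  have [-> //|zs] := eqVneq z s.
  have : z \in gset y by rewrite yE' !inE zs.
  by rewrite yE; apply: is_top_lt.
have [k'top top_x] := (EN_bound_gtop x'k, gtopE top_t).
have t_in : (0 < t <= n)%N by rewrite t0 ltnW.
case: H => [[x'y mE]|[x'y mE]].
  have sE := sum_eq (ltnW tn) (ltnW sn) mE; rewrite t0 tn sn andbT in sE.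
  have [s0|s0] := posnP (s : nat); first by left; rewrite s0 in sE; lia.
  exfalso; have [st|st] := eqVneq t s.
    case/eqP: xx'; rewrite -st in yE' mE; congr (_, _); last exact: addIm mE.
    apply: gen_eq; first by rewrite xy.
    by rewrite -(setD1K top_t.1) -yE yE' st setD1K.
  have s_in : (0 < s <= n)%N by rewrite s0 ltnW.
  have := mt s _ (bmon_swap s_in (ltnW tn) _ (esym mE)).
  rewrite s0 sn [s == t :> nat]eq_sym => /(_ isT st) st'.
  have st'' : (s < t)%N by rewrite ltn_neqAle eq_sym st.
  have := m'k t _ (bmon_swap t_in (ltnW sn) st mE).
  by rewrite t0 tn => /(_ isT); have := x'lt st''; lia.
have sE := sum_eq (ltnW tn) sn mE; rewrite t0 tn /= in sE.
have [s_n|sn'] := leqP n s.+1; first by left; lia.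
rewrite sn' in sE; right; split; first by lia.
left; rewrite top_x; have [st|st] := eqVneq (t : nat) s.+1.
  by apply: x'lt; rewrite st.
exfalso; have s_in : (0 < s.+1 <= n)%N by [].
have := mt s.+1 _ (bmon_swap s_in (ltnW tn) _ (esym mE)).
rewrite sn' eq_sym => /(_ isT st) st'.
have := m'k t _ (bmon_swap t_in sn st mE).
by rewrite t0 tn => /(_ isT); have := x'lt st'; lia.
Qed.

(** The top [t] survives in [y], so the tops of [x] and [x'] may agree. When [x'] has divided power
    1, middle degree and top can both coincide; this is where the rank needs the positivity of the
    divided power. *)
Lemma rank_second (x y x' : EN_gen) (t r s : 'I_n) m m' k' :
  gdiv x = 0%N -> gdiv y = 0%N -> is_top (gset x) t -> is_top (gset x :\ t) r ->
  gset y = gset x :\ r -> bounded r.+1 m ->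
  EN_bound x' k' -> bounded k' m' -> (x, m) != (x', m') ->
  s \in gset x' -> gset y = gset x' :\ s ->
  (gdiv x' = (gdiv y).+1 /\ (m + Y r.+1 = m' + Y s)%MM) \/
  (gdiv x' = gdiv y /\ (m + Y r.+1 = m' + Y s.+1)%MM) ->
  (EN_rk (Some x, m) < EN_rk (Some x', m'))%N.
Proof.
move=> x0 y0 top_t top_r yE mr x'k m'k xx' sx' yE' H; apply: EN_rk_lt.
have [tn sn] := (ltn_ord t, ltn_ord s).
have rt : (r < t)%N by apply: (is_top_lt top_t); case: top_r.
have rn : (r.+1 <= n)%N by lia.
have r_in : (0 < r.+1 <= n)%N by lia.
have tx' : t \in gset x'.
  have : t \in gset y by rewrite yE !inE top_t.1 andbT -val_eqE /= gtn_eqF.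
  by rewrite yE' => /setD1P[].
have in_x' z : z \in gset x' -> z = s \/ (z != r /\ z \in gset x).
  move=> zx'; have [->|zs] := eqVneq z s; [by left | right].
  by have : z \in gset y; [rewrite yE' !inE zs | rewrite yE => /setD1P[]].
case: H => [[x'y mE]|[x'y mE]].
  have sE := sum_eq rn (ltnW sn) mE.
  have [s0|s0] := posnP (s : nat); first by left; rewrite s0 in sE; lia.
  have st : (s <= t)%N.
    have [e|sr] := eqVneq (s : nat) r.+1; first by rewrite e.
    have s_in : (0 < s <= n)%N by lia.
    have := mr s _ (bmon_swap s_in rn sr (esym mE)).
    by rewrite s0 sn => /(_ isT); lia.
  right; split; first by lia.
  right; rewrite x0 x'y; split=> //; rewrite (gtopE top_t) (@gtopE x' t) //.
  by split=> // z /in_x'[-> //|[_]]; apply: top_t.2.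
have sE := sum_eq rn sn mE.
have [s_n|sn'] := leqP n s.+1; first by left; lia.
exfalso; have [sr|sr] := eqVneq s r.
  case/eqP: xx'; rewrite sr in mE yE' sx'; congr (_, _); last exact: addIm mE.
  apply: gen_eq; first by rewrite x0 x'y y0.
  have rx : r \in gset x by case: top_r => /setD1P[].
  by rewrite -(setD1K rx) -yE yE' setD1K.
have s_in : (0 < s.+1 <= n)%N by [].
have := mr s.+1 _ (bmon_swap s_in rn _ (esym mE)).
rewrite sn' eqSS => /(_ isT sr); rewrite ltnS leq_eqVlt (negPf (sr : s != r :> nat)) /= => sr'.
have rs : r.+1 != s.+1 by rewrite eqSS eq_sym.
have := m'k r.+1 _ (bmon_swap r_in sn rs mE).
have -> : (0 < r.+1 < n)%N by lia.
(* The variable of index [r.+1] divides [m'], so [r <= r'] for the second largest element [r'] of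
   [gset x']. But [r'] is [s] or an element of [gset x] other than [r] and [t], and all of these are
   below [r]. *)
move=> /(_ isT); case: x'k => t' top_t'; rewrite x'y y0 /= => -[r' top_r' ->].
have tt' : t = t'.
  apply: is_top_uniq top_t'; split=> // z /in_x'[->|[_]]; last exact: top_t.2.
  by lia.
rewrite -tt' in top_r'; rewrite ltnS leqNgt => /negP; apply.
case: top_r' => /setD1P[r't /in_x'[-> _ //|[r'r r'x]]] _.
have : r' \in gset x :\ t by rewrite !inE r't.
by move/(top_r.2); rewrite leq_eqVlt (negPf (r'r : r' != r :> nat)).
Qed.

(** The monomial is either the tail or the leading term of the other minor. A tail has an end
    factor, so that [m'] has larger middle degree, or it satisfies [j'.+1 <= j], so that the top is
    smaller. Two leading terms must come from the same pair, because each monomial is bounded by the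
    smaller index of its own leading term. *)
Lemma rank_minor (x x' : EN_gen) (i j i' j' : 'I_n) m m' k' :
  gset x = [set i; j] -> (i < j)%N -> bounded i.+1 m ->
  EN_bound x' k' -> bounded k' m' -> (x, m) != (x', m') ->
  gset x' = [set i'; j'] -> (i' < j')%N ->
  (m + Y i.+1 + Y j = m' + Y i' + Y j'.+1)%MM \/
  (m + Y i.+1 + Y j = m' + Y i'.+1 + Y j')%MM ->
  (EN_rk (Some x, m) < EN_rk (Some x', m'))%N.
Proof.
move=> xE ij mi x'k m'k xx' xE' ij' H; apply: EN_rk_lt.
have [k'E top_x' x'0] := bound_pair xE' ij' x'k; rewrite k'E in m'k.
have [k xk] := EN_bound_ex x; have [_ top_x x0] := bound_pair xE ij xk.
have [[jn jn'] [i_n in']] := ((ltn_ord j, ltn_ord j'), (ltn_ord i, ltn_ord i')).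
have i1n : (i.+1 < n)%N by lia.
have i1n' : (i'.+1 < n)%N by lia.
have sumE a b a' b' : (a <= n)%N -> (b <= n)%N -> (a' <= n)%N -> (b' <= n)%N ->
    (m + Y a + Y b = m' + Y a' + Y b')%MM ->
    (sum m + (0 < a < n) + (0 < b < n) = sum m' + (0 < a' < n) + (0 < b' < n))%N.
  move=> an bn an' bn' /(congr1 (@midsum N o n)).
  by rewrite !midsumD !(midsum_bmon h on_le).
have evalE a b a' b' c : (a <= n)%N -> (b <= n)%N -> (a' <= n)%N -> (b' <= n)%N ->
    (0 < c <= n)%N -> (m + Y a + Y b = m' + Y a' + Y b')%MM ->
    (m (v c) + (c == a) + (c == b) = m' (v c) + (c == a') + (c == b'))%N.
  move=> an bn an' bn' /andP[c0 cn] /mnmP/(_ (v c)).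
  have YE a0 : (a0 <= n)%N -> Y a0 (v c) = (c == a0).
    move=> a0n; rewrite (bmonE h on_le) //; case: (eqVneq c a0) => // <-.
    by rewrite mul1n (gtn_eqF c0).
  by rewrite !mnmDE !YE.
case: H => mE.
  have := sumE _ _ _ _ (ltnW i1n) (ltnW jn) (ltnW in') jn' mE.
  have [i'0|i'0] := posnP (i' : nat); first by rewrite i'0; left; lia.
  have [j'n|j'n] := leqP n j'.+1; first by left; lia.
  move=> sE; right; split; first by lia.
  left; rewrite top_x top_x'; have c_in : (0 < j'.+1 <= n)%N by lia.
  have := evalE _ _ _ _ j'.+1 (ltnW i1n) (ltnW jn) (ltnW in') jn' c_in mE.
  rewrite eqxx; have [|m0] := posnP (m (v j'.+1)); last first.
    by have := mi j'.+1 _ m0; rewrite j'n => /(_ isT); lia.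
  move=> ->; case: (eqVneq j'.+1 i.+1) => [|_]; first by lia.
  by case: (eqVneq j'.+1 (j : nat)) => [|_]; lia.
exfalso; have jj' : (j <= j')%N.
  have c_in : (0 < j <= n)%N by lia.
  have := evalE _ _ _ _ (j : nat) (ltnW i1n) (ltnW jn) (ltnW i1n') (ltnW jn') c_in mE.
  rewrite eqxx; have [|m0] := posnP (m' (v j)); last first.
    by have := m'k j _ m0; have -> : (0 < j < n)%N by [lia|]; move=> /(_ isT); lia.
  move=> ->; case: (eqVneq (j : nat) i'.+1) => [|_]; first by lia.
  by case: (eqVneq (j : nat) j') => [|_]; lia.
have j'j : (j' <= j)%N.
  have c_in : (0 < j' <= n)%N by lia.
  have := evalE _ _ _ _ (j' : nat) (ltnW i1n) (ltnW jn) (ltnW i1n') (ltnW jn') c_in mE.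
  rewrite [j' == j' :> nat]eqxx; have [|m0] := posnP (m (v j')); last first.
    by have := mi j' _ m0; have -> : (0 < j' < n)%N by [lia|]; move=> /(_ isT); lia.
  move=> ->; case: (eqVneq (j' : nat) i.+1) => [|_]; first by lia.
  by case: (eqVneq (j' : nat) j) => [|_]; lia.
have ej : j = j' by apply: val_inj; apply/eqP; rewrite eqn_leq jj'.
have {}mE : (m + Y i.+1 = m' + Y i'.+1)%MM by move: mE; rewrite ej => /addIm.
have [ei|ei] := eqVneq (i : nat) i'.
  case/eqP: xx'; congr (_, _); last by move: mE; rewrite ei => /addIm.
  by apply: gen_eq; rewrite ?x0 // xE xE' ej; congr [set _; _]; apply: val_inj.
have ai : (0 < i.+1 <= n)%N by lia.
have ai' : (0 < i'.+1 <= n)%N by lia.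
have H1 := m'k i.+1 _ (bmon_swap ai (ltnW i1n') ei mE).
rewrite eq_sym in ei.
have H2 := mi i'.+1 _ (bmon_swap ai' (ltnW i1n) ei (esym mE)).
have [] : (i.+1 <= i'.+1)%N /\ (i'.+1 <= i.+1)%N by rewrite H1 ?H2.
by move/eqP: ei; lia.
Qed.

Lemma EN_mt_rank u w u' w' : EN_mt u w -> EN_mt u' w' -> u != u' ->
  dcoef u' w != 0 -> (EN_rk u < EN_rk u')%N.
Proof.
case: u u' => [[x|] m] // [[x'|] m'] // uw /EN_mt_bound[k' x'k m'k] uu'.
have xx' : (x, m) != (x', m') by apply: contraNneq uu' => -[-> ->].
case: uw => [[y [t [xy top_t yE mt ->]]]|[y [t [r [[x0 y0] [top_t top_r] yE mt ->]]]]|[i [j [xE ij mi ->]]]].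
- move=> /dcoef_gen[s [sx' yE']] H.
  exact: (rank_top xy top_t yE mt x'k m'k xx' sx' yE' H).
- move=> /dcoef_gen[s [sx' yE']] H.
  exact: (rank_second x0 y0 top_t top_r yE mt x'k m'k xx' sx' yE' H).
- move=> /dcoef_min[i' [j' [ij' xE' H]]].
  exact: (rank_minor xE ij mi x'k m'k xx' xE' ij' H).
Qed.

(** Let [p <= c] be the two largest middle indices, counted with multiplicity; then [i = p.-1] and
    [j = c]. The shift by one turns weakly ordered pairs of variables into the strictly ordered
    pairs of columns. *)
Lemma mid_split m : (1 < sum m)%N -> exists (i j : 'I_n) m',
  [/\ (i < j)%N, bounded i.+1 m' & m = (m' + Y i.+1 + Y j)%MM].
Proof.
move=> sm2; have [c [cn mc cb]] := mid_max (ltnW sm2).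
have c0 : (0 < c)%N by case/andP: cn.
have mE := bmon_subK h c0 mc; set m1 := (m - Y c)%MM in mE.
have [|p [pn mp pb]] := @mid_max N o n m1.
  by rewrite -mE midsumD (midsum_bmon h on_le) ?cn // in sm2; lia.
have p0 : (0 < p)%N by case/andP: pn.
have pE := bmon_subK h p0 mp; set m2 := (m1 - Y p)%MM in pE.
have pc : (p <= c)%N.
  by apply: cb => //; apply: leq_trans mp _; rewrite mnmBE leq_subr.
have cn' : (c < n)%N by lia.
have pn' : (p.-1 < n)%N by lia.
have iE : (Ordinal pn').+1 = p by rewrite /= prednK.
exists (Ordinal pn'), (Ordinal cn'), m2; split; first by rewrite /=; lia.
  by rewrite iE; apply: bounded_sub.
by rewrite iE pE mE.
Qed.

Lemma EN_cover w : [\/ EN_crit w, exists w', EN_mt w w' | exists u, EN_mt u w].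
Proof.
case: w => -[x|] m; last first.
  have [sm1|sm2] := leqP (sum m) 1; first by apply: Or31.
  have [i [j [m' [ij mi ->]]]] := mid_split sm2.
  have [|x [x0 xE]] := @gen_mk 0 [set i; j].
    by rewrite cards2 -val_eqE /= ltn_eqF.
  by apply: Or33; exists (Some x, m'); apply: Or33; exists i, j.
have [k xk] := EN_bound_ex x; have [t top_t kE] := xk.
have [mk|/mid_max_gt[c [cn mc cb kc]]] := pselect (bounded k m).
  apply: Or32; move: kE; case: posnP => [x0 [r top_r kE]|x0 kE].
    have [x2|x3] := leqP #|gset x| 2.
      have xE : gset x = [set r; t].
        apply/esym/eqP; rewrite eqEcard cards2 (proj1 (setD1P top_r.1)) x2.
        have /setD1P[_ rx] := top_r.1.
        by rewrite andbT; apply/subsetP=> z; rewrite !inE => /orP[] /eqP -> //; case: top_t.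
      have rt : (r < t)%N by apply: (is_top_lt top_t); case: top_r.
      by eexists; apply: Or33; exists r, t; split=> //; rewrite -kE.
    have /setD1P[_ rx] := top_r.1.
    have [|y [y0 yE]] := @gen_mk 0 (gset x :\ r).
      by move: x3; rewrite (cardsD1 r) rx add1n; case: #|_| => [|[]].
    by eexists; apply: Or32; exists y, t, r; split=> //; rewrite -kE.
  have [|y [y0 yE]] := @gen_mk (gdiv x).-1 (gset x :\ t).
    have := gdiv_lt x; rewrite (cardsD1 t (gset x)) top_t.1 add1n /=.
    by case: (gdiv x) x0 => // a _; case: #|_|.
  by eexists; apply: Or31; exists y, t; split=> //; rewrite -?kE // y0 prednK.
(* The largest middle index [c] of [m] exceeds the bound. If it is above the top, [c] joins the set
   as new top and the divided power goes up by one. Otherwise the divided power is 0, the bound is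
   [r.+1], and [c.-1] joins as new second largest element. *)
have [c0 cn'] := andP cn; apply: Or33; have mE := bmon_subK h c0 mc.
have cbm := @bounded_sub N o n c m (Y c) cb; set m1 := (m - Y c)%MM in mE cbm.
have [tc|ct] := ltnP t c.
  pose c' := Ordinal cn'; have cx : c' \notin gset x.
    by apply/negP=> /(top_t.2) /=; rewrite leqNgt tc.
  have [|y [y0 yE]] := @gen_mk (gdiv x).+1 (c' |: gset x).
    by rewrite cardsU1 cx; have := gdiv_lt x; lia.
  exists (Some y, m1); apply: Or31; exists x, c'; split; rewrite ?mE ?y0 ?yE ?setU1K //.
  split=> [|s]; first by rewrite setU11.
  by rewrite !inE => /orP[/eqP ->|/top_t.2] //=; lia.
move: kE; case: posnP => [x0 [r top_r kE]|_ kE]; last by lia.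
have c1n : (c.-1 < n)%N by lia.
pose c' := Ordinal c1n; have rc : (r < c')%N by rewrite /=; lia.
have c't : c' != t by rewrite -val_eqE /=; apply/eqP; lia.
have cx : c' \notin gset x.
  apply/negP=> cx; have : c' \in gset x :\ t by rewrite !inE c't.
  by move/(top_r.2); rewrite leqNgt rc.
have [|y [y0 yE]] := @gen_mk 0 (c' |: gset x).
  by rewrite cardsU1 cx; have := card_gset x; lia.
exists (Some y, m1); apply: Or32; exists x, t, c'.
have c'E : c'.+1 = c by rewrite /= prednK.
rewrite yE c'E; split; rewrite ?setU1K ?mE //; split; split; rewrite ?inE ?eqxx ?c't ?top_t.1 ?orbT //.
  by move=> s; rewrite !inE => /orP[/eqP ->|/top_t.2] //=; lia.
move=> s; rewrite !inE => /andP[st /orP[/eqP -> //|sx]].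
by apply: leq_trans (ltnW rc); apply: top_r.2; rewrite !inE st.
Qed.

Lemma EN_local : local_matching (@in_block N o n) EN_crit EN_mt EN_rk.
Proof.
have Voff i j : ~~ in_block o n i -> (j <= n)%N -> Y j i = 0%N.
  by move=> iV jn; apply: (bmon_off h on_le).
split.
- split.
  + exact: EN_cover.
  + exact: EN_mt_coef.
  + exact: EN_mt_fun.
  + by move=> u w u' w' uw uw' uu' dc; left; apply: EN_mt_rank uw uw' uu' dc.
- case=> [[x|] m] [c p]; last by rewrite dcoef_none eqxx.
  case: c => [y /dcoef_gen[s _ H] i iV|/dcoef_min[i' [j' [ij' _ H]]] i iV] /=.
    have sn := ltn_ord s.
    by case: H => -[_ ->]; rewrite mnmDE Voff ?addn0 // ltnW.
  have [jn jn'] := (ltn_ord i', ltn_ord j').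
  by case: H => ->; rewrite !mnmDE !Voff ?addn0 // ltnW.
- by move=> b m m' [/= -> m1] mm'; split=> //=; rewrite -(eq_midsum on_le mm').
- by case=> b m [/= ->].
(* A target over the unit contains a product of two middle variables, while critical monomials have
   middle degree at most one. *)
- move=> [[x|] m0] b m m' // [/= -> m1] H mm'.
  case: H => [[? [? []]]|[? [? [? []]]]|[i [j [_ ij _ [m'E]]]]] //.
  have [i_n jn] := (ltn_ord i, ltn_ord j); have i1n : (i.+1 < n)%N by lia.
  have [a1 a2] : (0 < i.+1 < n)%N /\ (0 < j < n)%N by lia.
  move: m1; rewrite (eq_midsum on_le mm') m'E !midsumD.
  rewrite (midsum_bmon h on_le (ltnW i1n)) (midsum_bmon h on_le (ltnW jn)).
  by rewrite a1 a2 /=; lia.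
(* A target contains the variable that the matching has just introduced, and its index exceeds the
   bound of sources on the same basis element. *)
- move=> [[x0|] m0] b m m' w // H1 H2 mm'.
  case: b H1 H2 => [x|] // /EN_mt_bound[k xk mk] H2.
  have [t' top_t' kE] := xk.
  case: H2 => [[y [t [xy top_t yE _ [ey m'E]]]]|[y [t [r [[x00 y0] [top_t top_r] yE _ [ey m'E]]]]]|[? [? []]]] //.
    have tn := ltn_ord t; rewrite -ey in yE xy.
    have t't : (t' < t)%N by apply: (is_top_lt top_t); rewrite -yE; case: top_t'.
    have t_in : (0 < t <= n)%N by lia.
    have mv : m (v t) = m' (v t) by apply/mm'/(bvar_in on_le)/ltnW.
    have m'v : m' (v t) = (m0 (v t)).+1.
      by rewrite m'E mnmDE (bmon_mid h on_le (ltnW tn) t_in) eqxx addn1.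
    have := mk t; rewrite mv m'v.
    have -> : (0 < t < n)%N by lia.
    by have := EN_bound_gtop xk; rewrite (gtopE top_t') => ? /(_ isT isT); lia.
  rewrite -ey in yE y0; have tn := ltn_ord t.
  have rt : (r < t)%N by apply: (is_top_lt top_t); case: top_r.
  have tx : t \in gset x by rewrite yE !inE top_t.1 andbT -val_eqE /= gtn_eqF.
  have tt' : t = t'.
    apply: is_top_uniq top_t'; split=> // z; rewrite yE => /setD1P[_]; exact: top_t.2.
  move: kE; rewrite y0 /= -tt' => -[r' top_r' kE].
  have rn : (r.+1 <= n)%N by lia.
  have r_in : (0 < r.+1 <= n)%N by lia.
  have mv : m (v r.+1) = m' (v r.+1) by apply/mm'/(bvar_in on_le).
  have m'v : m' (v r.+1) = (m0 (v r.+1)).+1.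
    by rewrite m'E mnmDE (bmon_mid h on_le rn r_in) eqxx addn1.
  have := mk r.+1; rewrite mv m'v.
  have -> : (0 < r.+1 < n)%N by lia.
  move=> /(_ isT isT); rewrite kE ltnS leqNgt => /negP; apply.
  apply: (is_top_lt top_r); case: top_r' => /setD1P[r't]; rewrite yE => /setD1P[r'r r'x] _.
  by rewrite !inE r'r r't.
Qed.

End EagonNorthcottMatching.

(** * Standard monomials *)

Section BlockWeights.
Variables (N o n h : nat).
Hypotheses (on_le : (o + n <= N)%N) (n_gt0 : (0 < n)%N) (h_gt0 : (0 < h)%N).
Local Notation v := (@bvar N o).
Implicit Types m : 'X_{1..N.+1}.

Definition bsum (w : nat -> nat) m := (\sum_(0 <= j < n.+1) w j * m (v j))%N.

Definition bdeg := bsum (fun=> 1%N).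
(** [bA] and [bD] are the coefficients of [a] and [d] in the weight of the block; see
    [block_weight]. *)
Definition bA := bsum (fun j => if j == 0 then 1 else h)%N.
Definition bD := bsum id.

Definition midD m := (\sum_(1 <= j < n) j * m (v j))%N.

Lemma bsumE w m : bsum w m =
  (w 0 * m (v 0) + \sum_(1 <= j < n) w j * m (v j) + w n * m (v n))%N.
Proof. by rewrite /bsum big_nat_recr //= big_ltn. Qed.

Lemma bdegE m : bdeg m = (m (v 0) + midsum o n m + m (v n))%N.
Proof.
rewrite /bdeg bsumE !mul1n; congr (_ + _ + _)%N.
by apply: eq_bigr => j _; rewrite mul1n.
Qed.

Lemma bAE m : bA m = (m (v 0) + h * midsum o n m + h * m (v n))%N.
Proof.
rewrite /bA bsumE /= (gtn_eqF n_gt0) mul1n; congr (_ + _ + _)%N.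
rewrite /midsum big_distrr; apply: eq_big_nat => j /andP[j0 _].
by rewrite gtn_eqF.
Qed.

Lemma bDE m : bD m = (midD m + n * m (v n))%N.
Proof. by rewrite /bD bsumE mul0n. Qed.

Lemma midD_le m : (midD m <= n.-1 * midsum o n m)%N.
Proof.
rewrite /midD /midsum big_distrr /= big_nat_cond [X in (_ <= X)%N]big_nat_cond.
by apply: leq_sum => j /andP[jn _]; rewrite leq_mul2r; lia.
Qed.

Lemma midsum_le m : (midsum o n m <= midD m)%N.
Proof.
rewrite /midD /midsum big_nat_cond [X in (_ <= X)%N]big_nat_cond.
by apply: leq_sum => j /andP[/andP[j0 _] _]; rewrite leq_pmull.
Qed.

Lemma midsum0 m j : midsum o n m = 0%N -> (0 < j < n)%N -> m (v j) = 0%N.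
Proof.
move=> + jn; rewrite /midsum (bigD1_seq j) ?mem_index_iota ?iota_uniq //=.
by move/eqP; rewrite addn_eq0 => /andP[/eqP].
Qed.

Lemma mid_one m : (midsum o n m <= 1)%N -> forall j, (0 < j < n)%N ->
  m (v j) = ((midsum o n m == 1%N) && (j == midD m)).
Proof.
move=> m1 j jn; have [m0|m0] := posnP (midsum o n m).
  by rewrite (midsum0 m0 jn) m0.
have {m1 m0} sm : midsum o n m = 1%N by lia.
rewrite sm /=; have [|c [cn mc _]] := @mid_max N o n m; first by rewrite sm.
have cin : c \in index_iota 1 n by rewrite mem_index_iota.
have sD := bigD1_seq c cin (iota_uniq _ _).
have [mc1 /eqP] : m (v c) = 1%N /\ (\sum_(1 <= i < n | i != c) m (v i) = 0)%N.
  by move: sm; rewrite /midsum sD /=; lia.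
rewrite sum_nat_seq_eq0 => /allP others.
have other0 i : (0 < i < n)%N -> i != c -> m (v i) = 0%N.
  by move=> i_n ic; have := others i; rewrite mem_index_iota ic => /(_ i_n)/eqP.
have -> : midD m = c.
  rewrite /midD sD /= mc1 muln1 big_nat_cond big1 ?addn0 // => i /andP[i_n ic].
  by rewrite other0 // muln0.
by have [->|jc] := eqVneq j c; [rewrite mc1 | rewrite other0].
Qed.

(** Since [midD m < n], the exponent of the last variable is the quotient of [bD m] by [n], the
    largest possible. The number of factors other than the first variable is then this quotient
    rounded up, the least possible. In [bA] these factors count [h] times, so the exponent of the
    first variable is largest, and so is the degree because [h >= 1]. *)
Lemma block_ext m m' : (midsum o n m <= 1)%N -> bA m = bA m' -> bD m = bD m' ->
  [/\ (m' (v n) <= m (v n))%N, (m' (v 0) <= m (v 0))%N, (bdeg m' <= bdeg m)%N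
    & m' (v n) = m (v n) -> m' (v 0) = m (v 0) ->
      forall j, (j <= n)%N -> m' (v j) = m (v j)].
Proof.
move=> m1; rewrite !bAE !bDE !bdegE => AE DE.
have rD : (midD m < n)%N.
  have := midD_le m; move: m1; case: midsum => [_|[_|//]]; lia.
have [le1 le1'] := (midsum_le m, midsum_le m').
have le2' := midD_le m'; have le2 := midD_le m.
have ln : (m' (v n) <= m (v n))%N.
  rewrite -ltnS -(ltn_pmul2l n_gt0) mulnS; lia.
have sl : (midsum o n m + m (v n) <= midsum o n m' + m' (v n))%N.
  have : (n * m (v n) + midD m <= n * (midsum o n m' + m' (v n)))%N.
    rewrite mulnDr addnC DE leq_add2r; apply: leq_trans le2' _.
    by rewrite leq_mul2r leq_pred orbT.
  have [m0|m0] := posnP (midsum o n m).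
    rewrite m0; have -> : midD m = 0%N by rewrite m0 muln0 in le2; lia.
    by rewrite addn0 leq_pmul2l.
  have -> : midsum o n m = 1%N by lia.
  move=> H; rewrite add1n -(ltn_pmul2l n_gt0); apply: leq_trans H; lia.
have hs : (h * (midsum o n m + m (v n)) <= h * (midsum o n m' + m' (v n)))%N.
  by rewrite leq_mul2l sl orbT.
have hs' : (midsum o n m' + m' (v n) - (midsum o n m + m (v n)) <=
            h * (midsum o n m' + m' (v n)) - h * (midsum o n m + m (v n)))%N.
  by rewrite -mulnBr leq_pmull.
rewrite !mulnDr in hs hs'; split=> //; [by lia | by lia |].
move=> en e0; have : (h * midsum o n m = h * midsum o n m')%N by rewrite en e0 in AE; lia.
move/eqP; rewrite eqn_pmul2l // => /eqP sE.
have dE : midD m = midD m' by rewrite en in DE; lia.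
move=> j; have [->//|j0] := posnP j.
rewrite leq_eqVlt => /orP[/eqP -> //|jn].
by rewrite !mid_one ?j0 // -?sE // dE.
Qed.

Lemma bsumD w m m' : bsum w (m + m') = (bsum w m + bsum w m')%N.
Proof. by rewrite /bsum -big_split; apply: eq_bigr => j _; rewrite mnmDE mulnDr. Qed.

Lemma bsumU w j k : (j <= n)%N -> bsum w (U_(v j) *+ k) = (w j * k)%N.
Proof.
move=> jn; rewrite /bsum (bigD1_seq j) ?mem_index_iota ?iota_uniq //=.
rewrite mulmnE mnm1E eqxx mul1n big_nat_cond big1 ?addn0 // => i /andP[i_n ij].
by rewrite mulmnE mnm1E (bvar_eq on_le) // 1?eq_sym ?(negPf ij) ?muln0.
Qed.

Lemma bsum_off w m : (forall i, in_block o n i -> m i = 0%N) -> bsum w m = 0%N.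
Proof.
move=> m0; rewrite /bsum big_nat_cond big1 // => j; rewrite andbT => jn.
by rewrite m0 ?muln0 // (bvar_in on_le).
Qed.

Lemma midsum_bsum m : midsum o n m = bsum (fun j => (0 < j < n)%N) m.
Proof.
rewrite bsumE /= ltnn andbF mul0n addn0 /midsum.
by apply: eq_big_nat => j ->; rewrite mul1n.
Qed.

Lemma block_std m : exists m', [/\ (midsum o n m' <= 1)%N, bA m' = bA m, bD m' = bD m
  & forall i, ~~ in_block o n i -> m' i = 0%N].
Proof.
(* Division with remainder dictates the monomial: [q] copies of the last variable, one middle
   variable of index [r] if [r > 0], and copies of the first variable to fill up [bA m], which [qle]
   shows to be possible. *)
pose q := (bD m %/ n)%N; pose r := (bD m %% n)%N.
have rn : (r < n)%N by rewrite ltn_mod.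
have qle : (h * (q + (0 < r)) <= bA m)%N.
  rewrite bAE -addnA -mulnDr; apply: leq_trans (leq_addl _ _).
  rewrite leq_mul2l; apply/orP; right.
  have : (bD m <= n * (midsum o n m + m (v n)))%N.
    rewrite bDE mulnDr leq_add2r; apply: leq_trans (midD_le m) _.
    by rewrite leq_mul2r leq_pred orbT.
  rewrite {1}(divn_eq (bD m) n) -/q -/r mulnC => H.
  have [r0|r0] := posnP r; first by rewrite addn0 -(leq_pmul2l n_gt0); lia.
  by rewrite addn1 -(ltn_pmul2l n_gt0); lia.
pose e := (bA m - h * (q + (0 < r)))%N.
exists (U_(v 0) *+ e + (U_(v n) *+ q + U_(v r) *+ (0 < r)))%MM.
rewrite midsum_bsum /bA /bD; have rn' := ltnW rn.
split.
- by rewrite !bsumD !bsumU //= ltnn andbF rn andbT !mul0n !add0n; case: (0 < r)%N.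
- rewrite !bsumD !bsumU //= (gtn_eqF n_gt0) mul1n -[bsum _ m]/(bA m).
  have -> : ((if r == 0 then 1 else h) * (0 < r) = h * (0 < r))%N.
    by case: posnP; rewrite ?muln0.
  by rewrite -mulnDr /e subnK.
- rewrite !bsumD !bsumU //= mul0n add0n -[bsum _ m]/(bD m).
  have -> : (r * (0 < r) = r)%N by have [->|] := posnP r; rewrite ?muln1.
  by rewrite mulnC -divn_eq.
- move=> i iV; have U0 j k : (j <= n)%N -> (U_(v j) *+ k)%MM i = 0%N.
    move=> jn; rewrite mulmnE mnm1E; case: eqP => [e'|_]; last by rewrite mul0n.
    by rewrite -e' (bvar_in on_le) in iV.
  by rewrite !mnmDE !U0.
Qed.

End BlockWeights.

(** * Weights and standard monomials of the join *)

Section JoinMonomials.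
Variables (h n1 n2 : nat) (a1 d1 a2 d2 : 'X_{1..4}).

Local Notation N := (n1 + n2).+1.
Local Notation v1 := (@bvar N 0).
Local Notation v2 := (@bvar N n1.+1).
Local Notation wt := (@join_wt h n1 n2 a1 d1 a2 d2).
Local Notation wd := (wdeg wt).
Local Notation mid1 := (@midsum N 0 n1).
Local Notation mid2 := (@midsum N n1.+1 n2).
Implicit Types m : 'X_{1..nvars n1 n2}.

Lemma blk1_le : (0 + n1 <= N)%N. Proof. by rewrite add0n; lia. Qed.
Lemma blk2_le : (n1.+1 + n2 <= N)%N. Proof. by lia. Qed.

Lemma blocks_disjoint i : @in_block N 0 n1 i -> ~~ @in_block N n1.+1 n2 i.
Proof. by rewrite /in_block; lia. Qed.

Lemma block_cases (i : 'I_(nvars n1 n2)) :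
  (exists2 j, (j <= n1)%N & i = v1 j) \/ (exists2 j, (j <= n2)%N & i = v2 j).
Proof.
have iN : (i < (n1 + n2).+2)%N := ltn_ord i.
have [i1|i1] := leqP i n1; [left; exists (i : nat) | right; exists (i - n1.+1)%N] => //.
- by apply: val_inj; rewrite /= (bvar_val blk1_le) ?add0n.
- by lia.
- by apply: val_inj; rewrite /= (bvar_val blk2_le); lia.
Qed.

Lemma join_sum (F : 'I_(nvars n1 n2) -> nat) :
  (\sum_i F i = \sum_(0 <= j < n1.+1) F (v1 j) + \sum_(0 <= j < n2.+1) F (v2 j))%N.
Proof.
have -> : (\sum_i F i = \sum_(0 <= k < (n1 + n2).+2) F (inord k))%N.
  by rewrite big_mkord; apply: eq_bigr => i _; rewrite inord_val.
rewrite (@big_cat_nat _ _ _ n1.+1) //=; last by lia.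
congr (_ + _)%N; rewrite -{1}[n1.+1]add0n big_addn.
have -> : ((n1 + n2).+2 - n1.+1 = n2.+1)%N by lia.
by apply: eq_bigr => j _; rewrite /bvar [(j + _)%N]addnC.
Qed.

Lemma mdeg_blocks m : mdeg m = (@bdeg N 0 n1 m + @bdeg N n1.+1 n2 m)%N.
Proof.
by rewrite mdegE join_sum; congr (_ + _)%N; apply: eq_bigr => j _; rewrite mul1n.
Qed.

Lemma wt1 j : (j <= n1)%N -> wt (v1 j) = gen h a1 d1 j.
Proof. by move=> jn; rewrite /join_wt (bvar_val blk1_le) // add0n jn. Qed.

Lemma wt2 j : (j <= n2)%N -> wt (v2 j) = gen h a2 d2 j.
Proof.
move=> jn; rewrite /join_wt (bvar_val blk2_le) // ifF; last by lia.
by rewrite addKn.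
Qed.

Local Notation A1 := (@bA N 0 n1 h).
Local Notation D1 := (@bD N 0 n1).
Local Notation A2 := (@bA N n1.+1 n2 h).
Local Notation D2 := (@bD N n1.+1 n2).

Lemma block_weight (o n : nat) (a d : 'X_{1..4}) m c :
  (\sum_(0 <= j < n.+1) gen h a d j c * m (@bvar N o j) =
   a c * @bA N o n h m + d c * @bD N o n m)%N.
Proof.
rewrite /bA /bD /bsum !big_distrr -big_split; apply: eq_bigr => j _.
case: j => [|j] /=; first by rewrite mul1n mul0n muln0 addn0.
by rewrite mnmDE !mulmnE mulnDl !mulnA.
Qed.

Lemma wd_coord m c : wd m c = (a1 c * A1 m + d1 c * D1 m + (a2 c * A2 m + d2 c * D2 m))%N.
Proof.
rewrite /wdeg mnm_sumE -!block_weight join_sum.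
by congr (_ + _)%N; apply: eq_big_nat => j jn; rewrite mulmnE (wt1, wt2).
Qed.

Hypotheses (h_ge1 : (1 <= h)%N) (n1_ge2 : (2 <= n1)%N) (n2_ge2 : (2 <= n2)%N).
Hypothesis indep : lin_indep a1 d1 a2 d2.

(** Row-freeness over the rationals recovers the four coefficients of [a1], [d1], [a2], [d2] from
    the weight, so questions about weights split into the two blocks. *)
Lemma wdP m m' : wd m = wd m' <->
  [/\ A1 m = A1 m', D1 m = D1 m', A2 m = A2 m' & D2 m = D2 m'].
Proof.
split=> [mm'|[e1 e2 e3 e4]]; last first.
  by apply/mnmP => c; rewrite !wd_coord e1 e2 e3 e4.
pose cf (m : 'X_{1..nvars n1 n2}) : 'rV[rat]_4 :=
  \row_i (tnth [tuple A1 m; D1 m; A2 m; D2 m] i)%:R.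
have cfE : cf m = cf m'.
  apply: (row_free_inj indep); apply/rowP=> c; rewrite !mxE.
  have S k : \sum_i cf k 0 i * (\matrix_(i < 4, j < 4)
     ((tnth [tuple a1; d1; a2; d2] i) j)%:R : 'M[rat]_4) i c = (wd k c)%:R.
    rewrite !big_ord_recl big_ord0 !mxE addr0 /= -!natrM -!natrD wd_coord.
    rewrite /tnth /= [(a1 c * _)%N]mulnC [(d1 c * _)%N]mulnC [(a2 c * _)%N]mulnC.
    by rewrite [(d2 c * _)%N]mulnC !addnA.
  by rewrite !S mm'.
have E i : tnth [tuple A1 m; D1 m; A2 m; D2 m] i = tnth [tuple A1 m'; D1 m'; A2 m'; D2 m'] i.
  by move/rowP/(_ i): cfE; rewrite !mxE => /eqP; rewrite Num.Theory.eqr_nat => /eqP.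
by split; [exact: (E 0) | exact: (E 1) | exact: (E (@Ordinal 4 2 isT)) | exact: (E (@Ordinal 4 3 isT))].
Qed.

Definition join_std m := (mid1 m <= 1)%N && (mid2 m <= 1)%N.

Definition join_ends : seq 'I_(nvars n1 n2) := [:: v1 0; v1 n1; v2 0; v2 n2].

Lemma join_std_ext m m' : join_std m -> wd m = wd m' ->
  [/\ (mdeg m' <= mdeg m)%N, forall z, z \in join_ends -> (m' z <= m z)%N
    & (forall z, z \in join_ends -> m' z = m z) -> m' = m].
Proof.
move=> /andP[s1 s2] /wdP[AE1 DE1 AE2 DE2].
have [ln1 l01 ld1 eq1] := block_ext blk1_le (ltnW n1_ge2) h_ge1 s1 AE1 DE1.
have [ln2 l02 ld2 eq2] := block_ext blk2_le (ltnW n2_ge2) h_ge1 s2 AE2 DE2.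
split.
- by rewrite !mdeg_blocks leq_add.
- by move=> z; rewrite !inE => /or4P[] /eqP ->.
- move=> zE; have E z : z \in join_ends -> m' z = m z := zE z.
  apply/mnmP => i; case: (block_cases i) => -[j jn ->].
    by apply: eq1 => //; apply: E; rewrite !inE eqxx ?orbT.
  by apply: eq2 => //; apply: E; rewrite !inE eqxx ?orbT.
Qed.

Lemma join_std_uniq m m' : join_std m -> join_std m' -> wd m = wd m' -> m = m'.
Proof.
move=> sm sm' mm'; have [_ l1 E] := join_std_ext sm mm'.
have [_ l2 _] := join_std_ext sm' (esym mm').
by apply/esym/E => z zj; apply/eqP; rewrite eqn_leq l1 // l2.
Qed.

Lemma join_std_ex m : exists2 m', join_std m' & wd m' = wd m.
Proof.
have [m1 [s1 A1E D1E off1]] := block_std blk1_le (ltnW n1_ge2) h_ge1 m.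
have [m2 [s2 A2E D2E off2]] := block_std blk2_le (ltnW n2_ge2) h_ge1 m.
have m1_2 i : @in_block N n1.+1 n2 i -> m1 i = 0%N.
  by move=> i2; apply: off1; apply/negP=> /blocks_disjoint; rewrite i2.
have m2_1 i : @in_block N 0 n1 i -> m2 i = 0%N.
  by move=> /blocks_disjoint; apply: off2.
have off w : (bsum 0 n1 w m2 = 0 /\ bsum n1.+1 n2 w m1 = 0)%N.
  by split; [apply: (bsum_off blk1_le) m2_1 | apply: (bsum_off blk2_le) m1_2].
exists (m1 + m2)%MM.
  have z1 : mid1 m2 = 0%N by rewrite (midsum_bsum _ (ltnW n1_ge2)) (off _).1.
  have z2 : mid2 m1 = 0%N by rewrite (midsum_bsum _ (ltnW n2_ge2)) (off _).2.
  by apply/andP; rewrite !midsumD z1 z2 addn0 add0n.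
apply/wdP; rewrite -A1E -D1E -A2E -D2E /bA /bD !bsumD.
by split; rewrite ?(proj1 (off _)) ?(proj2 (off _)) ?addn0.
Qed.

End JoinMonomials.

(** * The defining ideal and its resolution *)

Section EagonNorthcottDegrees.
Variables (K : fieldType) (N o n h q : nat).
Hypotheses (on_le : (o + n <= N)%N) (h_ge1 : (1 <= h)%N).
Variables (omega : 'X_{1..N.+1} -> 'X_{1..q}) (a d : 'X_{1..q}).
Local Notation Y := (@bmon N o h).
Hypothesis omegaD : forall m m', omega (m + m')%MM = (omega m + omega m')%MM.
Hypothesis omegaY : forall j, (j <= n)%N -> omega (Y j) = (a *+ h + d *+ j)%MM.
Local Notation EN := (eagon_northcott (scroll_mx K N o n h)).

(** Column [c] contributes the weight of [Y c]. Each factor [g_1], of which there are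
    [#|gset x|.-2 - gdiv x], contributes one [d], and one more [d] comes from the second exterior
    power of the target, as in the weight of a minor. *)
Definition EN_gdeg (b : EN_basis n) : 'X_{1..q} :=
  if b is Some x then
    (a *+ (#|gset x| * h) + d *+ (\sum_(c in gset x) c + (#|gset x|.-1 - gdiv x)))%MM
  else 0%MM.

Lemma mdeg_bmon j : (0 < mdeg (Y j))%N.
Proof. by case: j => [|j]; rewrite /bmon ?mdegMn mdeg1 ?mul1n ?muln1. Qed.

(** The strict growth of the degree yields minimality of the resolution, the equality of weights its
    grading. *)
Lemma EN_gdegP (u w : cell EN) : dcoef u w != 0 ->
  (mdeg u.2 < mdeg w.2)%N /\
  (EN_gdeg u.1 + omega u.2 = EN_gdeg w.1 + omega w.2)%MM.
Proof.
case: u => [[x|] m]; last by rewrite dcoef_none eqxx.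
case: w => [[y|] p] /=.
  move=> /dcoef_gen[s [sx yE] H]; have sn := ltn_ord s.
  have [xs cx] : (\sum_(c in gset x) c = s + \sum_(c in gset y) c)%N /\
      #|gset x| = #|gset y|.+1.
    by rewrite yE (big_setD1 s sx) /= (cardsD1 s (gset x)) sx.
  have := gdiv_lt y; have := gdiv_lt x; rewrite xs cx /= => gx gy.
  case: H => -[xy ->]; rewrite mdegD -[X in (X < _)%N]addn0 ltn_add2l mdeg_bmon; split=> //;
    rewrite omegaD omegaY ?(ltnW sn) //; apply/mnmP=> c;
    rewrite !mnmDE !mulmnE xy; move: (\sum_(c0 in _) _)%N (omega m c) => S W.
  - have -> : (#|gset y| - (gdiv y).+1 = #|gset y|.-1 - gdiv y)%N by lia.
    by rewrite mulSn !mulnDr; move: (a c * (#|gset y| * h))%N (a c * h)%N (d c * s)%N (d c * S)%N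
         (d c * (#|gset y|.-1 - gdiv y))%N => *; lia.
  - have -> : (#|gset y| - gdiv y = (#|gset y|.-1 - gdiv y).+1)%N by rewrite -subSn 1?ltnW // prednK // ltnW // card_gset.
    by rewrite mulSn !mulnDr !mulnS; move: (a c * (#|gset y| * h))%N (a c * h)%N (d c * s)%N (d c * S)%N
         (d c * (#|gset y|.-1 - gdiv y))%N => *; lia.
move=> /dcoef_min[i [j [ij xE H]]]; have [i_n jn] := (ltn_ord i, ltn_ord j).
have ij' : i != j by rewrite -val_eqE /= ltn_eqF.
have x0 : gdiv x = 0%N.
  by have := gdiv_lt x; rewrite xE cards2 ij' /= ltnS leqn0 => /eqP.
rewrite xE cards2 ij' x0 big_setU1 ?inE //= big_set1.
case: H => ->; rewrite !mdegD; split.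
- by have := mdeg_bmon i; lia.
- rewrite !omegaD !omegaY //; try lia.
  by apply/mnmP=> c; rewrite !mnmDE !mulmnE mnm0E; lia.
- by have := mdeg_bmon j; lia.
- rewrite !omegaD !omegaY //; try lia.
  by apply/mnmP=> c; rewrite !mnmDE !mulmnE mnm0E; lia.
Qed.

End EagonNorthcottDegrees.

Section IdealClosure.
Variable A : comPzRingType.
Implicit Types I J G : A -> Prop.

Lemma ideal_span_sum G (T : Type) (r : seq T) (P : pred T) (F : T -> A) :
  (forall t, P t -> ideal_span G (F t)) -> ideal_span G (\sum_(t <- r | P t) F t).
Proof.
by move=> H; elim/big_ind: _ => //; [exact: ideal_span0 | exact: ideal_spanD].
Qed.

Lemma ideal_spanS G H : (forall x, G x -> H x) ->
  forall x, ideal_span G x -> ideal_span H x.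
Proof.
move=> GH; apply: ideal_span_min => [|x y|a x Gx].
- exact: ideal_span0.
- exact: ideal_spanD.
- by apply/ideal_spanM/ideal_span_sub/GH.
Qed.

Lemma ideal_add_span G H x : ideal_add (ideal_span G) (ideal_span H) x <->
  ideal_span (fun y => G y \/ H y) x.
Proof.
split=> [[u [w [Gu Hw ->]]]|].
  by apply: ideal_spanD; [apply: ideal_spanS Gu | apply: ideal_spanS Hw] => y; auto.
move: x; apply: ideal_span_min.
- by exists 0, 0; rewrite addr0; split=> //; apply: ideal_span0.
- move=> _ _ [u [w [Gu Hw ->]]] [u' [w' [Gu' Hw' ->]]].
  by exists (u + u'), (w + w'); rewrite addrACA; split=> //; apply: ideal_spanD.
- move=> a x [Gx|Hx].
    exists (a * x), 0; rewrite addr0; split=> //; last exact: ideal_span0.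
    exact/ideal_spanM/ideal_span_sub.
  exists 0, (a * x); rewrite add0r; split=> //; first exact: ideal_span0.
  exact/ideal_spanM/ideal_span_sub.
Qed.

End IdealClosure.

Section WeightedDegree.
Variables (n q : nat) (w : 'I_n -> 'X_{1..q}).

Lemma wdegD m m' : wdeg w (m + m')%MM = (wdeg w m + wdeg w m')%MM.
Proof.
apply/mnmP=> c; rewrite mnmDE /wdeg !mnm_sumE -big_split; apply: eq_bigr => i _.
by rewrite !mulmnE mnmDE mulnDr.
Qed.

Lemma wdegUn i k : wdeg w (U_(i) *+ k)%MM = (w i *+ k)%MM.
Proof.
apply/mnmP=> c; rewrite /wdeg mnm_sumE (bigD1 i) //= !mulmnE mnm1E eqxx mul1n.
rewrite big1 ?addn0 // => j ji; rewrite !mulmnE mnm1E eq_sym (negPf ji).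
by rewrite muln0.
Qed.

Lemma wdegU i : wdeg w U_(i)%MM = w i.
Proof. by have := wdegUn i 1; rewrite !mulm1n. Qed.

End WeightedDegree.

Section JoinResolution.
Variables (K : fieldType) (h n1 n2 : nat) (a1 d1 a2 d2 : 'X_{1..4}).
Hypotheses (h_ge1 : (1 <= h)%N) (n1_ge2 : (2 <= n1)%N) (n2_ge2 : (2 <= n2)%N).
Hypothesis indep : lin_indep a1 d1 a2 d2.

Local Notation N := (n1 + n2).+1.
Local Notation v1 := (@bvar N 0).
Local Notation wt := (@join_wt h n1 n2 a1 d1 a2 d2).
Local Notation wd := (wdeg wt).
Local Notation Q1 := (scroll_mx K N 0 n1 h).
Local Notation Q2 := (scroll_mx K N n1.+1 n2 h).
Local Notation jI := (@join_ideal K h n1 n2 a1 d1 a2 d2).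
Local Notation join_std := (@join_std n1 n2).
Implicit Types (m : 'X_{1..nvars n1 n2}) (f g : {mpoly K[nvars n1 n2]}).

Lemma rnc_scroll s n : rnc_matrix K n1 n2 h s n = scroll_mx K N s n h.
Proof.
apply/matrixP=> r c; rewrite !mxE; case: ifP => [/andP[/eqP -> /eqP ->]|rc].
  by rewrite /xvar /= /bvar addn0 mpolyXn.
have rc0 : (c + r != 0)%N.
  apply: contraFneq rc => /eqP; rewrite addn_eq0 => /andP[/eqP -> r0].
  by rewrite eqxx andbT -val_eqE.
rewrite /xvar /= /bmon; move: rc0; case E : (c + r)%N => [|j] // _.
by rewrite /bvar -E addnA.
Qed.

Lemma wdY1 j : (j <= n1)%N -> wd (bmon N 0 h j) = (a1 *+ h + d1 *+ j)%MM.
Proof.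
case: j => [|j] jn; rewrite /bmon (wdegUn, wdegU) wt1 //.
by rewrite mulm0n addm0.
Qed.

Lemma wdY2 j : (j <= n2)%N -> wd (bmon N n1.+1 h j) = (a2 *+ h + d2 *+ j)%MM.
Proof.
case: j => [|j] jn; rewrite /bmon (wdegUn, wdegU) wt2 //.
by rewrite mulm0n addm0.
Qed.

Lemma comp_join m : ('X_[K, m] : {mpoly K[nvars n1 n2]}) \mPo
  [tuple 'X_[wt k] | k < nvars n1 n2] = 'X_[wd m].
Proof.
rewrite comp_mpolyX /wdeg.
rewrite (big_morph (fun m : 'X_{1..4} => 'X_[K, m]) (@mpolyXD _ _) (@mpolyX0 _ _)).
by apply: eq_bigr => i _; rewrite tnth_mktuple mpolyXn.
Qed.

Lemma join_coef f (c : 'X_{1..4}) :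
  (f \mPo [tuple 'X_[wt k] | k < nvars n1 n2])@_c =
  \sum_(m <- msupp f | wd m == c) f@_m.
Proof.
rewrite comp_mpolyEX raddf_sum /= [RHS]big_mkcond; apply: eq_bigr => m _.
rewrite mcoeffZ comp_join mcoeffX.
by case: eqP; rewrite ?mulr1 ?mulr0.
Qed.

Lemma join_idealM f g : jI g -> jI (f * g).
Proof. by rewrite /join_ideal rmorphM /= => ->; rewrite mulr0. Qed.

Lemma join_idealD f g : jI f -> jI g -> jI (f + g).
Proof. by rewrite /join_ideal rmorphD /= => -> ->; rewrite addr0. Qed.

Lemma join_idealB f g : jI f -> jI g -> jI (f - g).
Proof. by rewrite /join_ideal rmorphB /= => -> ->; rewrite subr0. Qed.

Lemma join_ideal_binomial m m' : wd m = wd m' -> jI ('X_[m] - 'X_[m']).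
Proof. by move=> mm'; rewrite /join_ideal rmorphB /= !comp_join mm' subrr. Qed.

(** The coefficients of [f] over a single weight add up to zero, so no weight is hit exactly
    once. *)
Lemma join_ideal_partner f m : jI f -> m \in msupp f ->
  exists2 m', m' \in msupp f & m' != m /\ wd m' = wd m.
Proof.
move=> If mf; apply: contrapT => H.
have := join_coef f (wd m); rewrite If mcoeff0 big_mkcond.
rewrite (bigD1_seq m) ?msupp_uniq //= eqxx big_seq_cond big1 ?addr0.
  by move/esym/eqP; rewrite mcoeff_eq0 mf.
move=> m' /andP[m'f nm]; case: eqP => // wm.
by case: H; exists m'.
Qed.

Lemma join_ideal_std f : jI f -> (forall m, m \in msupp f -> join_std m) -> f = 0.
Proof.
move=> If fstd; apply/eqP; rewrite -msupp_eq0; case E : (msupp f) => [//|m s].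
have mf : m \in msupp f by rewrite E mem_head.
have [m' m'f [m'm wm]] := join_ideal_partner If mf.
by case/eqP: m'm; apply: (join_std_uniq h_ge1 n1_ge2 n2_ge2 indep) wm; apply: fstd.
Qed.

Local Notation C1 := (eagon_northcott Q1).
Local Notation C2 := (eagon_northcott Q2).
Local Notation T := (tensor_complex C1 C2).

Lemma EN_tensor_complex : is_complex T.
Proof. by apply: is_complex_tensor; apply: EN_is_complex. Qed.

Lemma EN_tensor_lm1 : local_matching (@in_block N 0 n1) (@EN_crit K N 0 n1 h)
  (@EN_mt K N 0 n1 h) (@EN_rk K N 0 n1 h).
Proof. exact: EN_local (blk1_le n1 n2) n1_ge2 h_ge1. Qed.

Lemma EN_tensor_lm2 : local_matching (@in_block N n1.+1 n2) (@EN_crit K N n1.+1 n2 h)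
  (@EN_mt K N n1.+1 n2 h) (@EN_rk K N n1.+1 n2 h).
Proof. exact: EN_local (blk2_le n1 n2) n2_ge2 h_ge1. Qed.

Definition EN_tensor_matching :=
  tensor_matching (@EN_is_complex _ _ Q1) (@EN_is_complex _ _ Q2) EN_tensor_lm1 EN_tensor_lm2
    (@blocks_disjoint n1 n2).

Definition EN_tensor_unit : cbasis T := (None, None).

Lemma EN_tensor_deg0 (b : cbasis T) : cdeg b = 0%N <-> b = EN_tensor_unit.
Proof.
have deg0 n (x : EN_basis n) : EN_deg x = 0%N -> x = None.
  by case: x => // x /= x0; have := gdiv_lt x; rewrite x0.
split=> [|-> //]; case: b => b1 b2 /= /eqP; rewrite addn_eq0 => /andP[/eqP b10 /eqP b20].
by rewrite (deg0 _ _ b10) (deg0 _ _ b20).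
Qed.

Lemma minorsP (R : comNzRingType) n (P : 'M[R]_(2, n)) x : x \in minors P <->
  exists i j : 'I_n, (i < j)%N /\ x = minor2 P i j.
Proof.
split=> [/mapP[[i j]]|[i [j [ij ->]]]].
  by rewrite mem_filter /= => /andP[ij _] ->; exists i, j.
by apply/mapP; exists (i, j) => //; rewrite mem_filter /= ij mem_enum.
Qed.

Lemma EN_diff_minors_ideal n (R : comNzRingType) (P : 'M[R]_(2, n)) b :
  minors_ideal P (EN_diff P b None).
Proof.
case: b => [x|]; last exact: ideal_span0.
rewrite /EN_diff; case: ifP => // _; last exact: ideal_span0.
apply: ideal_span_sum => i _; apply: ideal_span_sum => j /andP[_ ij].
by apply: ideal_span_sub; apply/minorsP; exists i, j.
Qed.

Lemma EN_tensor_image_ideal (r : {mpoly K[nvars n1 n2]}) x :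
  cmap x = [ffun b : cbasis T => if b == EN_tensor_unit then r else 0] ->
  ideal_add (minors_ideal Q1) (minors_ideal Q2) r.
Proof.
move=> /ffunP/(_ EN_tensor_unit); rewrite !ffunE eqxx => <-; apply/ideal_add_span.
apply: ideal_span_sum => -[b1 b2] _ /=; apply: ideal_spanM.
apply: ideal_spanD; rewrite ?mulrA; apply: ideal_spanM.
  by apply: ideal_spanS (EN_diff_minors_ideal Q1 b1) => y; left.
by apply: ideal_spanS (EN_diff_minors_ideal Q2 b2) => y; right.
Qed.

Lemma scroll_minor_join o n (a d : 'X_{1..4}) i j :
  (forall k, (k <= n)%N -> wd (bmon N o h k) = (a *+ h + d *+ k)%MM) ->
  jI (minor2 (scroll_mx K N o n h) i j).
Proof.
move=> wY; rewrite minor2E !scrollE !addn0 !addn1 -!mpolyXD.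
apply: join_ideal_binomial; have [i_n jn] := (ltn_ord i, ltn_ord j).
rewrite !wdegD !wY //; try exact: ltnW.
by apply/mnmP=> c; rewrite !mnmDE !mulmnE !mulnS; lia.
Qed.

Lemma minors_ideal_join f :
  ideal_add (minors_ideal Q1) (minors_ideal Q2) f -> jI f.
Proof.
move/ideal_add_span; move: f; apply: ideal_span_min.
- by rewrite /join_ideal rmorph0.
- exact: join_idealD.
- move=> c x [] /minorsP[i [j [ij ->]]]; apply: join_idealM.
    exact: scroll_minor_join wdY1.
  exact: scroll_minor_join wdY2.
Qed.

(** The remainder of [f] under the matching stays in the kernel, because the boundary subtracted
    from it is a combination of minors; being supported on standard monomials it is zero. This gives
    at once that the minors generate and that the complex resolves the quotient in degree zero. *)
Lemma EN_tensor_lift f : jI f -> exists2 x, in_cdeg 1 x &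
  cmap x = [ffun b : cbasis T => if b == EN_tensor_unit then f else 0].
Proof.
move=> If; pose v : {ffun cbasis T -> {mpoly K[N.+1]}} :=
  [ffun b => if b == EN_tensor_unit then f else 0].
have Dv : in_cdeg 0 v.
  by move=> b; rewrite ffunE; case: (b =P EN_tensor_unit) => [-> //|_]; rewrite eqxx.
have [x Dx Sx] := matching_reduce EN_tensor_complex EN_tensor_matching Dv.
exists x => //; apply/esym/subr0_eq; set g := v - cmap x in Sx *.
have g_other b : b != EN_tensor_unit -> g b = 0.
  move=> bb0; rewrite !ffunE (negPf bb0) sub0r big1 ?oppr0 // => b' _.
  have [->|/Dx b'1] := eqVneq (x b') 0; first by rewrite mul0r.
  have [->|/(EN_tensor_complex.1)] := eqVneq (cdiff b' b) 0; first by rewrite mulr0.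
  by rewrite b'1 => -[] /esym/EN_tensor_deg0 e; rewrite e eqxx in bb0.
have g0 : g EN_tensor_unit = 0.
  apply: join_ideal_std.
    rewrite !ffunE eqxx; apply: join_idealB => //; apply: minors_ideal_join.
    apply: (@EN_tensor_image_ideal _ x); apply/ffunP=> b; rewrite [RHS]ffunE.
    case: (b =P EN_tensor_unit) => [->|/eqP bb0]; first by rewrite ffunE.
    by have := g_other b bb0; rewrite /g !ffunE (negPf bb0) sub0r => /eqP;
       rewrite oppr_eq0 => /eqP.
  move=> m; rewrite mcoeff_msupp => gm; case: (Sx (EN_tensor_unit, m) gm).
    by case=> -[_ /= s1] [_ /= s2]; apply/andP.
  by case=> w [[]|[]].
apply/ffunP=> b; rewrite [RHS]ffunE.
by have [->|/g_other] := eqVneq b EN_tensor_unit.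
Qed.

Lemma join_ideal_minors f : jI f <-> ideal_add (minors_ideal Q1) (minors_ideal Q2) f.
Proof.
split=> [/EN_tensor_lift[x _ xE]|]; last exact: minors_ideal_join.
exact: EN_tensor_image_ideal xE.
Qed.

Lemma EN_tensor_resolves : resolves jI EN_tensor_unit.
Proof.
split.
- exact: EN_tensor_complex.
- exact: EN_tensor_deg0.
- move=> r; split=> [/EN_tensor_lift //|[x _ xE]].
  by apply/join_ideal_minors; apply: EN_tensor_image_ideal xE.
- move=> k v; apply: (matching_exact EN_tensor_complex EN_tensor_matching).
  exact: tensor_crit_deg EN_tensor_lm1 EN_tensor_lm2.
Qed.

Lemma join_minimal_resolution : minimal_graded_resolution wt T jI.
Proof.
pose g1 := @EN_gdeg n1 h 4 a1 d1; pose g2 := @EN_gdeg n2 h 4 a2 d2.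
have D1 := @EN_gdegP K N 0 n1 h 4 (blk1_le n1 n2) h_ge1 wd a1 d1 (@wdegD _ _ wt) wdY1.
have D2 := @EN_gdegP K N n1.+1 n2 h 4 (blk2_le n1 n2) h_ge1 wd a2 d2 (@wdegD _ _ wt) wdY2.
have wd0 : wd 0%MM = 0%MM by have := wdegUn wt (v1 0) 0; rewrite !mulm0n.
have D (b c : cbasis T) m : m \in msupp (cdiff b c) ->
    (0 < mdeg m)%N /\ (g1 b.1 + g2 b.2 = g1 c.1 + g2 c.2 + wd m)%MM.
  rewrite mcoeff_msupp.
  (* An entry of the differential is the boundary of a cell with trivial monomial, so the results on
     cells apply to it. *)
  have -> : (cdiff b c)@_m = dcoef ((b, 0%MM) : cell T) (c, m).
    by rewrite /dcoef /= mpolyX0 mul1r.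
  rewrite dcoef_tensor /= => H.
  have [[e H']|[e H']] : (b.2 = c.2 /\ dcoef ((b.1, 0%MM) : cell C1) (c.1, m) != 0) \/
      (b.1 = c.1 /\ dcoef ((b.2, 0%MM) : cell C2) (c.2, m) != 0).
    move: H; have [->|_] := eqVneq b.2 c.2.
      have [->|H _] := eqVneq (dcoef ((b.1, 0%MM) : cell C1) (c.1, m)) 0; last by left.
      rewrite mulr0 add0r; have [->|_] := eqVneq b.1 c.1; last by rewrite mul0r mulr0 => /eqP.
      by rewrite mul1r mulf_eq0 negb_or => /andP[_ ?]; right.
    rewrite mul0r add0r; have [->|_] := eqVneq b.1 c.1; last by rewrite mul0r mulr0 => /eqP.
    by rewrite mul1r mulf_eq0 negb_or => /andP[_ ?]; right.
  - have [m0 E] := D1 _ _ H'; rewrite mdeg0 in m0; split=> //.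
    by move: E; rewrite /= wd0 addm0 -/(g1 b.1) -/(g1 c.1) e => ->; rewrite -!addmA [(wd m + _)%MM]addmC.
  - have [m0 E] := D2 _ _ H'; rewrite mdeg0 in m0; split=> //.
    by move: E; rewrite /= wd0 addm0 -/(g2 b.2) -/(g2 c.2) e => ->; rewrite addmA.
exists EN_tensor_unit, (fun b => (g1 b.1 + g2 b.2)%MM); split.
- exact: EN_tensor_resolves.
- by rewrite /= addm0.
- by move=> b c m /D[].
- move=> b c; apply/eqP; rewrite mcoeff_eq0; apply/negP => /D[].
  by rewrite mdeg0.
Qed.

End JoinResolution.

(** * The Groebner basis *)

Lemma index_iota_mem m n k : (m <= k < m + n)%N -> index k (iota m n) = (k - m)%N.
Proof.
move=> kmn; have kn : (k - m < n)%N by lia.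
rewrite -{1}(subnKC (m := m) (n := k)) -?(nth_iota 0 m kn); last by lia.
by rewrite index_uniq ?size_iota ?iota_uniq.
Qed.

Lemma index_map_in (T U : eqType) (f : T -> U) (s : seq T) x :
  {in s &, injective f} -> x \in s -> index (f x) (map f s) = index x s.
Proof.
elim: s => //= y s IH f_inj; rewrite inE => xs.
have [->|yx] := eqVneq y x; first by rewrite eqxx.
case: eqP => [/f_inj e|_].
  by move: yx; rewrite e ?eqxx // inE ?eqxx.
have xs' : x \in s by move: xs; rewrite eq_sym (negPf yx).
by rewrite IH // => a b as_ bs; apply: f_inj; rewrite inE ?as_ ?bs orbT.
Qed.

(** * The local order and the leading terms of minors *)

Section Order.
Variables (n1 n2 : nat).
Hypotheses (n1_ge2 : (2 <= n1)%N) (n2_ge2 : (2 <= n2)%N).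
Local Notation N := (n1 + n2).+1.
Local Notation v1 := (@bvar N 0).
Local Notation v2 := (@bvar N n1.+1).
Local Notation s := (join_vars n1 n2).

Lemma join_vars_index (k : nat) : (1 <= k <= N.+1)%N ->
  index (inord k.-1) s =
  if (2 <= k <= n1)%N then (k - 2)%N else
  if (n1 + 3 <= k <= n1 + n2 + 1)%N then (n1.-1 + (k - (n1 + 3)))%N else
  (n1.-1 + (n2.-1 + index k [:: 1; n1 + 1; n1 + 2; n1 + n2 + 2]%N))%N.
Proof.
move=> kN; pose f (x : nat) : 'I_N.+1 := inord x.-1.
pose L := iota 2 n1.-1 ++ iota (n1 + 3) n2.-1 ++ [:: 1; n1 + 1; n1 + 2; n1 + n2 + 2]%N.
have L_le x : x \in L -> (1 <= x <= N.+1)%N.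
  by rewrite !mem_cat !mem_iota !inE => /or3P[||/or4P[] /eqP ->]; lia.
have kL : k \in L by rewrite !mem_cat !mem_iota !inE; lia.
have f_inj : {in L &, injective f}.
  move=> x y /L_le xN /L_le yN /(congr1 (fun i : 'I_N.+1 => nat_of_ord i)).
  by rewrite !inordK; lia.
rewrite -[LHS]/(index (f k) (map f L)) index_map_in // index_cat mem_iota size_iota.
have -> : (2 <= k < 2 + n1.-1)%N = (2 <= k <= n1)%N by lia.
case: ifP => [kn1|_]; first by rewrite index_iota_mem //; lia.
rewrite index_cat mem_iota size_iota.
have -> : (n1 + 3 <= k < n1 + 3 + n2.-1)%N = (n1 + 3 <= k <= n1 + n2 + 1)%N by lia.
by case: ifP => [kn2|_] //; rewrite index_iota_mem //; lia.
Qed.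

(** The position of a variable within its block in decreasing order: the middle ones, then the
    first, then the last. A minor involves one block only, so this decides its leading term. *)
Definition block_key (n j : nat) : nat :=
  if (0 < j < n)%N then j else if j == 0 then n else n.+1.

Lemma block_key_le n j : (j <= n)%N -> (block_key n j <= n.+1)%N.
Proof. by rewrite /block_key => jn; case: ifP => _; last case: ifP; lia. Qed.

Lemma block_key_last n j : (j <= n)%N -> (n < block_key n j)%N -> j = n.
Proof.
by rewrite /block_key => jn; case: ifP => ?; last case: ifP => ?; lia.
Qed.

Lemma block_key_mid n j : (0 < j < n)%N -> block_key n j = j.
Proof. by rewrite /block_key => ->. Qed.

Lemma block_key_gt n j : (0 < j)%N -> (block_key n j = j \/ (n <= j)%N).
Proof. by rewrite /block_key => j0; case: ifP => ?; [left | right; lia]. Qed.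

Lemma index_v1 j : (j <= n1)%N -> index (v1 j) s =
  if (0 < j < n1)%N then j.-1 else (n1.-1 + n2.-1 + (j != 0))%N.
Proof.
move=> jn; rewrite -[v1 j]/(inord j.+1.-1) join_vars_index; last by lia.
case: ifP => [jn'|j_end]; first by lia.
case: ifP => [|_]; first by lia.
rewrite /=; have [->|j0] := eqVneq j 0%N; first by rewrite /= addn0; lia.
have -> : j = n1 by lia.
by case: ifP => [|_]; [lia | case: ifP; lia].
Qed.

Lemma index_v2 j : (j <= n2)%N -> index (v2 j) s =
  if (0 < j < n2)%N then (n1.-1 + j.-1)%N else (n1.-1 + n2.-1 + 2 + (j != 0))%N.
Proof.
move=> jn; rewrite -[v2 j]/(inord (n1.+2 + j).-1) join_vars_index; last by lia.
rewrite ifF; last by lia.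
case: ifP => [jn'|j_end]; first by rewrite ifT; lia.
rewrite ifF; last by lia.
rewrite /=; have [->|j0] := eqVneq j 0%N.
  by rewrite addn0; do 4?case: ifP; lia.
have -> : j = n2 by lia.
by do 4?case: ifP; lia.
Qed.

Lemma mem_join_vars i : i \in s.
Proof.
rewrite -index_mem; have -> : size s = N.+1.
  by rewrite size_map !size_cat !size_iota /=; lia.
case: (block_cases i) => -[j jn ->].
  by rewrite index_v1 //; case: ifP; case: (j == 0)%N; lia.
by rewrite index_v2 //; case: ifP; case: (j == 0)%N; lia.
Qed.

Lemma index_mid_end i z : i \notin join_ends n1 n2 -> z \in join_ends n1 n2 ->
  (index i s < index z s)%N.
Proof.
move=> i_mid z_end.
have lo : (index i s < n1.-1 + n2.-1)%N.
  move: i_mid; case: (block_cases i) => -[j jn ->].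
    rewrite index_v1 //; case: ifP => H; [lia | rewrite !inE].
    have [->|->] : j = 0%N \/ j = n1 by lia.
      by rewrite eqxx.
    by rewrite eqxx orbT.
  rewrite index_v2 //; case: ifP => H; [lia | rewrite !inE].
  have [->|->] : j = 0%N \/ j = n2 by lia.
    by rewrite eqxx !orbT.
  by rewrite eqxx !orbT.
apply: leq_trans lo _; move: z_end; rewrite !inE => /or4P[] /eqP ->.
- by rewrite index_v1 //= leq_addr.
- by rewrite index_v1 // ltnn andbF leq_addr.
- by rewrite index_v2 //= -addnA leq_addr.
- by rewrite index_v2 // ltnn andbF -addnA leq_addr.
Qed.

Lemma neg_degrevlex_asym m m' :
  neg_degrevlex_gt s m m' -> neg_degrevlex_gt s m' m -> False.
Proof.
case=> [d1|[e [i mi eqi]]] [d2|[e2 [j mj eqj]]]; [lia | lia | lia |].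
have [ij|ji|ij] := ltngtP (index i s) (index j s).
- by have := eqi j ij; lia.
- by have := eqj i ji; lia.
- have eij : i = j by rewrite -(nth_index ord0 (mem_join_vars i)) ij nth_index ?mem_join_vars.
  by rewrite eij in mi; lia.
Qed.

(** If [i = 0] and [h > 1], the tail has larger degree. Otherwise the deciding variable occurs in
    the tail alone: it is the first variable of the block if [i = 0] and [j.+1 < n], and the one of
    index [j.+1] in all other cases. *)
Lemma minor_gt o n h (i j : 'I_n) : (o + n <= N)%N -> (1 <= h)%N ->
  (forall a b, (a <= n)%N -> (b <= n)%N ->
     (index (@bvar N o a) s < index (@bvar N o b) s)%N -> (block_key n a < block_key n b)%N) ->
  (i < j)%N ->
  neg_degrevlex_gt s (bmon N o h i.+1 + bmon N o h j) (bmon N o h i + bmon N o h j.+1).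
Proof.
move=> on_le h1 key ij; have [i_n jn] := (ltn_ord i, ltn_ord j).
have dY k : (0 < k)%N -> mdeg (bmon N o h k) = 1%N by case: k => // k _; rewrite mdeg1.
rewrite /neg_degrevlex_gt !mdegD (dY i.+1) // (dY j.+1) // (dY j); last by lia.
have pick k : (k <= n)%N ->
    (bmon N o h i.+1 + bmon N o h j)%MM (@bvar N o k) = 0%N ->
    (0 < (bmon N o h i + bmon N o h j.+1)%MM (@bvar N o k))%N ->
    (forall b, (b <= n)%N -> (block_key n k < block_key n b)%N ->
       (bmon N o h i.+1 + bmon N o h j)%MM (@bvar N o b) =
       (bmon N o h i + bmon N o h j.+1)%MM (@bvar N o b)) ->
    exists2 x, ((bmon N o h i.+1 + bmon N o h j)%MM x < (bmon N o h i + bmon N o h j.+1)%MM x)%N &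
      forall y, (index x s < index y s)%N ->
      (bmon N o h i.+1 + bmon N o h j)%MM y = (bmon N o h i + bmon N o h j.+1)%MM y.
  move=> kn z0 pos H; exists (@bvar N o k); first by rewrite z0.
  move=> y ky; have [yV|yV] := boolP (@in_block N o n y); last first.
    by rewrite !mnmDE !(bmon_off h on_le) // ltnW.
  have [b bn yE] : exists2 b, (b <= n)%N & y = @bvar N o b.
    have /andP[oy yo] : (o <= y <= o + n)%N := yV.
    exists (y - o)%N; first by lia.
    by apply: val_inj; rewrite /= (bvar_val on_le); lia.
  by rewrite yE in ky *; apply: H => //; apply: key.
have ev a b : (a <= n)%N -> (0 < b <= n)%N -> bmon N o h a (@bvar N o b) = (b == a).
  move=> an /andP[b0 bn]; rewrite (bmonE h on_le) //.
  by have [<-|_] := eqVneq b a; rewrite ?(gtn_eqF b0).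
have ev0 a : (0 < a <= n)%N -> bmon N o h a (@bvar N o 0) = 0%N.
  by move=> /andP[a0 an]; rewrite (bmonE h on_le) // eq_sym gtn_eqF.
have [jn'|jn'] := leqP n j.+1.
  have [h_eq|h_gt] : mdeg (bmon N o h i) = 1%N \/ (1 < mdeg (bmon N o h i))%N.
  - by have := mdeg_bmon N o h1 i; lia.
  - right; rewrite h_eq; split=> //; apply: (pick j.+1) => //.
    + by rewrite mnmDE !ev //; lia.
    + by rewrite mnmDE [X in (_ + X)%N]ev ?eqxx //; lia.
    + move=> b bn; have -> : j.+1 = n by lia.
      rewrite {1}/block_key ltnn andbF gtn_eqF ?(leq_trans _ jn) // => H.
      by have := block_key_le bn; lia.
  - by left; rewrite ltn_add2r.
have [i0|i0] := posnP i.
  rewrite i0; have [h_gt|h_eq] := ltnP 1 h.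
    by left; rewrite mdegMn mdeg1; lia.
  right; have h_1 : h = 1%N by lia.
  split; first by rewrite mdegMn mdeg1; lia.
  have := pick 0%N; rewrite i0; apply=> //.
  - by rewrite mnmDE !ev0 //; lia.
  - by rewrite mnmDE (bmonE h on_le) // eqxx mul1n addn_gt0 h1.
  - move=> b bn; rewrite -[block_key n 0]/n => /(block_key_last bn) ->.
    by rewrite !mnmDE !ev //; lia.
right; split; first by rewrite (dY i).
apply: (pick j.+1) => //.
- by rewrite mnmDE !ev //; lia.
- by rewrite mnmDE [X in (_ + X)%N]ev ?eqxx //; lia.
- move=> b bn; rewrite block_key_mid ?jn' // => H; rewrite !mnmDE.
  have [b0|b0] := posnP b; first by rewrite b0 !ev0 //; lia.
  have bj : (j.+1 < b)%N by case: (block_key_gt n b0) => [bE|nb]; lia.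
  by rewrite !ev ?b0 //; lia.
Qed.

End Order.

Section Groebner.
Variables (K : fieldType) (h n1 n2 : nat) (a1 d1 a2 d2 : 'X_{1..4}).
Hypotheses (h_ge1 : (1 <= h)%N) (n1_ge2 : (2 <= n1)%N) (n2_ge2 : (2 <= n2)%N).
Hypothesis indep : lin_indep a1 d1 a2 d2.

Local Notation N := (n1 + n2).+1.
Local Notation v1 := (@bvar N 0).
Local Notation v2 := (@bvar N n1.+1).
Local Notation Q1 := (scroll_mx K N 0 n1 h).
Local Notation Q2 := (scroll_mx K N n1.+1 n2 h).
Local Notation jI := (@join_ideal K h n1 n2 a1 d1 a2 d2).
Local Notation join_std := (@join_std n1 n2).
Local Notation gt := (neg_degrevlex_gt (join_vars n1 n2)).

Definition minor_lead o (i j : nat) : 'X_{1..N.+1} := (bmon N o h i.+1 + bmon N o h j)%MM.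
Definition minor_tail o (i j : nat) : 'X_{1..N.+1} := (bmon N o h i + bmon N o h j.+1)%MM.

Lemma minor_terms o n (i j : 'I_n) :
  minor2 (scroll_mx K N o n h) i j = 'X_[minor_tail o i j] - 'X_[minor_lead o i j].
Proof.
rewrite minor2E !scrollE !addn0 !addn1 -!mpolyXD; congr (_ - 'X_[_]).
exact: addmC.
Qed.

Lemma is_lead_binomial (p q : 'X_{1..N.+1}) : gt q p ->
  forall m, is_lead gt ('X_[p] - 'X_[q] : {mpoly K[N.+1]}) m <-> m = q.
Proof.
move=> qp m; have pq : p != q.
  by apply/eqP=> pq; rewrite pq in qp; exact: (neg_degrevlex_asym n1_ge2 n2_ge2 qp qp).
have msE k : (k \in msupp ('X_[p] - 'X_[q] : {mpoly K[N.+1]})) = (k == p) || (k == q).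
  rewrite mcoeff_msupp mcoeffB !mcoeffX ![_ == k]eq_sym.
  have [->|_] := eqVneq k p; first by rewrite (negPf pq) subr0 oner_neq0.
  by have [_|_] := eqVneq k q; rewrite sub0r oppr_eq0 ?oner_neq0 ?eqxx.
split=> [[mS mmax]|->].
  move: mS; rewrite msE => /orP[/eqP mp|/eqP //].
  have := mmax q; rewrite msE eqxx orbT mp eq_sym => /(_ isT pq) pq'.
  by case: (neg_degrevlex_asym n1_ge2 n2_ge2 pq' qp).
split=> [|m']; rewrite msE ?eqxx ?orbT // => /orP[/eqP -> //|/eqP ->].
by rewrite eqxx.
Qed.

Lemma key1 a b : (a <= n1)%N -> (b <= n1)%N ->
  (index (v1 a) (join_vars n1 n2) < index (v1 b) (join_vars n1 n2))%N ->
  (block_key n1 a < block_key n1 b)%N.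
Proof.
move=> an bn; rewrite !(index_v1 n1_ge2 n2_ge2) // /block_key.
case: ifP => H1; case: ifP => H2.
- by lia.
- by have [b0|b0] := eqVneq b 0%N; lia.
- by have [a0|a0] := eqVneq a 0%N; lia.
- by have [b0|b0] := eqVneq b 0%N; have [a0|a0] := eqVneq a 0%N; lia.
Qed.

Lemma key2 a b : (a <= n2)%N -> (b <= n2)%N ->
  (index (v2 a) (join_vars n1 n2) < index (v2 b) (join_vars n1 n2))%N ->
  (block_key n2 a < block_key n2 b)%N.
Proof.
move=> an bn; rewrite !(index_v2 n1_ge2 n2_ge2) // /block_key.
case: ifP => H1; case: ifP => H2.
- by lia.
- by have [b0|b0] := eqVneq b 0%N; lia.
- by have [a0|a0] := eqVneq a 0%N; lia.
- by have [b0|b0] := eqVneq b 0%N; have [a0|a0] := eqVneq a 0%N; lia.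
Qed.

Lemma gt1 (i j : 'I_n1) : (i < j)%N -> gt (minor_lead 0 i j) (minor_tail 0 i j).
Proof. exact: (minor_gt n1_ge2 n2_ge2 (blk1_le n1 n2) h_ge1 key1). Qed.

Lemma gt2 (i j : 'I_n2) : (i < j)%N -> gt (minor_lead n1.+1 i j) (minor_tail n1.+1 i j).
Proof. exact: (minor_gt n1_ge2 n2_ge2 (blk2_le n1 n2) h_ge1 key2). Qed.

Lemma mem_minors g : g \in minors Q1 ++ minors Q2 -> exists o n (i j : 'I_n),
  [/\ (o = 0%N /\ n = n1) \/ (o = n1.+1 /\ n = n2), (i < j)%N,
      gt (minor_lead o i j) (minor_tail o i j)
    & g = 'X_[minor_tail o i j] - 'X_[minor_lead o i j]].
Proof.
rewrite mem_cat => /orP[] /minorsP[i [j [ij ->]]].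
  by exists 0%N, n1, i, j; split; [left | | exact: gt1 | exact: minor_terms].
by exists n1.+1, n2, i, j; split; [right | | exact: gt2 | exact: minor_terms].
Qed.

Lemma minor_lead_eq o n (i j i' j' : 'I_n) : (o + n <= N)%N -> (i < j)%N -> (i' < j')%N ->
  minor_lead o i j = minor_lead o i' j' -> i = i' /\ j = j'.
Proof.
move=> on_le ij ij' E; have [[i_n jn] [in' jn']] := ((ltn_ord i, ltn_ord j), (ltn_ord i', ltn_ord j')).
have ev k : (0 < k <= n)%N -> ((k == i.+1) + (k == j) = (k == i'.+1) + (k == j'))%N.
  move=> kn; have /andP[k0 kn'] := kn; move/mnmP/(_ (@bvar N o k)): E.
  by rewrite !mnmDE !(bmon_mid h on_le kn') //; lia.
have jj : j = j' :> nat.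
  have j_in : (0 < j <= n)%N by lia.
  have j_in' : (0 < j' <= n)%N by lia.
  by have := ev j j_in; have := ev j' j_in'; rewrite !eqxx; lia.
have ii : i = i' :> nat.
  have i_in : (0 < i.+1 <= n)%N by lia.
  by have := ev i.+1 i_in; rewrite eqxx jj; lia.
by split; apply: val_inj.
Qed.

Lemma mnm_le_deg_eq (m m' : 'X_{1..N.+1}) : (m <= m')%MM -> mdeg m = mdeg m' -> m = m'.
Proof.
move=> le_mm'; rewrite -{1}(submK le_mm') mdegD => /eqP.
rewrite -[X in X == _]add0n eqn_add2r eq_sym mdeg_eq0 => /eqP e.
by rewrite -(submK le_mm') e add0m.
Qed.

Lemma minor_lead_mdeg o (i j : nat) : (0 < j)%N -> mdeg (minor_lead o i j) = 2%N.
Proof. by case: j => // j _; rewrite mdegD !mdeg1. Qed.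

(** A standard leading monomial would have a partner of the same weight in [f], of no larger degree.
    A comparison decided at an end variable contradicts extremality there. If a middle variable
    decides, all ends come later in the list, so the exponents agree at them and the two monomials
    coincide. *)
Lemma lead_not_std f m : jI f -> is_lead gt f m -> ~~ join_std m.
Proof.
move=> If [mf mmax]; apply/negP=> sm.
have [m' m'f [m'm wm]] := join_ideal_partner If mf.
have [dle zle zeq] := join_std_ext h_ge1 n1_ge2 n2_ge2 indep sm (esym wm).
case: (mmax _ m'f m'm) => [|[_ [i mi agree]]]; first by lia.
have [iz|iz] := boolP (i \in join_ends n1 n2); first by have := zle i iz; lia.
case/eqP: m'm; apply: zeq => z zz; apply/esym/agree.
exact: (index_mid_end n1_ge2 n2_ge2 iz zz).
Qed.

Lemma not_std_lead m : ~~ join_std m -> exists o n (i j : 'I_n) m',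
  [/\ (o = 0%N /\ n = n1) \/ (o = n1.+1 /\ n = n2), (i < j)%N
    & m = (m' + minor_lead o i j)%MM].
Proof.
rewrite negb_and -!ltnNge => /orP[] H.
  have [i [j [m' [ij _ ->]]]] := mid_split (blk1_le n1 n2) n1_ge2 h_ge1 H.
  by exists 0%N, n1, i, j, m'; split; [left | | rewrite /minor_lead addmA].
have [i [j [m' [ij _ ->]]]] := mid_split (blk2_le n1 n2) n2_ge2 h_ge1 H.
by exists n1.+1, n2, i, j, m'; split; [right | | rewrite /minor_lead addmA].
Qed.

Lemma join_groebner : minimal_groebner_basis gt jI (minors Q1 ++ minors Q2).
Proof.
have G_I g : g \in minors Q1 ++ minors Q2 -> jI g /\ g != 0.
  move=> gG; split.
    have : ideal_add (minors_ideal Q1) (minors_ideal Q2) g.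
      apply/ideal_add_span; apply: ideal_span_sub.
      by move: gG; rewrite mem_cat => /orP[]; [left | right].
    exact: minors_ideal_join.
  have [o [n [i [j [_ _ lt_ij ->]]]]] := mem_minors gG.
  have [] := (is_lead_binomial lt_ij (minor_lead o i j)).2 erefl.
  by move=> lead_in _; apply: contraTneq lead_in => ->; rewrite msupp0.
split; first split=> [//|u].
  split; first by apply: ideal_spanS => _ [g [m [/G_I gG gm ->]]]; exists g, m.
  move: u; apply: ideal_span_min.
  - exact: ideal_span0.
  - exact: ideal_spanD.
  - move=> c _ [f [m [[If _] fm ->]]].
    have [o [n [i [j [m' [on ij ->]]]]]] := not_std_lead (lead_not_std If fm).
    rewrite mpolyXD mulrA; apply/ideal_spanM/ideal_span_sub.
    exists (minor2 (scroll_mx K N o n h) i j), (minor_lead o i j); split=> //.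
      by rewrite mem_cat; apply/orP; case: on => -[eo en]; subst o n;
        [left | right]; apply/minorsP; exists i, j.
    rewrite minor_terms; apply/is_lead_binomial => //.
    by case: on => -[eo en]; subst o n; [apply: gt1 | apply: gt2].
(* All leading monomials have degree two, so divisibility is equality. Within a block they determine
   the minor, and across blocks they involve disjoint variables. *)
move=> g g' m m' gG gG' gg' gm gm'.
have [o [n [i [j [on ij lt_ij gE]]]]] := mem_minors gG.
have [o' [n' [i' [j' [on' ij' lt_ij' gE']]]]] := mem_minors gG'.
move: gm gm'; rewrite gE gE' => /(is_lead_binomial lt_ij) -> /(is_lead_binomial lt_ij') ->.
apply/negP=> le_ll.
have j0 : (0 < j)%N by apply: leq_trans ij.
have j0' : (0 < j')%N by apply: leq_trans ij'.
have E := mnm_le_deg_eq le_ll (etrans (minor_lead_mdeg o i j0) (esym (minor_lead_mdeg o' i' j0'))).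
have lead_pos (o0 n0 : nat) (p q : 'I_n0) : (o0 + n0 <= N)%N -> (p < q)%N ->
    (0 < minor_lead o0 p q (@bvar N o0 q))%N.
  move=> le0 pq; have qn0 := ltn_ord q; have q_in : (0 < q <= n0)%N by lia.
  by rewrite mnmDE [X in (_ + X)%N](bmon_mid h le0) ?eqxx ?addn1 // ltnW.
have in1 (k : 'I_n1) : @in_block N 0 n1 (v1 k) by apply/(bvar_in (blk1_le n1 n2))/ltnW.
have off2 (k : 'I_n1) (i1 j1 : 'I_n2) : minor_lead n1.+1 i1 j1 (v1 k) = 0%N.
  have nin := blocks_disjoint (in1 k).
  by rewrite mnmDE !(bmon_off h (blk2_le n1 n2) nin) // ltnW.
case: on on' => -[eo en] [] [eo' en']; subst o n o' n'.
- case/eqP: gg'; rewrite gE gE'.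
  by have [-> ->] := minor_lead_eq (blk1_le n1 n2) ij ij' E.
- by have := lead_pos _ _ i j (blk1_le n1 n2) ij; rewrite E off2.
- by have := lead_pos _ _ i' j' (blk1_le n1 n2) ij'; rewrite -E off2.
- case/eqP: gg'; rewrite gE gE'.
  by have [-> ->] := minor_lead_eq (blk2_le n1 n2) ij ij' E.
Qed.

End Groebner.

(** * The associated graded ring *)

Local Open Scope quotient_scope.

Section IdealPowers.
Variables (A : comPzRingType) (I : A -> Prop).

Lemma ideal_powS_sub i x : ideal_pow I i.+1 x -> ideal_pow I i x.
Proof.
apply: ideal_span_min; [exact: ideal_pow0 | exact: ideal_powD |].
by move=> a _ [u [w [_ Iw ->]]]; rewrite mulrA; apply: ideal_powMl.
Qed.

Lemma ideal_pow_le i j x : (i <= j)%N -> ideal_pow I j x -> ideal_pow I i x.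
Proof.
move=> ij; rewrite -(subnK ij); elim: (j - i)%N => [|k IH] //.
by rewrite addSn => /ideal_powS_sub.
Qed.

Lemma ideal_pow1 x : I x -> ideal_pow I 1 x.
Proof. by move=> Ix; apply: ideal_span_sub; exists x, 1; rewrite mulr1. Qed.

End IdealPowers.

Section FlagIdeals.
Variables (A : comPzRingType) (v : nat -> A).

Lemma flag_idealD j x y : flag_ideal v j x -> flag_ideal v j y -> flag_ideal v j (x + y).
Proof.
move=> [a ->] [b ->]; exists (fun c => a c + b c).
by rewrite -big_split; apply: eq_bigr => c _; rewrite mulrDl.
Qed.

Lemma flag_idealM j a x : flag_ideal v j x -> flag_ideal v j (a * x).
Proof.
move=> [b ->]; exists (fun c => a * b c).
by rewrite mulr_sumr; apply: eq_bigr => c _; rewrite mulrA.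
Qed.

Lemma flag_ideal_zero j : flag_ideal v j 0.
Proof. by exists (fun=> 0); rewrite big1 // => c _; rewrite mul0r. Qed.

Lemma flag_ideal_sum j (T : Type) (r : seq T) (P : pred T) (F : T -> A) :
  (forall t, P t -> flag_ideal v j (F t)) -> flag_ideal v j (\sum_(t <- r | P t) F t).
Proof.
by move=> H; elim/big_ind: _ => //; [exact: flag_ideal_zero | exact: flag_idealD].
Qed.

Lemma flag_ideal_gen j c : (c < j)%N -> flag_ideal v j (v c).
Proof.
move=> cj; exists (fun i => (i == c)%:R).
rewrite (bigD1 (Ordinal cj)) //= eqxx mul1r big1 ?addr0 // => i.
by rewrite -val_eqE /= => /negPf ->; rewrite mul0r.
Qed.

End FlagIdeals.

Section AssociatedGradedLemmas.
Variables (A : comNzRingType) (m : A -> Prop).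
Local Notation rees := (@rees A m).
Local Notation gr := (@gr A m).
Local Notation "\p x" := (\pi_gr (x : rees) : gr) (at level 8).

Lemma gr_pi0 : \p 0 = 0 :> gr.
Proof. by apply: (addrI (\p 0)); rewrite -gr_piD !addr0. Qed.

Lemma gr_piN (p : rees) : \p (- p) = - \p p.
Proof. by apply: (addrI (\p p)); rewrite -gr_piD !subrr gr_pi0. Qed.

Lemma gr_piB (p q : rees) : \p (p - q) = \p p - \p q.
Proof. by rewrite gr_piD gr_piN. Qed.

Lemma gr_piMr (p q : rees) : \p (p * q) = \p p * \p q.
Proof. by rewrite -gr_piM. Qed.

Lemma gr_pi_sum (T : Type) (r : seq T) (P : pred T) (F : T -> rees) :
  \p (\sum_(t <- r | P t) F t) = \sum_(t <- r | P t) \p (F t).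
Proof. by apply: (big_morph (fun p : rees => \p p)) => [p q|]; [exact: gr_piD | exact: gr_pi0]. Qed.

Lemma gr_pi_eq (p q : rees) : \p p = \p q <-> p - q \in @rees_shift A m.
Proof. by split=> /gr_eqP. Qed.

Lemma gr_piP (x : gr) : exists p : rees, x = \p p.
Proof. by exists (repr x); rewrite reprK. Qed.

Lemma rees_mono i (a : A) : ideal_pow m i a -> a *: 'X^i \in rees_pred m.
Proof.
move=> ma; apply/reesP => j; rewrite coefZ coefXn; case: eqP => [->|_].
  by rewrite mulr1.
by rewrite mulr0; apply: ideal_pow0.
Qed.

Definition rmono i (a : A) (ma : ideal_pow m i a) : rees := Sub (a *: 'X^i) (rees_mono ma).

Lemma rees_valB (p q : rees) : val (p - q) = (val p : {poly A}) - val q.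
Proof. exact: raddfB. Qed.

Lemma rees_valM (p q : rees) : val (p * q) = (val p : {poly A}) * val q.
Proof. exact: rmorphM. Qed.

Lemma rees_val_sum (T : Type) (r : seq T) (P : pred T) (F : T -> rees) :
  val (\sum_(t <- r | P t) F t) = \sum_(t <- r | P t) (val (F t) : {poly A}).
Proof. exact: raddf_sum. Qed.

Lemma rees_coef (p : rees) i : ideal_pow m i (val p : {poly A})`_i.
Proof. by have /reesP := valP p. Qed.

Lemma gr_partP i (x : gr) : gr_part i x <->
  exists (a : A) (ma : ideal_pow m i a), x = \p (rmono ma).
Proof.
split=> [[a [p [pE ->]]]|[a [ma ->]]]; last by exists a, (rmono ma).
have ma : ideal_pow m i a.
  by have := rees_coef p i; rewrite pE coefZ coefXn eqxx mulr1.
by exists a, ma; congr (\p _); apply: val_inj; rewrite /= pE.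
Qed.

Lemma gr_part0 i : gr_part i (0 : gr).
Proof. by exists 0, 0; rewrite gr_pi0 scale0r raddf0. Qed.

Lemma gr_partB i (x y : gr) : gr_part i x -> gr_part i y -> gr_part i (x - y).
Proof.
move=> [a [p [pE ->]]] [b [q [qE ->]]]; exists (a - b), (p - q).
by rewrite gr_piB raddfB /= pE qE scalerBl.
Qed.

Lemma gr_partM i j (x y : gr) : gr_part i x -> gr_part j y -> gr_part (i + j) (x * y).
Proof.
move=> [a [p [pE ->]]] [b [q [qE ->]]]; exists (a * b), (p * q).
by rewrite gr_piMr rmorphM /= pE qE -scalerAl -scalerAr scalerA exprD.
Qed.

(* The coefficients are replaced by their homogeneous parts of degree 1. *)
Lemma gr_flag_lin (v : nat -> gr) (t : nat -> A) (mt : forall c, ideal_pow m 1 (t c)) j x :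
  (forall c, (c < j)%N -> v c = \p (rmono (mt c))) -> gr_part 2 x -> flag_ideal v j x ->
  exists a : nat -> gr, (forall c, gr_part 1 (a c)) /\ x = \sum_(c < j) a c * v c.
Proof.
move=> vE /gr_partP[b [mb ->]] [a xE].
pose p c : rees := repr (a c); pose b1 c := (val (p c) : {poly A})`_1.
pose q c : rees := rmono (rees_coef (p c) 1).
exists (fun c => \p (q c)); split; first by move=> c; apply/gr_partP; exists (b1 c), (rees_coef (p c) 1).
move: xE; pose T c := rmono (mt c).
have -> : \sum_(c < j) a c * v c = \p (\sum_(c < j) p c * T c).
  rewrite gr_pi_sum; apply: eq_bigr => c _; rewrite gr_piMr -(vE c) //.
  by rewrite /p reprK.
have -> : \sum_(c < j) \p (q c) * v c = \p (\sum_(c < j) q c * T c).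
  by rewrite gr_pi_sum; apply: eq_bigr => c _; rewrite gr_piMr -(vE c).
move=> /gr_pi_eq /rees_shiftP H; apply/gr_pi_eq/rees_shiftP => i.
rewrite rees_valB coefB rees_val_sum coef_sum.
have [->|i2] := eqVneq i 2%N.
  have := H 2%N; rewrite rees_valB coefB rees_val_sum coef_sum.
  congr (ideal_pow m 3 (_ - _)); apply: eq_bigr => c _.
  rewrite !rees_valM [in RHS]/= -scalerAl -!scalerAr !coefZ -exprD coefXn mulr1.
  by rewrite expr1 coefMX mulrC.
rewrite [X in _ - X]big1 ?subr0; last first.
  move=> c _; rewrite rees_valM /= -scalerAl -scalerAr scalerA -exprD coefZ coefXn.
  by rewrite (negPf i2) mulr0.
by rewrite /= coefZ coefXn (negPf i2) mulr0; apply: (@ideal_pow0 _ m i.+1).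
Qed.

End AssociatedGradedLemmas.

(** * Powers of the maximal ideal of the semigroup ring *)

Section JoinGraded.
Variables (K : fieldType) (h n1 n2 : nat) (a1 d1 a2 d2 : 'X_{1..4}).

Local Notation N := (n1 + n2).+1.
Local Notation v1 := (@bvar N 0).
Local Notation v2 := (@bvar N n1.+1).
Local Notation wt := (@join_wt h n1 n2 a1 d1 a2 d2).
Local Notation wd := (wdeg wt).
Local Notation A := (join_ring K h n1 n2 a1 d1 a2 d2).
Local Notation mI := (@join_max K h n1 n2 a1 d1 a2 d2).
Local Notation rees := (@rees A mI).
Local Notation gr := (@gr A mI).
Local Notation gen_semigroup := (semigroup_gen (join_gens h n1 n2 a1 d1 a2 d2)).
Implicit Types (m s : 'X_{1..nvars n1 n2}).

Lemma wd_eq0 : wd 0%MM = 0%MM.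
Proof. by have := wdegUn wt (v1 0) 0; rewrite !mulm0n. Qed.

Lemma mnm_split m : m != 0%MM -> exists i m', m = (U_(i) + m')%MM.
Proof.
move=> m0; have [i mi] : exists i, m i != 0%N.
  apply: contrapT => H; case/eqP: m0; apply/mnmP=> i; rewrite mnm0E.
  by apply/eqP; apply: contrapT => /negP mi; apply: H; exists i.
exists i, (m - U_(i))%MM; rewrite addmC submK //; apply/mnm_lepP => j.
by rewrite mnm1E; case: eqP => // <-; rewrite lt0n.
Qed.

Lemma mnm_U_ind (P : 'X_{1..nvars n1 n2} -> Prop) :
  P 0%MM -> (forall i m, P m -> P (U_(i) + m)%MM) -> forall m, P m.
Proof.
move=> P0 PU m; have [k] := ubnP (mdeg m); elim: k m => // k IH m mk.
have [->//|/mnm_split[i [m' mE]]] := eqVneq m 0%MM.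
by rewrite mE; apply/PU/IH; move: mk; rewrite mE mdegD mdeg1 add1n ltnS.
Qed.

Lemma wd_semigroup m : gen_semigroup (wd m).
Proof.
elim/mnm_U_ind: m => [|i m IH]; first by rewrite wd_eq0; apply: Semigroup0.
rewrite wdegD wdegU; apply: SemigroupD IH.
case: (block_cases i) => -[j jn ->]; [left | right]; exists j => //.
  exact: wt1.
exact: wt2.
Qed.

Lemma semigroup_wd c : gen_semigroup c -> exists m, wd m = c.
Proof.
elim=> [|g c' [] [j jn ->] _ [m <-]]; first by exists 0%MM; apply: wd_eq0.
  by exists (U_(v1 j) + m)%MM; rewrite wdegD wdegU wt1.
by exists (U_(v2 j) + m)%MM; rewrite wdegD wdegU wt2.
Qed.

Lemma mono_ksg (c : 'X_{1..4}) : gen_semigroup c ->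
  'X_[K, c] \in ksg_pred (join_gens h n1 n2 a1 d1 a2 d2).
Proof. by move=> Sc; apply/ksgP => m; rewrite msuppX inE => /eqP ->. Qed.

Definition tm m : A := Sub 'X_[K, wd m] (mono_ksg (wd_semigroup m)).

Lemma tmE m : val (tm m) = 'X_[K, wd m]. Proof. by []. Qed.

Lemma tmD m m' : tm (m + m')%MM = tm m * tm m'.
Proof. by apply: val_inj; rewrite rmorphM /= wdegD mpolyXD. Qed.

Lemma tm0 : tm 0%MM = 1.
Proof. by apply: val_inj; rewrite rmorph1 /= wd_eq0 mpolyX0. Qed.

Lemma tmU_max i : mI (tm U_(i)).
Proof. by apply: ideal_span_sub; exists i; rewrite tmE wdegU. Qed.

Lemma tm_pow m : ideal_pow mI (mdeg m) (tm m).
Proof.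
elim/mnm_U_ind: m => [|i m IH]; first by rewrite mdeg0.
rewrite tmD mdegD mdeg1; apply: ideal_powM IH.
exact/ideal_pow1/tmU_max.
Qed.

Definition Ord i (c : 'X_{1..4}) := exists2 m, wd m = c & (i <= mdeg m)%N.

Lemma OrdD i j c c' : Ord i c -> Ord j c' -> Ord (i + j) (c + c')%MM.
Proof.
move=> [m <- im] [m' <- jm]; exists (m + m')%MM; first exact: wdegD.
by rewrite mdegD leq_add.
Qed.

Definition supp_Ord i (a : A) := forall c, c \in msupp (val a : {mpoly K[4]}) -> Ord i c.

Lemma supp_Ord0 i : supp_Ord i 0.
Proof. by move=> c; rewrite raddf0 msupp0. Qed.

Lemma supp_OrdD i (a b : A) : supp_Ord i a -> supp_Ord i b -> supp_Ord i (a + b).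
Proof.
move=> Ha Hb c; rewrite raddfD => /msuppD_le; rewrite mem_cat => /orP[].
  exact: Ha.
exact: Hb.
Qed.

Lemma supp_Ord_full (a : A) : supp_Ord 0 a.
Proof. by move=> c ca; have /ksgP/(_ c ca)/semigroup_wd[m mE] := valP a; exists m. Qed.

Lemma supp_OrdM i j (a b : A) : supp_Ord i a -> supp_Ord j b -> supp_Ord (i + j) (a * b).
Proof.
move=> Ha Hb c; rewrite rmorphM => /msuppM_le /allpairsP[[u w] /= [/Ha Hu /Hb Hw ->]].
exact: OrdD.
Qed.

Lemma max_supp (a : A) : mI a -> supp_Ord 1 a.
Proof.
move: a; apply: ideal_span_min.
- exact: supp_Ord0.
- exact: supp_OrdD.
- move=> a x [k xE]; apply: (@supp_OrdM 0 1); first exact: supp_Ord_full.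
  move=> c; rewrite xE msuppX inE => /eqP ->.
  by exists U_(k)%MM; rewrite ?wdegU ?mdeg1.
Qed.

Lemma ksg_val0 : val (0 : A) = 0 :> {mpoly K[4]}.
Proof. exact: raddf0. Qed.

Lemma ksg_valM (a b : A) : val (a * b) = (val a : {mpoly K[4]}) * val b.
Proof. exact: rmorphM. Qed.

Lemma ksg_valB (a b : A) : val (a - b) = (val a : {mpoly K[4]}) - val b.
Proof. exact: raddfB. Qed.

Lemma ksg_val_sum (T : Type) (r : seq T) (P : pred T) (F : T -> A) :
  val (\sum_(t <- r | P t) F t) = \sum_(t <- r | P t) (val (F t) : {mpoly K[4]}).
Proof. exact: raddf_sum. Qed.

Lemma val_algA (c : K) : val (c%:A : A) = c%:MP_[4].
Proof. by rewrite [LHS]linearZ -alg_mpolyC. Qed.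

(** The powers of the maximal ideal are spanned by monomials, so membership is a condition on each
    weight of the support separately. *)
Lemma max_powP i (a : A) : ideal_pow mI i a <-> supp_Ord i a.
Proof.
split.
  elim: i a => [|i IH] a; first by move=> _; apply: supp_Ord_full.
  move: a; apply: ideal_span_min.
  - exact: supp_Ord0.
  - exact: supp_OrdD.
  - move=> a x [u [w [Iu Iw ->]]]; apply: (@supp_OrdM 0 i.+1).
      exact: supp_Ord_full.
    by apply: (@supp_OrdM 1 i); [apply: max_supp | apply: IH].
move=> Ha; have -> : a = \sum_(c <- msupp (val a : {mpoly K[4]}))
    ((val a : {mpoly K[4]})@_c)%:A * insubd 0 'X_[K, c].
  apply: val_inj; rewrite ksg_val_sum [LHS]mpolyE big_seq [RHS]big_seq.
  apply: eq_bigr => c ca; have [m mE _] := Ha c ca.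
  rewrite ksg_valM val_algA val_insubd ifT ?mul_mpolyC //.
  by apply: mono_ksg; rewrite -mE; apply: wd_semigroup.
rewrite big_seq; apply: (big_ind (ideal_pow mI i)).
- exact: ideal_pow0.
- exact: ideal_powD.
- move=> c ca; have [m mE im] := Ha c ca; apply: ideal_powMl.
  rewrite (_ : insubd 0 _ = tm m); first exact: ideal_pow_le im (tm_pow m).
  apply: val_inj; rewrite val_insubd tmE mE ifT //.
  by apply: mono_ksg; rewrite -mE; apply: wd_semigroup.
Qed.

End JoinGraded.

(** * Standard basis and colon ideals in the associated graded ring *)

Section JoinKoszul.
Variables (K : fieldType) (h n1 n2 : nat) (a1 d1 a2 d2 : 'X_{1..4}).
Hypotheses (h_ge1 : (1 <= h)%N) (n1_ge2 : (2 <= n1)%N) (n2_ge2 : (2 <= n2)%N).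
Hypothesis indep : lin_indep a1 d1 a2 d2.

Local Notation N := (n1 + n2).+1.
Local Notation v1 := (@bvar N 0).
Local Notation v2 := (@bvar N n1.+1).
Local Notation wt := (@join_wt h n1 n2 a1 d1 a2 d2).
Local Notation wd := (wdeg wt).
Local Notation join_std := (@join_std n1 n2).
Local Notation A := (join_ring K h n1 n2 a1 d1 a2 d2).
Local Notation mI := (@join_max K h n1 n2 a1 d1 a2 d2).
Local Notation rees := (@rees A mI).
Local Notation gr := (@gr A mI).
Local Notation "\p x" := (\pi_gr (x : rees) : gr) (at level 8).
Local Notation tm := (@tm K h n1 n2 a1 d1 a2 d2).
Local Notation tm_pow := (@tm_pow K h n1 n2 a1 d1 a2 d2).
Implicit Types (m s t : 'X_{1..nvars n1 n2}) (p q : rees).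

(** The monomial placed in its own degree. Its class in [gr] vanishes exactly when its weight has a
    monomial of larger degree. *)
Definition em m : rees := rmono (tm_pow m).

Lemma em_val m : val (em m) = (tm m *: 'X^(mdeg m) : {poly A}). Proof. by []. Qed.

Lemma emD m m' : em (m + m')%MM = em m * em m'.
Proof.
apply: val_inj; rewrite rees_valM !em_val tmD mdegD.
by rewrite -scalerAl -scalerAr scalerA exprD.
Qed.

Definition rcoef i (c : 'X_{1..4}) p : K := (val ((val p : {poly A})`_i) : {mpoly K[4]})@_c.

Definition cf s p : K := rcoef (mdeg s) (wd s) p.

Lemma rcoefB i c p q : rcoef i c (p - q) = rcoef i c p - rcoef i c q.
Proof. by rewrite /rcoef rees_valB coefB ksg_valB mcoeffB. Qed.

Lemma rcoef_sum i c (T : Type) (r : seq T) (P : pred T) (F : T -> rees) :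
  rcoef i c (\sum_(t <- r | P t) F t) = \sum_(t <- r | P t) rcoef i c (F t).
Proof.
by rewrite /rcoef rees_val_sum coef_sum ksg_val_sum raddf_sum.
Qed.

Lemma rcoef_em i c m : rcoef i c (em m) = ((i == mdeg m) && (wd m == c))%:R.
Proof.
rewrite /rcoef em_val coefZ coefXn; case: (i == mdeg m).
  by rewrite mulr1 tmE mcoeffX.
by rewrite mulr0 ksg_val0 mcoeff0.
Qed.

Lemma rcoef_Ord i c p : rcoef i c p != 0 -> exists2 m, wd m = c & (i <= mdeg m)%N.
Proof.
rewrite /rcoef -mcoeff_msupp => cp.
by have /max_powP/(_ c cp) := rees_coef p i.
Qed.

(** The order of a weight is the degree of its standard monomial. A coefficient at this weight in
    lower degree therefore dies in [gr], in higher degree it cannot occur, and in equal degree it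
    survives. Hence the classes of standard monomials are independent over the field. *)
Lemma rees_shift_cf p : p \in @rees_shift A mI <-> forall s, join_std s -> cf s p = 0.
Proof.
split=> [/rees_shiftP H s ss|H].
  apply/eqP; rewrite /cf /rcoef mcoeff_eq0; apply/negP=> cs.
  have /max_powP/(_ _ cs)[m mE ms] := H (mdeg s).
  by have [] := join_std_ext h_ge1 n1_ge2 n2_ge2 indep ss (esym mE); lia.
apply/rees_shiftP => i; apply/max_powP => c; rewrite mcoeff_msupp => cp.
have [m mE im] := rcoef_Ord cp.
have [s ss sE] := join_std_ex h_ge1 n1_ge2 n2_ge2 indep m.
have [ms _ _] := join_std_ext h_ge1 n1_ge2 n2_ge2 indep ss sE.
exists s; first by rewrite sE.
rewrite ltn_neqAle (leq_trans im ms) andbT; apply/eqP=> e.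
have := H s ss; rewrite /cf -e sE mE => /eqP; exact/negP.
Qed.

Definition cst (c : K) : rees := Sub (c%:A)%:P (polyC_rees mI c%:A).

Lemma rcoef_cst i d c p : rcoef i d (cst c * p) = c * rcoef i d p.
Proof. by rewrite /rcoef rees_valM coefCM ksg_valM val_algA mcoeffCM. Qed.

(** The degree bound [b] makes the sum finite: the coefficients of [p] vanish from degree [b] on. *)
Lemma rees_expand p : let b := size (val p : {poly A}) in
  \p p = \sum_(s : bmultinom (nvars n1 n2) b | join_std s) \p (cst (cf s p) * em s).
Proof.
move=> b; rewrite -gr_pi_sum; apply/gr_pi_eq/rees_shift_cf => t st.
rewrite /cf rcoefB rcoef_sum; apply/eqP; rewrite subr_eq0; apply/eqP.
under eq_bigr => s ss do rewrite rcoef_cst rcoef_em.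
have [tb|bt] := ltnP (mdeg t) b; last first.
  rewrite /rcoef nth_default // ksg_val0 mcoeff0 big1 // => s _.
  by rewrite gtn_eqF ?mulr0 // (leq_trans (bmdeg s)).
rewrite (bigD1 (BMultinom tb)) //= !eqxx mulr1 big1 ?addr0 // => s /andP[ss st'].
case: eqP => [_|_]; last by rewrite mulr0.
case: eqP => [e|_]; last by rewrite mulr0.
case/eqP: st'; apply: val_inj => /=.
exact: (join_std_uniq h_ge1 n1_ge2 n2_ge2 indep ss st e).
Qed.

Definition mids1 : seq 'I_(nvars n1 n2) := [seq v1 j | j <- iota 1 n1.-1].
Definition mids2 : seq 'I_(nvars n1 n2) := [seq v2 j | j <- iota 1 n2.-1].
Definition flag_vars := join_ends n1 n2 ++ mids1 ++ mids2.
Definition fvar k := nth (v1 0) flag_vars k.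
Definition fsize := (4 + (n1.-1 + n2.-1))%N.
(** Multiplication by an end variable preserves standard monomials, which gives the first range. The
    product of two middle variables of one block lies in the ideal of the ends, whereas a product
    across the blocks is standard. So a middle variable of the first block has the ends and its own
    block as colon ideal; for one of the second block the whole first block is already in the flag,
    and the colon ideal contains every variable. *)
Definition fcolon k :=
  if (k < 4)%N then k else if (k < 4 + n1.-1)%N then (4 + n1.-1)%N else fsize.
Definition fgen k : gr := \p (em U_(fvar k)).

Lemma flag_ideal_supp j p :
  (forall s, join_std s -> cf s p != 0 -> exists2 k, (k < j)%N & (0 < s (fvar k))%N) ->
  flag_ideal fgen j (\p p).
Proof.
move=> H; rewrite rees_expand; apply: flag_ideal_sum => s ss.
have [->|/(H s ss)[k kj sk]] := eqVneq (cf s p) 0.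
  have -> : cst 0 = 0 by apply: val_inj; rewrite /= scale0r polyC0.
  by rewrite mul0r gr_pi0; apply: flag_ideal_zero.
have sE : (bmnm s - U_(fvar k) + U_(fvar k))%MM = bmnm s.
  rewrite submK //; apply/mnm_lepP => i.
  by rewrite mnm1E; case: eqP => // <-.
rewrite -sE emD !gr_piMr !mulrA; apply: flag_idealM; exact: flag_ideal_gen.
Qed.

Lemma flag_vars_size : size flag_vars = fsize.
Proof. by rewrite /flag_vars !size_cat !size_map !size_iota. Qed.

Lemma fvar_end k : (k < 4)%N -> fvar k \in join_ends n1 n2.
Proof. by case: k => [|[|[|[|]]]] // _; rewrite !inE eqxx ?orbT. Qed.

Lemma fvar_mid1 k : (4 <= k < 4 + n1.-1)%N -> fvar k = v1 (k - 3).
Proof.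
move=> /andP[k4 kn]; rewrite /fvar /flag_vars nth_cat [size _]/= ltnNge k4 /=.
rewrite nth_cat size_map size_iota ifT; last by lia.
by rewrite (nth_map 0%N) ?size_iota ?nth_iota; [congr v1|..]; lia.
Qed.

Lemma fvar_mid2 k : (4 + n1.-1 <= k < fsize)%N -> fvar k = v2 (k - (3 + n1.-1)).
Proof.
rewrite /fsize => /andP[k4 kn]; rewrite /fvar /flag_vars nth_cat [size _]/= ifF; last by lia.
rewrite nth_cat size_map size_iota ifF; last by lia.
by rewrite (nth_map 0%N) ?size_iota ?nth_iota; [congr v2|..]; lia.
Qed.

Lemma v1_neq_v2 i j : (i <= n1)%N -> (j <= n2)%N -> v1 i != v2 j.
Proof.
move=> i_n jn; rewrite -val_eqE /= (bvar_val (blk1_le n1 n2)) // (bvar_val (blk2_le n1 n2)) //.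
by lia.
Qed.

Lemma mem_flag_vars i : i \in flag_vars.
Proof.
rewrite /flag_vars !mem_cat; case: (block_cases i) => -[j jn ->].
  have [->|j0] := eqVneq j 0%N; first by rewrite !inE eqxx.
  have [->|jn'] := eqVneq j n1; first by rewrite !inE eqxx orbT.
  apply/orP; right; apply/orP; left; apply/mapP; exists j => //.
  by rewrite mem_iota; lia.
have [->|j0] := eqVneq j 0%N; first by rewrite !inE eqxx !orbT.
have [->|jn'] := eqVneq j n2; first by rewrite !inE eqxx !orbT.
apply/orP; right; apply/orP; right; apply/mapP; exists j => //.
by rewrite mem_iota; lia.
Qed.

Lemma flag_vars_uniq : uniq flag_vars.
Proof.
apply/card_uniqP.
have -> : #|flag_vars| = #|'I_(nvars n1 n2)|.
  by apply: eq_card => i; rewrite mem_flag_vars.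
by rewrite card_ord flag_vars_size /fsize /nvars; lia.
Qed.

Lemma fvar_inj j k : (j < fsize)%N -> (k < fsize)%N -> fvar j = fvar k -> j = k.
Proof.
move=> js ks /eqP; rewrite nth_uniq ?flag_vars_size ?flag_vars_uniq //.
exact: eqP.
Qed.

Lemma fvar_ex i : exists2 k, (k < fsize)%N & fvar k = i.
Proof.
exists (index i flag_vars); first by rewrite -flag_vars_size index_mem mem_flag_vars.
by rewrite /fvar nth_index ?mem_flag_vars.
Qed.

Lemma coefMXS (R : nzRingType) (f : {poly R}) d : (f * 'X)`_d.+1 = f`_d.
Proof. by rewrite coefMX. Qed.

Lemma rcoef_mulU d c i p : rcoef d.+1 (c + wt i)%MM (p * em U_(i)) = rcoef d c p.
Proof.
rewrite /rcoef rees_valM em_val mdeg1 -scalerAr coefZ expr1 coefMXS.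
by rewrite mulrC ksg_valM tmE wdegU addmC mcoeffMX.
Qed.

Lemma rcoef_mulU_ex d c i p : rcoef d.+1 c (p * em U_(i)) != 0 ->
  exists2 c', c = (c' + wt i)%MM & rcoef d c' p != 0.
Proof.
rewrite /rcoef rees_valM em_val mdeg1 -scalerAr coefZ expr1 coefMXS.
rewrite mulrC ksg_valM tmE wdegU -mcoeff_msupp (perm_mem (msuppMX _ _)).
by move=> /mapP[c' cp ->]; exists c'; [exact: addmC | rewrite -mcoeff_msupp].
Qed.

Local Notation bs1 := (@bsum N 0 n1).
Local Notation bs2 := (@bsum N n1.+1 n2).
Local Notation A1 := (@bA N 0 n1 h).
Local Notation A2 := (@bA N n1.+1 n2 h).
Local Notation D1 := (@bD N 0 n1).
Local Notation mid1 := (@midsum N 0 n1).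
Local Notation mid2 := (@midsum N n1.+1 n2).

Lemma bs1D w (m m' : 'X_{1..nvars n1 n2}) : bs1 w (m + m')%MM = (bs1 w m + bs1 w m')%N.
Proof. exact: bsumD. Qed.

Lemma bs2D w (m m' : 'X_{1..nvars n1 n2}) : bs2 w (m + m')%MM = (bs2 w m + bs2 w m')%N.
Proof. exact: bsumD. Qed.

Lemma bs11 w j : (j <= n1)%N -> bs1 w U_(v1 j)%MM = w j.
Proof. by move=> jn; have := bsumU (blk1_le n1 n2) w 1 jn; rewrite mulm1n muln1. Qed.

Lemma bs22 w j : (j <= n2)%N -> bs2 w U_(v2 j)%MM = w j.
Proof. by move=> jn; have := bsumU (blk2_le n1 n2) w 1 jn; rewrite mulm1n muln1. Qed.

Lemma bs12 w j : (j <= n2)%N -> bs1 w U_(v2 j)%MM = 0%N.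
Proof.
move=> jn; apply: (bsum_off (blk1_le n1 n2)) => i i1; rewrite mnm1E; case: eqP => // e.
by have := blocks_disjoint i1; rewrite -e (bvar_in (blk2_le n1 n2)).
Qed.

Lemma bs21 w j : (j <= n1)%N -> bs2 w U_(v1 j)%MM = 0%N.
Proof.
move=> jn; apply: (bsum_off (blk2_le n1 n2)) => i i2; rewrite mnm1E; case: eqP => // e.
by have := blocks_disjoint (bvar_in (blk1_le n1 n2) jn); rewrite e i2.
Qed.

Definition bmid (n j : nat) : nat := (0 < j < n)%N.

Lemma mid1E m : mid1 m = bs1 (bmid n1) m.
Proof. exact/midsum_bsum/ltnW. Qed.

Lemma mid2E m : mid2 m = bs2 (bmid n2) m.
Proof. exact/midsum_bsum/ltnW. Qed.

Lemma join_stdE m : join_std m = (bs1 (bmid n1) m <= 1)%N && (bs2 (bmid n2) m <= 1)%N.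
Proof. by rewrite -[join_std m]/((mid1 m <= 1)%N && (mid2 m <= 1)%N) mid1E mid2E. Qed.

Lemma bs_end z : z \in join_ends n1 n2 ->
  bs1 (bmid n1) U_(z)%MM = 0%N /\ bs2 (bmid n2) U_(z)%MM = 0%N.
Proof.
rewrite !inE => /or4P[] /eqP ->.
- by rewrite bs11 ?bs21.
- by rewrite bs11 ?bs21 // /bmid ltnn andbF.
- by rewrite bs12 ?bs22.
- by rewrite bs12 ?bs22 // /bmid ltnn andbF.
Qed.

Lemma join_std_end m z : z \in join_ends n1 n2 -> join_std (m + U_(z))%MM = join_std m.
Proof.
by move=> /bs_end[e1 e2]; rewrite !join_stdE bs1D bs2D e1 e2 !addn0.
Qed.

Lemma join_stdU i : join_std U_(i)%MM.
Proof.
rewrite join_stdE; case: (block_cases i) => -[j jn ->].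
  by rewrite bs11 // bs21 // leq_b1.
by rewrite bs12 // bs22 // leq_b1.
Qed.

Lemma block1_zero m : A1 m = 0%N -> D1 m = 0%N.
Proof.
rewrite (bAE _ _ (ltnW n1_ge2)) (bDE _ (ltnW n1_ge2)) => /eqP.
rewrite !addn_eq0 !muln_eq0 (gtn_eqF h_ge1) /= => /andP[/andP[_ /eqP m0] /eqP ->].
by have := midD_le (blk1_le n1 n2) (ltnW n1_ge2) h_ge1 m; rewrite m0 !muln0 leqn0 => /eqP ->.
Qed.

(** If [s] contains no variable of the colon ideal, or if [j] is an end, then [s] times the j-th
    variable is standard. By hypothesis it has the weight of [s'] times an earlier variable. Where
    that product is standard too, uniqueness identifies the two, and the k-th variable must divide
    [s]. *)
Lemma colon_std j s : (j < fsize)%N -> join_std s ->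
  (forall t, join_std t -> wd t = wd (s + U_(fvar j))%MM -> mdeg t = (mdeg s).+1 ->
     exists k s', [/\ (k < j)%N, join_std s', mdeg s' = mdeg s & wd (s' + U_(fvar k))%MM = wd t]) ->
  exists2 k, (k < fcolon j)%N & (0 < s (fvar k))%N.
Proof.
move=> js ss H.
have mdegU i : mdeg (s + U_(i))%MM = (mdeg s).+1 by rewrite mdegD mdeg1 addn1.
have neq k : (k < j)%N -> (fvar j == fvar k) = false.
  move=> kj; apply/eqP=> /(fvar_inj js (ltn_trans kj js)) e.
  by rewrite e ltnn in kj.
rewrite /fcolon; have [j4|j4] := ltnP j 4.
  have sj : join_std (s + U_(fvar j))%MM by rewrite join_std_end ?fvar_end.
  have [k [s' [kj ss' _ wE]]] := H _ sj erefl (mdegU _).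
  have s'k : join_std (s' + U_(fvar k))%MM.
    by rewrite join_std_end // fvar_end // (ltn_trans kj).
  have /mnmP/(_ (fvar k)) := join_std_uniq h_ge1 n1_ge2 n2_ge2 indep s'k sj wE.
  rewrite !mnmDE !mnm1E eqxx neq // addn0 addn1 => sk.
  by exists k => //; rewrite -sk.
apply: contrapT => H0.
have s0 k : (k < if (j < 4 + n1.-1)%N then 4 + n1.-1 else fsize)%N -> s (fvar k) = 0%N.
  move=> kj; apply/eqP; apply: contrapT => /negP; rewrite -lt0n => sk.
  by apply: H0; exists k.
have [j1|j1] := ltnP j (4 + n1.-1); last first.
  rewrite ltnNge j1 /= in s0.
  have s00 : s = 0%MM.
    by apply/mnmP=> i; have [k kf <-] := fvar_ex i; rewrite mnm0E s0.
  have sj : join_std (s + U_(fvar j))%MM by rewrite s00 add0m join_stdU.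
  have [k [s' [kj ss' s'0 wE]]] := H _ sj erefl (mdegU _).
  have s'00 : s' = 0%MM by apply/eqP; rewrite -mdeg_eq0 s'0 s00 mdeg0.
  rewrite s'00 s00 !add0m in wE.
  have /mnmP/(_ (fvar k)) := join_std_uniq h_ge1 n1_ge2 n2_ge2 indep (join_stdU _) (join_stdU _) wE.
  by rewrite !mnm1E eqxx neq.
rewrite j1 in s0.
have jE := @fvar_mid1 j; rewrite j4 j1 in jE; have {}jE := jE isT.
have q_in : (0 < j - 3 < n1)%N by lia.
have s_z z : z \in join_ends n1 n2 -> s z = 0%N.
  have [k kf <-] := fvar_ex z => zk; apply: s0.
  rewrite ltnNge; apply/negP=> k4.
  have : fvar k \notin join_ends n1 n2; last by rewrite zk.
  rewrite fvar_mid2 ?k4 //; set x := (k - _)%N.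
  have xn : (0 < x < n2)%N by move: kf; rewrite /x /fsize; lia.
  have ne i : (i <= n1)%N -> (v2 x == v1 i) = false.
    move=> i_n; have xn' : (x <= n2)%N by lia.
    by apply: contraNF (v1_neq_v2 i_n xn') => /eqP ->.
  have ne2 i : (i <= n2)%N -> (v2 x == v2 i) = (x == i).
    by move=> i_n; apply: (bvar_eq (blk2_le n1 n2)) => //; lia.
  by rewrite !inE !negb_or (ne 0%N) // (ne n1) // (ne2 0%N) // (ne2 n2) //; lia.
have mid_s : mid1 s = 0%N.
  rewrite /midsum big_nat_cond big1 // => i; rewrite andbT => i_n.
  have := @fvar_mid1 (i + 3); rewrite addnK => <-; last by lia.
  by apply: s0; lia.
have A1s : A1 s = 0%N.
  rewrite (bAE _ _ (ltnW n1_ge2)) mid_s !s_z ?muln0 //.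
    by rewrite !inE eqxx orbT.
  by rewrite !inE eqxx.
have sj : join_std (s + U_(fvar j))%MM.
  have : join_std s := ss; rewrite !join_stdE bs1D bs2D jE bs11 ?bs21; try lia.
  rewrite -mid1E mid_s addn0 => /andP[_ ->]; rewrite andbT.
  exact: leq_b1.
have [k [s' [kj ss' s'm wE]]] := H _ sj erefl (mdegU _).
have [k4|k4] := ltnP k 4.
  have s'k : join_std (s' + U_(fvar k))%MM by rewrite join_std_end // fvar_end.
  have /mnmP/(_ (fvar k)) := join_std_uniq h_ge1 n1_ge2 n2_ge2 indep s'k sj wE.
  by rewrite !mnmDE !mnm1E eqxx neq // s_z ?fvar_end // addn1.
(* Both variables are now middle ones of the first block, and [s] has no factor from this block.
   Comparing [bA] shows the same for [s'], and then [bD] identifies the two indices. *)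
have kE := @fvar_mid1 k; rewrite k4 (ltn_trans kj j1) in kE; have {}kE := kE isT.
have [AE DE _ _] := (wdP h indep _ _).1 wE.
have kj' : (k - 3 = j - 3)%N; last by lia.
have s'0 : A1 s' = 0%N.
  move: AE; rewrite /bA !bs1D jE kE !bs11; try lia.
  rewrite -[bs1 _ s]/(A1 s) A1s -[bs1 _ s']/(A1 s').
  have -> : (k - 3 == 0)%N = false by lia.
  have -> : (j - 3 == 0)%N = false by lia.
  exact: addIn.
move: DE; rewrite /bD !bs1D jE kE !bs11; try lia.
by rewrite -[bs1 _ s]/(D1 s) -[bs1 _ s']/(D1 s') !block1_zero.
Qed.

(** In [gr] the product is zero or the standard monomial of its weight, of degree two. Without an
    end variable the latter would be a middle variable from each block, and neither [bA] would
    vanish. *)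
Lemma pair_ends m : mdeg m = 2%N -> A1 m = 0%N \/ A2 m = 0%N ->
  flag_ideal fgen 4 (\p (em m)).
Proof.
move=> m2 Am; apply: flag_ideal_supp => s ss.
rewrite /cf rcoef_em; have [sm|_] := eqVneq (mdeg s) (mdeg m); last by rewrite eqxx.
have [wE _|_] := eqVneq (wd m) (wd s); last by rewrite eqxx.
apply: contrapT => H.
have s0 z : z \in join_ends n1 n2 -> s z = 0%N.
  move=> zj; apply/eqP; apply: contrapT => /negP; rewrite -lt0n => sz.
  apply: H; have zs : (index z (join_ends n1 n2) < 4)%N by rewrite -[4%N]/(size (join_ends n1 n2)) index_mem.
  exists (index z (join_ends n1 n2)) => //.
  by rewrite /fvar /flag_vars nth_cat zs nth_index.
have /andP[s1 s2] : (mid1 s <= 1)%N && (mid2 s <= 1)%N := ss.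
have zin : [/\ v1 0 \in join_ends n1 n2, v1 n1 \in join_ends n1 n2, v2 0 \in join_ends n1 n2
    & v2 n2 \in join_ends n1 n2] by rewrite !inE !eqxx !orbT.
have [z1 z2 z3 z4] := zin.
have := sm; rewrite m2 mdeg_blocks (bdegE _ (ltnW n1_ge2)) (bdegE _ (ltnW n2_ge2)).
rewrite !s0 // !add0n !addn0 => s12.
have [AE1 _ AE2 _] := (wdP h indep _ _).1 wE.
rewrite AE1 AE2 !(bAE _ _ (ltnW n1_ge2)) !(bAE _ _ (ltnW n2_ge2)) !s0 // in Am.
rewrite !add0n !muln0 !addn0 in Am.
have [e1 e2] : mid1 s = 1%N /\ mid2 s = 1%N by lia.
by rewrite e1 e2 !muln1 in Am; lia.
Qed.

Lemma fgenM j k : fgen j * fgen k = \p (em (U_(fvar j) + U_(fvar k))%MM).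
Proof. by rewrite emD gr_piMr. Qed.

Lemma fgen_colon j x : (j < fsize)%N ->
  flag_ideal fgen j (x * fgen j) <-> flag_ideal fgen (fcolon j) x.
Proof.
move=> js; split; last first.
  move=> [a ->]; rewrite mulr_suml; apply: flag_ideal_sum => -[k kc] _ /=.
  rewrite -mulrA; apply: flag_idealM.
  have [kj|jk] := ltnP k j; first by rewrite mulrC; apply/flag_idealM/flag_ideal_gen.
  have j4 : (4 <= j)%N.
    rewrite leqNgt; apply/negP=> j4; move: kc; rewrite /fcolon j4.
    by rewrite ltnNge jk.
  apply: (flag_ideal_sub j4); rewrite fgenM; apply: pair_ends.
    by rewrite mdegD !mdeg1.
  move: kc; rewrite /fcolon [(j < 4)%N]ltnNge j4 /=.
  case: ifP => [j1 k1|j1 kf].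
    right; rewrite !fvar_mid1; try lia.
    by rewrite /bA bs2D !bs21; lia.
  left; rewrite !fvar_mid2; try lia.
  by rewrite /bA bs1D !bs12; move: js kf; rewrite /fsize; lia.
have [p ->] := gr_piP x; move=> [a xE]; apply: flag_ideal_supp => s ss sp.
pose q k : rees := repr (a k).
have {}xE : p * em U_(fvar j) - \sum_(k < j) q k * em U_(fvar k) \in @rees_shift A mI.
  apply/gr_pi_eq; rewrite gr_piMr xE gr_pi_sum; apply: eq_bigr => k _.
  by rewrite gr_piMr /q reprK.
(* The coefficient of [t] in the product is the nonzero coefficient of [s] in [p], so some [q k]
   times the k-th variable contributes to it. Let [s'] be the standard monomial of the contributing
   weight: its degree is at least that of [s] by the filtration, and at most that of [s] by
   maximality of the degree of [t]. *)
apply: (colon_std js ss) => t st wE dE.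
move/rees_shift_cf/(_ t st)/eqP: xE; rewrite /cf rcoefB subr_eq0 dE wE wdegD wdegU.
rewrite rcoef_mulU -/(cf s p) => /eqP E; rewrite E rcoef_sum in sp.
have [k kp] : exists k : 'I_j, rcoef (mdeg s).+1 (wd s + wt (fvar j))%MM (q k * em U_(fvar k)) != 0.
  apply: contrapT => Hk; case/eqP: sp; apply: big1 => k _; apply/eqP.
  by apply: contrapT => /negP kp; apply: Hk; exists k.
have [c cE cq] := rcoef_mulU_ex kp; have [m mE sm] := rcoef_Ord cq.
have [s' ss' s'E] := join_std_ex h_ge1 n1_ge2 n2_ge2 indep m.
have [ms' _ _] := join_std_ext h_ge1 n1_ge2 n2_ge2 indep ss' s'E.
have wE' : wd (s' + U_(fvar k))%MM = wd t by rewrite wdegD wdegU s'E mE -cE wE wdegD wdegU.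
have [ts' _ _] := join_std_ext h_ge1 n1_ge2 n2_ge2 indep st (esym wE').
rewrite mdegD mdeg1 dE addn1 ltnS in ts'.
exists (k : nat), s'; split=> //.
  by apply/eqP; rewrite eqn_leq ts' (leq_trans sm ms').
by rewrite wE' wE wdegD wdegU.
Qed.

Lemma fgen_part c : gr_part 1 (fgen c).
Proof.
by exists (tm U_(fvar c)%MM), (em U_(fvar c)%MM); rewrite em_val mdeg1.
Qed.

Lemma fgen_irrelevant x : irrelevant_ideal (@gr_part A mI) x <-> flag_ideal fgen fsize x.
Proof.
split.
  move: x; apply: ideal_span_min.
  - exact: flag_ideal_zero.
  - exact: flag_idealD.
  - move=> a x [i i0 [b [p [pE ->]]]]; apply: flag_idealM; apply: flag_ideal_supp => s ss.
    rewrite /cf /rcoef pE coefZ coefXn; have [e _|_] := eqVneq (mdeg s) i; last first.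
      by rewrite mulr0 ksg_val0 mcoeff0 eqxx.
    have [|k [s' sE]] := @mnm_split n1 n2 s; first by rewrite -mdeg_eq0 e -lt0n.
    have [c cf ck] := fvar_ex k; exists c => //.
    by rewrite sE ck mnmDE mnm1E eqxx.
move=> [a ->]; apply: ideal_span_sum => c _; apply: ideal_spanM.
by apply: ideal_span_sub; exists 1%N => //; apply: fgen_part.
Qed.

Lemma join_is_koszul : join_koszul K h n1 n2 a1 d1 a2 d2.
Proof.
have cst_cf c s : cf s (cst c) = (s == 0%MM)%:R * c.
  have -> : cst c = cst c * em 0%MM.
    by apply: val_inj; rewrite rees_valM em_val mdeg0 expr0 tm0 scale1r mulr1.
  rewrite /cf rcoef_cst rcoef_em mdeg0 mdeg_eq0 mulrC; congr (_%:R * _).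
  by case: (s =P 0%MM) => [->|//]; rewrite eqxx.
have std0 : join_std 0%MM.
  by rewrite join_stdE /bsum !big1 // => i _; rewrite mnm0E muln0.
have algE c : join_gr_alg K h n1 n2 a1 d1 a2 d2 c = \p (cst c) by [].
split.
- move=> c c'; rewrite !algE => /gr_pi_eq/rees_shift_cf/(_ _ std0).
  by rewrite /cf rcoefB -!/(cf _ _) !cst_cf eqxx !mul1r => /subr0_eq.
- move=> x; split=> [[a [p [pE ->]]]|[c ->]]; last first.
    by exists (c%:A), (cst c); rewrite expr0 /= alg_polyC.
  exists (cf 0%MM p); rewrite algE; apply/gr_pi_eq/rees_shift_cf => s ss.
  rewrite /cf rcoefB -!/(cf _ _) cst_cf; have [->|s0] := eqVneq s 0%MM.
    by rewrite mul1r subrr.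
  rewrite mul0r subr0 /cf /rcoef pE coefZ coefXn mdeg_eq0 (negPf s0).
  by rewrite mulr0 ksg_val0 mcoeff0.
- apply: (@flag_linear_resolution gr (@gr_part A mI 1) (@gr_part A mI 2) fsize fgen fcolon).
  + exact: gr_part0.
  + exact: gr_partB.
  + exact: gr_partB.
  + exact: gr_partM.
  + by move=> c _; apply: fgen_part.
  + move=> j x _; pose mt c := ideal_pow1 (@tmU_max K h n1 n2 a1 d1 a2 d2 (fvar c)).
    apply: (gr_flag_lin (mt := mt)) => c _; congr (\p _); apply: val_inj.
    by rewrite em_val mdeg1.
  + by move=> j; rewrite /fcolon /fsize; case: ifP; [lia | case: ifP; lia].
  + by move=> j x; apply: fgen_colon.
  + by [].
  + exact: fgen_irrelevant.
Qed.

End JoinKoszul.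

Theorem theorem5p13 (K : fieldType) (h n1 n2 : nat)
    (a1 d1 a2 d2 : 'X_{1..4})
    (h_ge1 : (1 <= h)%N) (n1_ge2 : (2 <= n1)%N) (n2_ge2 : (2 <= n2)%N)
    (indep : lin_indep a1 d1 a2 d2) :
  let I : {mpoly K[nvars n1 n2]} -> Prop := join_ideal h a1 d1 a2 d2 in
  let P1 := P1 K n1 n2 h in
  let P2 := P2 K n1 n2 h in
  [/\ forall f, I f <-> ideal_add (minors_ideal P1) (minors_ideal P2) f,
      minimal_groebner_basis (neg_degrevlex_gt (join_vars n1 n2)) I
        (minors P1 ++ minors P2),
      join_koszul K h n1 n2 a1 d1 a2 d2
    & minimal_graded_resolution (join_wt h a1 d1 a2 d2)
        (tensor_complex (eagon_northcott P1) (eagon_northcott P2)) I].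
Proof.
move=> I P1 P2.
have -> : P1 = scroll_mx K (n1 + n2).+1 0 n1 h by apply: rnc_scroll.
have -> : P2 = scroll_mx K (n1 + n2).+1 n1.+1 n2 h by apply: rnc_scroll.
split.
- by move=> f; apply: join_ideal_minors.
- exact: join_groebner.
- exact: join_is_koszul.
- exact: join_minimal_resolution.
Qed.
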